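(* Assume $\hat f$ and $\hat g$ have been estimated on an auxiliary data set independent of $(\mathbf X^{(n)},\mathbf Y^{(n)},\mathbf Z^{(n)})$. Let $w:\mathbb R^{d_Z}\to\mathbb R$ be measurable with $|w(z)|\le C$ for all $z$, for some $C>0$. For $P\in\mathcal E_0$ let $\rho_P=\mathbb E_P[\epsilon_P\xi_Pw(Z)]$ and $\sigma_P^2=\operatorname{Var}_P(\epsilon_P\xi_Pw(Z))$. 1. Let $P\in\mathcal E_0$ and assume $A_fA_g=o_P(n^{-1})$, $B_f=o_P(1)$, $B_g=o_P(1)$, $\sigma_P^2>0$ and $\mathbb E_P[\epsilon_P^2\xi_P^2]<\infty$. Then $\sup_{t\in\mathbb R}\big|\mathbb P_P\big(T^{(n)}-\sqrt n\,\rho_P/\tau_D^{(n)}\le t\big)-\Phi(t)\big|\to0$ and $\tau_D^{(n)}-\sigma_P=o_P(1)$. 2. Let $\mathcal P\subset\mathcal E_0$ and assume $A_fA_g=o_{\mathcal P}(n^{-1})$, $B_f=o_{\mathcal P}(1)$, $B_g=o_{\mathcal P}(1)$, $\inf_{P\in\mathcal P}\sigma_P^2>0$ and that there exists $\eta>0$ with $\sup_{P\in\mathcal P}\mathbb E_P[|\epsilon_P\xi_P|^{2+\eta}]<\infty$. Then $\sup_{P\in\mathcal P}\sup_{t\in\mathbb R}\big|\mathbb P_P\big(T^{(n)}-\sqrt n\,\rho_P/\tau_D^{(n)}\le t\big)-\Phi(t)\big|\to0$.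
   Context: Let $X,Y$ be real-valued random variables and $Z$ a random vector in $\mathbb R^{d_Z}$. $\mathcal E_0$ is the set of all distributions of $(X,Y,Z)$ absolutely continuous with respect to Lebesgue measure. For $P\in\mathcal E_0$ let $f_P(z)=\mathbb E_P[X\mid Z=z]$, $g_P(z)=\mathbb E_P[Y\mid Z=z]$, $\epsilon_P=X-f_P(Z)$, $\xi_P=Y-g_P(Z)$, $u_P(z)=\mathbb E_P[\epsilon_P^2\mid Z=z]$, $v_P(z)=\mathbb E_P[\xi_P^2\mid Z=z]$. Let $(x_i,y_i,z_i)$, $i=1,\dots,n$, be i.i.d. copies of $(X,Y,Z)$ forming $(\mathbf X^{(n)},\mathbf Y^{(n)},\mathbf Z^{(n)})$; $\hat f,\hat g$ are estimates of $f_P,g_P$ (regression functions of $X$, resp. $Y$, on $Z$). Define $A_f=\frac1n\sum_{i=1}^n(f_P(z_i)-\hat f(z_i))^2$, $A_g=\frac1n\sum_{i=1}^n(g_P(z_i)-\hat g(z_i))^2$, $B_f=\frac1n\sum_{i=1}^n(f_P(z_i)-\hat f(z_i))^2v_P(z_i)$, $B_g=\frac1n\sum_{i=1}^n(g_P(z_i)-\hat g(z_i))^2u_P(z_i)$. Let $R_i=(x_i-\hat f(z_i))(y_i-\hat g(z_i))w(z_i)$, $\tau_N^{(n)}=\frac1{\sqrt n}\sum_{i=1}^nR_i$, $\tau_D^{(n)}=\big(\frac1n\sum_iR_i^2-(\frac1n\sum_rR_r)^2\big)^{1/2}$, $T^{(n)}=\tau_N^{(n)}/\tau_D^{(n)}$.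 $\Phi$ is the standard normal distribution function. For a family $\mathcal P$, $V_n=o_{\mathcal P}(W_n)$ means $\sup_{P\in\mathcal P}\mathbb P_P(|V_n/W_n|>\delta)\to0$ for all $\delta>0$; $o_P$ is the case $\mathcal P=\{P\}$. *)

(* Defs.v *)
From HB Require Import structures.
From mathcomp Require Import all_boot all_order all_algebra.
From mathcomp Require Import all_classical all_reals all_analysis.
Set Implicit Arguments. Unset Strict Implicit. Unset Printing Implicit Defensive.
Import Order.TTheory GRing.Theory Num.Theory Num.Def.
Import numFieldNormedType.Exports.
Local Open Scope classical_set_scope.
Local Open Scope ring_scope.

Section Defs.
Context {R : realType}.

(** One observation (X, Y, Z) with Z in R^d is a (d+2)-tuple of reals:
    coordinate 0 is X, coordinate 1 is Y, coordinates 2..d+1 form Z.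
    Tuples carry the product (Borel) sigma-algebra of the library. *)
Definition Obs (d : nat) := (d.+2).-tuple R.
Definition Zsp (d : nat) := d.-tuple R.

Definition Xc {d} (o : Obs d) : R := tnth o ord0.
Definition Yc {d} (o : Obs d) : R := tnth o (lift ord0 ord0).
Definition Zc {d} (o : Obs d) : Zsp d := [tuple tnth o (rshift 2 i) | i < d].

Definition box {k} (a b : k.-tuple R) : set (k.-tuple R) :=
  [set x | forall i, tnth a i <= tnth x i <= tnth b i].
Definition lebesgue_null {k} (N : set (k.-tuple R)) : Prop :=
  forall e : R, 0 < e -> exists a b : nat -> k.-tuple R,
    (forall j i, tnth (a j) i <= tnth (b j) i) /\
    N `<=` \bigcup_j box (a j) (b j) /\
    (\sum_(0 <= j <oo) ((\prod_(i < k) (tnth (b j) i - tnth (a j) i))%:E)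
       <= e%:E)%E.

Definition in_E0 {d} (P : probability (Obs d) R) : Prop :=
  forall N, measurable N -> lebesgue_null N -> P N = 0%E.

Definition cond_exp {d} (P : probability (Obs d) R) (h : Obs d -> R)
    (c : Zsp d -> R) : Prop :=
  measurable_fun setT c /\ P.-integrable setT (EFin \o h) /\
  forall B : set (Zsp d), measurable B ->
    (\int[P]_(o in Zc @^-1` B) (h o)%:E = \int[P]_(o in Zc @^-1` B) (c (Zc o))%:E)%E.

Definition cond_exp_nonneg {d} (P : probability (Obs d) R) (h : Obs d -> R)
    (c : Zsp d -> R) : Prop :=
  measurable_fun setT c /\ (forall z, 0 <= c z) /\
  forall B : set (Zsp d), measurable B ->
    (\int[P]_(o in Zc @^-1` B) (h o)%:E = \int[P]_(o in Zc @^-1` B) (c (Zc o))%:E)%E.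

Definition eps {d} (fP : Zsp d -> R) (o : Obs d) : R := Xc o - fP (Zc o).
Definition xi {d} (gP : Zsp d -> R) (o : Obs d) : R := Yc o - gP (Zc o).

Definition regr_functions {d} (P : probability (Obs d) R)
    (fP gP uP vP : Zsp d -> R) : Prop :=
  cond_exp P Xc fP /\ cond_exp P Yc gP /\
  cond_exp_nonneg P (fun o => eps fP o ^+ 2) uP /\
  cond_exp_nonneg P (fun o => xi gP o ^+ 2) vP.

Definition rho {d} (P : probability (Obs d) R) (fP gP : Zsp d -> R)
    (w : Zsp d -> R) : R :=
  fine (expectation P (fun o => eps fP o * xi gP o * w (Zc o))).
Definition sigma2 {d} (P : probability (Obs d) R) (fP gP : Zsp d -> R)
    (w : Zsp d -> R) : R :=
  fine (variance P (fun o => eps fP o * xi gP o * w (Zc o))).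

Definition Phi (t : R) : R := fine (normal_prob 0 1 `]-oo, t]).

Definition iid_indep_aux {dO dA} {Om : measurableType dO} {d}
    {Aux : measurableType dA} (P : probability (Obs d) R)
    (Pr : probability Om R) (n : nat) (obs : nat -> Om -> Obs d)
    (aux : Om -> Aux) : Prop :=
  (forall i, (i < n)%N -> forall B, measurable B -> Pr (obs i @^-1` B) = P B) /\
  (forall (B : nat -> set (Obs d)) (A : set Aux),
     (forall i, measurable (B i)) -> measurable A ->
     Pr (aux @^-1` A `&` \bigcap_(i in `I_n) (obs i @^-1` B i)) =
     (Pr (aux @^-1` A) * \prod_(i < n) Pr (obs i @^-1` B i))%E).

Section sample.
Variables (d n : nat) (obs : nat -> Obs d) (fh gh w : Zsp d -> R).
Definition Ri (i : nat) : R :=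
  (Xc (obs i) - fh (Zc (obs i))) * (Yc (obs i) - gh (Zc (obs i))) * w (Zc (obs i)).
Definition tauN : R := (Num.sqrt n%:R)^-1 * \sum_(i < n) Ri i.
Definition tauD : R :=
  Num.sqrt (n%:R^-1 * \sum_(i < n) Ri i ^+ 2 - (n%:R^-1 * \sum_(i < n) Ri i) ^+ 2).
Definition Tstat : R := tauN / tauD.
Definition Af (fP : Zsp d -> R) : R :=
  n%:R^-1 * \sum_(i < n) (fP (Zc (obs i)) - fh (Zc (obs i))) ^+ 2.
Definition Ag (gP : Zsp d -> R) : R :=
  n%:R^-1 * \sum_(i < n) (gP (Zc (obs i)) - gh (Zc (obs i))) ^+ 2.
Definition Bf (fP vP : Zsp d -> R) : R :=
  n%:R^-1 * \sum_(i < n) (fP (Zc (obs i)) - fh (Zc (obs i))) ^+ 2 * vP (Zc (obs i)).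
Definition Bg (gP uP : Zsp d -> R) : R :=
  n%:R^-1 * \sum_(i < n) (gP (Zc (obs i)) - gh (Zc (obs i))) ^+ 2 * uP (Zc (obs i)).
End sample.

(** Uniform convergence to 0 over a family of nonnegative quantities:
    sup_{P in fam} a P n -> 0 as n -> oo (written in epsilon form so that
    the empty family is handled as in the paper, sup over empty = 0). *)
Definition unif_cvg0 {d} (fam : set (probability (Obs d) R))
    (a : probability (Obs d) R -> nat -> \bar R) : Prop :=
  forall e : R, 0 < e -> \forall n \near \oo, forall P, fam P -> (a P n <= e%:E)%E.

Definition little_o_fam {dO} {Om : measurableType dO} {d}
    (fam : set (probability (Obs d) R))
    (Pr : probability (Obs d) R -> nat -> probability Om R)
    (V W : probability (Obs d) R -> nat -> Om -> R) : Prop :=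
  forall delta : R, 0 < delta ->
    unif_cvg0 fam (fun P n => Pr P n [set om | delta < `|V P n om / W P n om|]).

Definition KSdist {dO} {Om : measurableType dO} (Pr : probability Om R)
    (S : Om -> R) : \bar R :=
  ereal_sup [set (`|fine (Pr [set om | S om <= t]) - Phi t|)%:E | t in [set: R]].

End Defs.

(* Main.v *)
Require Import Defs.
From HB Require Import structures.
From mathcomp Require Import all_boot all_order all_algebra.
From mathcomp Require Import all_classical all_reals all_analysis.
From mathcomp Require Import measurable_realfun.
From mathcomp Require Import ring lra.
Import Order.TTheory GRing.Theory Num.Theory Num.Def.
Import numFieldNormedType.Exports.
Local Open Scope classical_set_scope.
Local Open Scope ring_scope.

(** Writing a = f - fhat, b = g - ghat, each R_i is eps_i xi_i w_i plus the
    error a_i b_i w_i + a_i xi_i w_i + b_i eps_i w_i.  The product term is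
    controlled by Cauchy-Schwarz and A_f A_g = o(1/n).  For a cross term,
    truncate on the event {B_f <= eta}, which depends only on the auxiliary data
    and on Z_1, ..., Z_n: integrating one observation at a time, the summands
    1_{B_f <= eta} a_i w_i xi_i are orthogonal and the sum of their second
    moments is at most n C^2 eta, so Markov's inequality applies.  Hence R_i may
    be replaced by eps_i xi_i w_i in the numerator and in the empirical standard
    deviation, uniformly in P.  For the standardized
    Y = (eps xi w - rho) / sigma, a truncated weak law of large numbers gives
    tau_D / sigma -> 1.  The central limit theorem is Lindeberg's argument run
    along the heat flow: F(s, x) = Phi((t - x) / sqrt s) satisfies
    F_s = F_xx / 2, so E F(s_k, S_k) with s_k = s_0 + 1 - k / n is almost constant
    in the number k of summands; it goes from Phi(t / sqrt(s_0 + 1)) at k = 0 to a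
    smoothed P(S_n <= t) at k = n.  All bounds depend on P only through
    E[Y^2; |Y| > K], and are uniform in t since x Phi'(x) is bounded. *)

Set Implicit Arguments. Unset Strict Implicit. Unset Printing Implicit Defensive.

(** * Independence of one observation from the rest of the sample *)

(** The noises are known only to be integrable: [cond_exp_nonneg] allows E eps^2 and E xi^2 to be
    infinite, and the fitted functions need have no moments, so the cross terms may lack a second
    moment before truncation. The cut at B_f <= eta gives them one, since on that event a single (f
    - fhat)^2 v is at most n eta. The event couples all the summands, but through the Z_i and the
    auxiliary data alone, so each noise keeps conditional mean zero given everything else. This is
    why independence is phrased between one observation and the [rest] of the sample, and why
    conditioning appears as identities between integrals of nonnegative functions, which keep their
    meaning when both sides are infinite. The Lindeberg remainder min(z^2, |z|^3) costs only a
    second moment. Both parts of the theorem thus reduce to one statement about a family with a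
    common positive lower bound on sigma and uniformly integrable squares of the standardized score:
    a single law has these by dominated convergence, a family by its moment of order 2 + eta. *)

Section prodlaw.
Context {R : realType} {dO dS dT : measure_display}
  {Om : measurableType dO} {S : measurableType dS} {T : measurableType dT}.
Local Open Scope ereal_scope.

(* Taking [D = setT]: [X] has law [P]; it is moreover independent of [V]. *)
Definition prodlaw (Q : probability Om R) (P : probability S R) (X : Om -> S)
    (V : Om -> T) :=
  forall B D, measurable B -> measurable D ->
    Q (X @^-1` B `&` V @^-1` D) = P B * Q (V @^-1` D).

(** The rectangle identity determines the law of [(X, V)] as the product of [P] and the law of [V];
    the rest is Tonelli. *)
Lemma prodlaw_integral Q P X V (Psi : S * T -> \bar R) :
  measurable_fun setT X -> measurable_fun setT V -> prodlaw Q P X V ->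
  measurable_fun [set: S * T] Psi -> (forall x, 0 <= Psi x) ->
  \int[Q]_om Psi (X om, V om) = \int[Q]_om \int[P]_o Psi (o, V om).
Proof.
move=> mX mV QPXV mPsi Psi0.
pose XV om := (X om, V om).
have mXV : measurable_fun setT XV by exact: measurable_fun_pair.
pose fXV : {mfun Om >-> (S * T)%type} :=
  HB.pack XV (isMeasurableFun.Build _ _ _ _ _ mXV).
pose fV : {mfun Om >-> T} := HB.pack V (isMeasurableFun.Build _ _ _ _ _ mV).
transitivity (\int[distribution Q fXV]_z Psi z).
  by rewrite ge0_integral_pushforward.
transitivity (\int[P \x distribution Q fV]_z Psi z).
  apply: eq_measure_integral => A mA _.
  apply/esym/product_measure_unique => // B D mB mD; exact: QPXV.
rewrite fubini_tonelli2// ge0_integral_pushforward//.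
- exact: measurable_fun_fubini_tonelli_G.
- by move=> y _; apply: integral_ge0.
Qed.

Lemma prodlaw_comp dT' (T' : measurableType dT') Q P X V (phi : T -> T') :
  measurable_fun setT phi -> prodlaw Q P X V ->
  forall B D, measurable B -> measurable D ->
    Q (X @^-1` B `&` (phi \o V) @^-1` D) = P B * Q ((phi \o V) @^-1` D).
Proof.
move=> mphi QPXV B D mB mD; rewrite comp_preimage QPXV//.
by rewrite -[X in measurable X]setTI; exact: mphi.
Qed.

End prodlaw.

Section rest.
Context {R : realType} {dO dA : measure_display} {Om : measurableType dO}
  {Aux : measurableType dA} {d : nat}.
Variables (P : probability (@Obs R d) R) (Q : probability Om R) (n : nat)
  (obs : nat -> Om -> @Obs R d) (aux : Om -> Aux).
Hypothesis mobs : forall i, measurable_fun setT (obs i).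
Hypothesis maux : measurable_fun setT aux.
Local Open Scope ereal_scope.
Hypothesis iid : iid_indep_aux P Q n obs aux.

(** Overwriting coordinate [i] by the constant [point] keeps the length [n] of the tuple and removes
    all information on observation [i]. *)
Definition rest (i : nat) (om : Om) : Aux * n.-tuple (@Obs R d) :=
  (aux om, [tuple if (j : nat) == i then point else obs j om | j < n]).

Lemma measurable_rest (i : nat) : measurable_fun setT (rest i).
Proof.
apply: measurable_fun_pair => //; apply/measurable_fun_tnthP => j.
rewrite (_ : _ \o _ = fun om => if (j : nat) == i then point else obs j om); last first.
  by apply/funext => om /=; rewrite tnth_mktuple.
by case: eqP => _; [exact: measurable_cst|exact: mobs].
Qed.

Let mpre i B : measurable B -> measurable (obs i @^-1` B).
Proof. by move=> mB; rewrite -[X in measurable X]setTI; exact: mobs. Qed.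

(** For fixed [B], both sides are finite measures in [D]. They agree on measurable cylinder
    rectangles, a pi-system generating the product sigma-algebra, hence everywhere. *)
Lemma rest_prodlaw i : (i < n)%N -> prodlaw Q P (obs i) (rest i).
Proof.
move=> ni B D mB mD.
have mB' := mpre i mB.
pose fr : {mfun Om >-> (Aux * n.-tuple (@Obs R d))%type} :=
  HB.pack (rest i) (isMeasurableFun.Build _ _ _ _ _ (@measurable_rest i)).
pose r : {nonneg R} := NngNum (fine_ge0 (measure_ge0 P B)).
pose m1 := pushforward (mrestr Q mB') fr.
pose m2 := mscale r (distribution Q fr).
pose G := [set E | exists A : set Aux, exists C : nat -> set (@Obs R d),
   [/\ measurable A, forall j, measurable (C j) &
     E = A `*` [set t : n.-tuple (@Obs R d) | forall j : 'I_n, C j (tnth t j)]]].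
have rE : (fine (P B))%:E = P B by rewrite fineK// fin_num_measure.
have m1E E : m1 E = Q (fr @^-1` E `&` obs i @^-1` B) by [].
have m2E E : m2 E = P B * Q (fr @^-1` E).
  by rewrite /m2 /mscale /= /pushforward /= rE.
suff : m1 D = m2 D by rewrite m1E m2E setIC.
have mG : G `<=` measurable.
  move=> _ [A [C [mA mC ->]]]; apply: measurableX => //.
  rewrite (_ : mkset _ = \bigcap_(j in [set: 'I_n]) (fun t : n.-tuple (@Obs R d) => tnth t j) @^-1` C j).
    apply: fin_bigcap_measurable => // j _.
    by rewrite -[X in measurable X]setTI; exact: measurable_tnth.
  by apply/seteqP; split => t /= h j; [move=> _|]; exact: h.
(* [G] generates: every coordinate projection, hence the identity, is measurable from the
   sigma-algebra generated by [G]. *)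
have sG : <<s G >> D.
  have mid : measurable_fun setT (id : g_sigma_algebraType G -> Aux * n.-tuple (@Obs R d)).
    apply/measurable_fun_pairP; split.
      move=> _ A mA; rewrite setTI; apply: sub_sigma_algebra.
      exists A, (fun=> setT); split => //.
      by apply/seteqP; split => -[a t] //= [].
    apply/measurable_fun_tnthP => j.
    move=> _ C mC; rewrite setTI; apply: sub_sigma_algebra.
    exists setT, (fun k : nat => if k == j :> nat then C else setT); split => //.
      by move=> k; case: eqP.
    apply/seteqP; split => -[a t] /=.
      by move=> Ct; split => // k; case: eqP => // /val_inj ->.
    by move=> [_ /(_ j)]; rewrite eqxx.
  by have := mid measurableT _ mD; rewrite setTI.
apply: (@g_sigma_algebra_measure_unique _ _ _ G mG (fun=> setT)) => //.
- move=> _; exists setT, (fun=> setT); split => //.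
  by apply/seteqP; split => -[].
- by apply/seteqP; split => // x _; exists 0%N.
- move=> _ _ [A [C [mA mC ->]]] [A' [C' [mA' mC' ->]]].
  exists (A `&` A'), (fun j => C j `&` C' j); split => //.
  + exact: measurableI.
  + by move=> j; exact: measurableI.
  + apply/seteqP; split => -[a t] /=.
      by move=> [[? h] [? h']].
    by move=> [[? ?] h]; do 2?split => //; move=> j; have [] := h j.
- move=> _ [A [C [mA mC ->]]].
  have [law ind] := iid.
  (* At coordinate [i] the tuple holds [point], so the constraint [C i] is either void or
     impossible; [setT] or [set0] expresses this as an event on observation [i]. *)
  pose C1 j := if j == i then (if `[< C i point >] then setT else set0) else C j.
  have mC1 j : measurable (C1 j).
    by rewrite /C1; case: eqP => // _; case: ifP.
  have fE : fr @^-1` (A `*` [set t : n.-tuple (@Obs R d) | forall j : 'I_n, C j (tnth t j)]) =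
      aux @^-1` A `&` \bigcap_(j in `I_n) (obs j @^-1` C1 j).
    apply/seteqP; split => om /=.
      move=> [Aom h]; split => // j /= jn.
      have := h (Ordinal jn); rewrite tnth_mktuple/= /C1.
      by case: eqP => // -> /asboolP ->.
    move=> [Aom h]; split => // j; rewrite tnth_mktuple.
    have := h j (ltn_ord j); rewrite /C1; case: eqP => // ->.
    by case: asboolP.
  transitivity (m1 (A `*` [set t : n.-tuple (@Obs R d) | forall j : 'I_n, C j (tnth t j)])) => //.
  transitivity (m2 (A `*` [set t : n.-tuple (@Obs R d) | forall j : 'I_n, C j (tnth t j)])) => //.
  rewrite m1E m2E fE.
  (* Moving [B] into slot [i] turns the left side into one product event, to which the independence
     hypothesis applies. *)
  pose C2 j := if j == i then B `&` C1 i else C1 j.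
  have mC2 j : measurable (C2 j).
    by rewrite /C2; case: eqP => // _; exact: measurableI.
  have -> : aux @^-1` A `&` \bigcap_(j in `I_n) (obs j @^-1` C1 j) `&` obs i @^-1` B
    = aux @^-1` A `&` \bigcap_(j in `I_n) (obs j @^-1` C2 j).
    apply/seteqP; split => om /=.
      move=> [[Aom h] Bom]; split => // j /= jn; rewrite /C2.
      by case: eqP => [E|_]; [split; rewrite ?E//; exact: (h i)|exact: h].
    move=> [Aom h]; split; first split => // j /= jn.
      by have := h j jn; rewrite /C2; case: eqP => [->|//] [].
    by have := h i ni; rewrite /C2 eqxx => -[].
  rewrite !ind//.
  rewrite [in LHS](bigD1 (Ordinal ni))//= [in RHS](bigD1 (Ordinal ni))//=.
  rewrite [in LHS](eq_bigr (fun j : 'I_n => Q (obs j @^-1` C1 j))); last first.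
    by move=> j ji; rewrite /C2; case: eqP => // E; case/eqP: ji; apply/val_inj.
  rewrite /C2 eqxx /C1 eqxx.
  have <- : Q (obs i @^-1` B) = P B by exact: law.
  case: ifP => _.
    by rewrite setIT preimage_setT probability_setT mul1e muleCA.
  by rewrite setI0 preimage_set0 measure0 !mul0e !mule0.
- move=> _; change (m1 setT < +oo); rewrite m1E preimage_setT setTI.
  exact: le_lt_trans (probability_le1 Q mB') (ltry 1).
Qed.

End rest.

(** * Integrating out one observation *)

(** Splits a signed product into nonnegative products, for which identities between possibly
    infinite integrals are available. *)
Lemma maxr0M (R : realDomainType) (a b : R) :
  Num.max (a * b) 0 =
  Num.max a 0 * Num.max b 0 + Num.max (- a) 0 * Num.max (- b) 0.
Proof.
have maxp (x : R) : 0 <= x -> (Num.max x 0 = x) * (Num.max (- x) 0 = 0).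
  by move=> x0; split; [apply/max_idPl|apply/max_idPr; rewrite oppr_le0].
have maxn (x : R) : x <= 0 -> (Num.max x 0 = 0) * (Num.max (- x) 0 = - x).
  by move=> x0; split; [apply/max_idPr|apply/max_idPl; rewrite oppr_ge0].
have [a0|/ltW a0] := leP 0 a; have [b0|/ltW b0] := leP 0 b.
- by rewrite !(maxp a)// !(maxp b)// mulr0 addr0; apply/max_idPl/mulr_ge0.
- rewrite !(maxp a)// !(maxn b)// mulr0 mul0r addr0.
  by apply/max_idPr/mulr_ge0_le0.
- rewrite !(maxn a)// !(maxp b)// mulr0 mul0r addr0.
  by apply/max_idPr/mulr_le0_ge0.
- rewrite !(maxn a)// !(maxn b)// mul0r add0r mulrNN.
  by apply/max_idPl/mulr_le0.
Qed.

Section cond.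
Context {R : realType} {dS dZ : measure_display}
  {S : measurableType dS} {Z : measurableType dZ}.
Local Open Scope ereal_scope.
Variables (P : probability S R) (pi : S -> Z) (h1 h2 : S -> R).
Hypotheses (mpi : measurable_fun setT pi) (mh1 : measurable_fun setT h1)
  (mh2 : measurable_fun setT h2).
Hypotheses (h10 : forall o, (0 <= h1 o)%R) (h20 : forall o, (0 <= h2 o)%R).
Hypothesis h12 : forall B, measurable B ->
  \int[P]_(o in pi @^-1` B) (h1 o)%:E = \int[P]_(o in pi @^-1` B) (h2 o)%:E.

Import HBNNSimple.

Let nnsfun_integral (h : S -> R) (f : {nnsfun Z >-> R}) :
  measurable_fun setT h -> (forall o, (0 <= h o)%R) ->
  \int[P]_o (f (pi o) * h o)%:E =
  \sum_(k \in range f) k%:E * \int[P]_(o in pi @^-1` (f @^-1` [set k])) (h o)%:E.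
Proof.
move=> mh h0.
have mfk k : measurable (pi @^-1` (f @^-1` [set k])).
  by rewrite -[X in measurable X]setTI; apply: mpi.
transitivity (\int[P]_o (\sum_(k \in range f)
    (k%:E * ((\1_(f @^-1` [set k]) (pi o))%:E * (h o)%:E)))).
  apply: eq_integral => o _; rewrite EFinM fimfunE -fsumEFin//.
  rewrite !fsbig_finite//= ge0_sume_distrl; last first.
    by move=> k _; rewrite EFinM nnfun_muleindic_ge0.
  by apply: eq_bigr => k _; rewrite EFinM muleA.
have mt k : measurable_fun setT (fun o => (\1_(f @^-1` [set k]) (pi o))%:E * (h o)%:E).
  by apply: emeasurable_funM; apply/measurable_EFinP => //; apply: measurableT_comp.
rewrite ge0_integral_fsum//; last 2 first.
- by move=> k; exact: measurable_funeM.
- move=> k o _; rewrite muleA; apply: mule_ge0; last by rewrite lee_fin.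
  exact: nnfun_muleindic_ge0.
apply: eq_fsbigr => k; rewrite inE => -[z _ <-].
rewrite ge0_integralZl//; last 2 first.
- by move=> o _; rewrite mule_ge0// lee_fin.
- by rewrite lee_fin.
congr (_ * _); rewrite [RHS]integral_mkcond.
apply: eq_integral => o _; rewrite patchE indicE.
have -> : (pi o \in f @^-1` [set f z]) = (o \in pi @^-1` (f @^-1` [set f z])).
  by apply/idP/idP; rewrite !inE.
by case: ifP => _; rewrite ?mul1e ?mul0e.
Qed.

Lemma cond_integral_eq (H : Z -> R) : measurable_fun setT H ->
  (forall z, (0 <= H z)%R) ->
  \int[P]_o (H (pi o) * h1 o)%:E = \int[P]_o (H (pi o) * h2 o)%:E.
Proof.
move=> mH H0.
have mEH : measurable_fun [set: Z] (EFin \o H) by exact/measurable_EFinP.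
pose f := nnsfun_approx measurableT mEH.
have fcvg (h : S -> R) : measurable_fun setT h -> (forall o, (0 <= h o)%R) ->
    \int[P]_o (f n (pi o) * h o)%:E @[n --> \oo] --> \int[P]_o (H (pi o) * h o)%:E.
  move=> mh h0.
  rewrite [X in _ --> X](_ : _ = \int[P]_o limn (fun n => (f n (pi o) * h o)%:E)); last first.
    apply: eq_integral => o _; apply/esym/cvg_lim => //.
    rewrite (_ : (fun _ => _) = (fun n => (f n (pi o))%:E * (h o)%:E)); last first.
      by apply/funext => n; rewrite EFinM.
    rewrite EFinM; apply: cvgeZr => //.
    by apply: (@cvg_nnsfun_approx _ _ _ _ measurableT _ mEH) => // z _; rewrite lee_fin.
  apply: cvg_monotone_convergence => //.
  - move=> n; apply/measurable_EFinP/measurable_funM => //.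
    exact: measurableT_comp.
  - by move=> n o _; rewrite lee_fin mulr_ge0.
  - move=> o _ m n mn; rewrite lee_fin ler_wpM2r//.
    by move: mn => /(nd_nnsfun_approx measurableT mEH) /lefP.
have := fcvg h1 mh1 h10.
rewrite (_ : (fun _ => _) = fun n => \int[P]_o (f n (pi o) * h2 o)%:E); last first.
  apply/funext => n; rewrite !nnsfun_integral//; apply: eq_fsbigr => k _.
  by congr (_ * _); apply: h12.
by move=> /cvg_unique; apply => //; exact: fcvg.
Qed.

End cond.

Section peel.
Context {R : realType} {dO dS dT dZ : measure_display}
  {Om : measurableType dO} {S : measurableType dS} {T : measurableType dT}
  {Z : measurableType dZ}.
Local Open Scope ereal_scope.
Variables (Q : probability Om R) (P : probability S R) (X : Om -> S)
  (V : Om -> T) (pi : S -> Z).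
Hypotheses (mX : measurable_fun setT X) (mV : measurable_fun setT V)
  (mpi : measurable_fun setT pi) (QPXV : prodlaw Q P X V).

(** Once [V] is frozen by independence, [H] is a weight in [pi (X om)] alone, so [cond_integral_eq]
    applies under the outer integral. *)
Lemma prodlaw_cond_integral (h1 h2 : S -> R) (H : Z * T -> R) :
  measurable_fun setT h1 -> measurable_fun setT h2 ->
  (forall o, (0 <= h1 o)%R) -> (forall o, (0 <= h2 o)%R) ->
  (forall B, measurable B ->
    \int[P]_(o in pi @^-1` B) (h1 o)%:E = \int[P]_(o in pi @^-1` B) (h2 o)%:E) ->
  measurable_fun [set: Z * T] H -> (forall z, (0 <= H z)%R) ->
  \int[Q]_om (H (pi (X om), V om) * h1 (X om))%:E =
  \int[Q]_om (H (pi (X om), V om) * h2 (X om))%:E.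
Proof.
move=> mh1 mh2 h10 h20 h12 mH H0.
have mPsi (h : S -> R) : measurable_fun setT h ->
    measurable_fun [set: S * T] (fun p => (H (pi p.1, p.2) * h p.1)%:E).
  move=> mh; apply/measurable_EFinP/measurable_funM; last exact: measurableT_comp.
  apply: (measurableT_comp mH); apply: measurable_fun_pair => //.
  exact: measurableT_comp.
rewrite (prodlaw_integral (Psi := fun p => (H (pi p.1, p.2) * h1 p.1)%:E) mX mV QPXV)//;
  [|exact: mPsi|by move=> x; rewrite lee_fin mulr_ge0].
rewrite (prodlaw_integral (Psi := fun p => (H (pi p.1, p.2) * h2 p.1)%:E) mX mV QPXV)//;
  [|exact: mPsi|by move=> x; rewrite lee_fin mulr_ge0].
apply: eq_integral => om _ /=.
apply: (cond_integral_eq mpi mh1 mh2 h10 h20 h12 (H := fun z => H (z, V om))) => //.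
by apply: (measurableT_comp mH); exact: measurable_fun_pair.
Qed.

(** The hypothesis on the positive and negative parts of [h] says that [h] has conditional mean zero
    given [pi]. Through [maxr0M] it makes the two parts of the integrand have equal integrals;
    integrability of the product makes their difference legitimate. *)
Lemma prodlaw_cond_integral0 (h : S -> R) (H : Z * T -> R) :
  measurable_fun setT h ->
  (forall B, measurable B ->
    \int[P]_(o in pi @^-1` B) (h^\+%R o)%:E = \int[P]_(o in pi @^-1` B) (h^\-%R o)%:E) ->
  measurable_fun [set: Z * T] H ->
  Q.-integrable setT (fun om => (H (pi (X om), V om) * h (X om))%:E) ->
  \int[Q]_om (H (pi (X om), V om) * h (X om))%:E = 0.
Proof.
move=> mh hpn mH iHh.
have HX : measurable_fun setT (fun om => (pi (X om), V om)).
  by apply: measurable_fun_pair => //; exact: measurableT_comp.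
have mHp := measurable_funrpos mH; have mHn := measurable_funrneg mH.
have mhp := measurable_funrpos mh; have mhn := measurable_funrneg mh.
have E1 := prodlaw_cond_integral mhp mhn (funrpos_ge0 h) (funrneg_ge0 h) hpn mHp (funrpos_ge0 H).
have E2 := prodlaw_cond_integral mhp mhn (funrpos_ge0 h) (funrneg_ge0 h) hpn mHn (funrneg_ge0 H).
have meas (a : Z * T -> R) (b : S -> R) : measurable_fun [set: Z * T] a ->
    measurable_fun setT b ->
    measurable_fun setT (fun om => (a (pi (X om), V om) * b (X om))%:E).
  move=> ma mb; apply/measurable_EFinP/measurable_funM; last exact: measurableT_comp.
  exact: (measurableT_comp ma).
set F := fun om => (H (pi (X om), V om) * h (X om))%:E in iHh *.
have Fp : F^\+ = (fun om => (H^\+%R (pi (X om), V om) * h^\+%R (X om))%:E +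
   (H^\-%R (pi (X om), V om) * h^\-%R (X om))%:E).
  apply/funext => om.
  by rewrite funeposE /F /funrpos /funrneg -EFinD -EFin_max maxr0M.
have Fn : F^\- = (fun om => (H^\-%R (pi (X om), V om) * h^\+%R (X om))%:E +
   (H^\+%R (pi (X om), V om) * h^\-%R (X om))%:E).
  apply/funext => om.
  by rewrite funenegE /F /funrpos /funrneg -EFinD -EFin_max -mulNr maxr0M opprK.
have FE : \int[Q]_om F^\+ om = \int[Q]_om F^\- om.
  rewrite Fp Fn !ge0_integralD//;
    try (by move=> om _; rewrite lee_fin mulr_ge0 ?funrpos_ge0 ?funrneg_ge0);
    try exact: meas.
  by rewrite E1 E2 addeC.
rewrite integralE FE subee// -FE.
exact: integrable_pos_fin_num.
Qed.

End peel.

(** * Taylor bounds *)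

Section calculus.
Context {R : realType}.
Implicit Types (f df ddf : R -> R) (x y h M : R).

Lemma mean_value f df x y : (forall z : R, is_derive z 1 f (df z)) ->
  exists2 c, `|c - x| <= `|y - x| & f y - f x = df c * (y - x).
Proof.
move=> fdf.
have cf a b : {within `[a, b], continuous f}.
  apply: continuous_subspaceT => z.
  by apply/differentiable_continuous/derivable1_diffP; have [] := fdf z.
have [xy|/ltW yx] := leP x y.
  have [c /[!in_itv]/= /andP[xc cy] E] := MVT_segment xy (fun z _ => fdf z) (cf x y).
  by exists c => //; rewrite !ger0_norm ?subr_ge0// lerD2r.
have [c /[!in_itv]/= /andP[yc cx] E] := MVT_segment yx (fun z _ => fdf z) (cf y x).
exists c; last by rewrite -[LHS]opprB E -mulrN opprB.
by rewrite !ler0_norm ?subr_le0// lerN2 lerD2r.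
Qed.

(** One integration from 0 by the mean value theorem; the constant stays [M] instead of becoming M /
    (k + 1). *)
Lemma le_norm_exp_primitive f df M k : (forall z : R, is_derive z 1 f (df z)) -> f 0 = 0 ->
  (forall z, `|df z| <= M * `|z| ^+ k) -> forall h, `|f h| <= M * `|h| ^+ k.+1.
Proof.
move=> fdf f0 dfM h; have [c cz] := mean_value 0 h fdf.
rewrite f0 !subr0 in cz * => ->; rewrite normrM exprSr mulrA ler_wpM2r//.
have M0 : 0 <= M by have := dfM 1; rewrite normr1 expr1n mulr1; exact: le_trans.
by rewrite (le_trans (dfM c))// ler_wpM2l// lerXn2r ?nnegrE.
Qed.

Lemma taylor2_cubic f df ddf (dddf : R -> R) M x h :
  (forall z : R, is_derive z 1 f (df z)) -> (forall z : R, is_derive z 1 df (ddf z)) ->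
  (forall z : R, is_derive z 1 ddf (dddf z)) -> (forall z, `|dddf z| <= M) ->
  `|f (x + h) - f x - h * df x - 2^-1 * h ^+ 2 * ddf x| <= M * `|h| ^+ 3.
Proof.
move=> d1 d2 d3 dM.
have shift (g dg : R -> R) (z : R) : (forall z : R, is_derive z 1 g (dg z)) ->
    is_derive z 1 (fun z : R => g (x + z)) (dg (x + z)).
  move=> gdg; have := @is_derive1_comp _ g (fun z => x + z) z (dg (x + z)) 1 (gdg _).
  rewrite mulr1; apply.
  by have := is_deriveD (is_derive_cst x z 1) (is_derive_id z 1); rewrite add0r.
have ddB z : `|ddf (x + z) - ddf x| <= M * `|z| ^+ 1.
  have [c _] := mean_value x (x + z) d3.
  by rewrite addrAC subrr add0r => ->; rewrite normrM expr1 ler_wpM2r.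
have dB : forall z, `|df (x + z) - df x - z * ddf x| <= M * `|z| ^+ 2.
  apply: (@le_norm_exp_primitive _ (fun z => ddf (x + z) - ddf x)) => //.
    move=> z; apply: is_deriveB; last first.
      by have := is_deriveM (is_derive_id z 1) (is_derive_cst (ddf x) z 1);
        rewrite /GRing.scale/= mulr0 mulr1 add0r.
    by have := is_deriveB (shift _ _ z d2) (is_derive_cst (df x) z 1); rewrite subr0.
  by rewrite addr0 subrr mul0r subr0.
move: h; apply: (@le_norm_exp_primitive _ (fun z => df (x + z) - df x - z * ddf x)) => //.
  move=> z; apply: is_deriveB; last first.
    have H := is_deriveM (is_deriveM (is_derive_cst (2^-1 : R) z 1) (is_deriveX 2 (is_derive_id z 1))) (is_derive_cst (ddf x) z 1).
    apply: (is_derive_eq H).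
    by rewrite /GRing.scale/=; field.
  apply: is_deriveB; last first.
    by have := is_deriveM (is_derive_id z 1) (is_derive_cst (df x) z 1);
      rewrite /GRing.scale/= mulr0 mulr1 add0r.
  by have := is_deriveB (shift _ _ z d1) (is_derive_cst (f x) z 1); rewrite subr0.
by rewrite addr0 subrr mul0r expr0n mulr0 mul0r !subr0.
Qed.

(** The same remainder as in [taylor2_cubic], now for large increments: the smaller of the two
    bounds is integrable under a second moment. *)
Lemma taylor2_quadratic f df ddf M x h :
  (forall z : R, is_derive z 1 f (df z)) -> (forall z : R, is_derive z 1 df (ddf z)) ->
  (forall z, `|ddf z| <= M) ->
  `|f (x + h) - f x - h * df x - 2^-1 * h ^+ 2 * ddf x| <= 2 * M * `|h| ^+ 2.
Proof.
move=> d1 d2 dM.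
have M0 : 0 <= M by exact: le_trans (dM 0).
have hE : x + h - x = h by rewrite addrAC subrr add0r.
have [c cx] := mean_value x (x + h) d1; rewrite hE in cx * => ->.
have [c' _ c'E] := mean_value x c d2.
rewrite (_ : _ - _ = h * (ddf c' * (c - x)) - 2^-1 * h ^+ 2 * ddf x); last first.
  by rewrite -c'E; ring.
have -> : 2 * M * `|h| ^+ 2 = M * `|h| ^+ 2 + M * `|h| ^+ 2 by ring.
rewrite (le_trans (ler_normB _ _))// lerD//.
  rewrite !normrM expr2 mulrCA ler_pM// ?mulr_ge0//.
  by rewrite ler_wpM2l.
rewrite normrM mulrC ler_pM// normrM normrX ger0_norm ?invr_ge0//.
by rewrite ler_piMl// ?exprn_ge0// invf_le1// ler1n.
Qed.

End calculus.

(** * The Gaussian distribution function and the heat equation *)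

Section gauss.
Context {R : realType}.
Implicit Types x y h t s : R.
Local Notation phi := (normal_pdf (0 : R) 1).

Lemma std_normal_pdfE x : phi x = normal_peak 1 * expR (- (2^-1 * x ^+ 2)).
Proof.
rewrite normal_pdfE ?oner_eq0// /normal_fun subr0 expr1n; congr (_ * expR _).
by field.
Qed.

Lemma is_derive_Phi x : is_derive x 1 (@Phi R) (phi x).
Proof.
have cphi : {for x, continuous phi} by apply: continuous_normal_pdf; rewrite oner_eq0.
have iphi : lebesgue_measure.-integrable [set` Interval -oo%O (BRight (x + 1))] (EFin \o phi).
  by apply: (integrableS measurableT) => //; exact: integrable_normal_pdf.
have [] := @continuous_FTC1 R phi -oo%O x (x + 1) _ iphi _ cphi.
- by rewrite ltrDl.
- by rewrite ltNyr.
move=> d1; rewrite derive1E => d2.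
by apply: DeriveDef => //.
Qed.

Lemma is_derive_std_normal_pdf x : is_derive x 1 phi (- x * phi x).
Proof.
rewrite (_ : phi = fun x => normal_peak 1 * expR (- (2^-1 * x ^+ 2))); last first.
  by apply/funext => y; rewrite std_normal_pdfE.
have H1 := is_deriveN (is_deriveM (is_derive_cst (2^-1 : R) x 1) (is_deriveX 2 (is_derive_id x 1))).
have H2 := @is_derive1_comp _ expR _ x _ _ (is_derive_expR _) H1.
have H3 := is_deriveM (is_derive_cst (normal_peak 1 : R) x 1) H2.
apply: (is_derive_eq H3).
rewrite /GRing.scale/= !fctE/=; by field.

Qed.

Lemma normal_peak1_le1 : normal_peak (1 : R) <= 1.
Proof.
have p2 := @pi_ge2 R.
have p0 : 0 < 1 ^+ 2 * pi *+ 2 :> R by rewrite expr1n mul1r -mulr_natl; lra.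
rewrite /normal_peak invf_le1 ?sqrtr_gt0// -[leLHS]sqrtr1 ler_sqrt ?ltW//.
by rewrite expr1n mul1r -mulr_natl; lra.
Qed.

(* [exp(x^2/2) >= (1 + x^2/4)^2] dominates every power of [x] up to the fourth. *)
Lemma normr_exp_std_normal_pdf k x : (k <= 4)%N -> `|x| ^+ k * phi x <= 17.
Proof.
move=> k4.
have e0 : 0 < expR (- (2^-1 * x ^+ 2)) by exact: expR_gt0.
(* The term x^4 / 16 of the expanded square calls for a constant of at least 16, whence 17. *)
have x4 : `|x| ^+ k <= 17 * (1 + x ^+ 2 / 4) ^+ 2.
  have xk : `|x| ^+ k <= 1 + `|x| ^+ 4.
    have [x1|/ltW x1] := leP `|x| 1.
      by rewrite (@le_trans _ _ 1)// ?exprn_ile1// lerDl exprn_ge0.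
    by rewrite (@le_trans _ _ (`|x| ^+ 4))// ?ler_weXn2l// lerDr.
  apply: (le_trans xk); rewrite (exprM _ 2 2) real_normK ?num_real//.
  have := sqr_ge0 x; set q := x ^+ 2 => q0; nra.
rewrite std_normal_pdfE.
have q0 : 0 <= x ^+ 2 / 4 by rewrite divr_ge0// sqr_ge0.
have eE : (1 + x ^+ 2 / 4) ^+ 2 * expR (- (2^-1 * x ^+ 2)) <= 1.
  rewrite expRN ler_pdivrMr ?expR_gt0// mul1r.
  rewrite (_ : 2^-1 * x ^+ 2 = x ^+ 2 / 4 + x ^+ 2 / 4); last by field.
  rewrite expRD -expr2 lerXn2r ?nnegrE ?expR_ge0//; last exact: expR_ge1Dx.
  by rewrite addr_ge0.
apply: (@le_trans _ _ (17 * ((1 + x ^+ 2 / 4) ^+ 2 * expR (- (2^-1 * x ^+ 2))))); last by lra.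
rewrite mulrA ler_pM ?mulr_ge0 ?normal_peak_ge0 ?expR_ge0 ?exprn_ge0//.
by rewrite ler_piMl ?expR_ge0// normal_peak1_le1.
Qed.

Lemma std_normal_pdf_ge0 x : 0 <= phi x. Proof. exact: normal_pdf_ge0. Qed.

Let nb k x : (k <= 4)%N -> `|x ^+ k * phi x| <= 17.
Proof.
move=> k4; rewrite normrM normrX (ger0_norm (std_normal_pdf_ge0 _)).
exact: normr_exp_std_normal_pdf.
Qed.

Section space.
Variables (l t : R).
Hypothesis l0 : 0 < l.
Let y x := l * (t - x).

Let dy x : is_derive x 1 y (- l).
Proof.
have H := is_deriveM (is_derive_cst l x 1) (is_deriveB (is_derive_cst t x 1) (is_derive_id x 1)).
by apply: (is_derive_eq H); rewrite /GRing.scale/=; ring.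
Qed.

(** Here l stands for s^(-1/2). With y = l (t - x), every space derivative is a power of l times
    terms y^k phi(y), hence bounded uniformly in [t] and [x]. *)
Lemma heat_dx x : is_derive x 1 (fun x => Phi (l * (t - x))) (- l * phi (l * (t - x))).
Proof.
have H := @is_derive1_comp _ (@Phi R) y x _ _ (is_derive_Phi _) (dy x).
by apply: (is_derive_eq H); rewrite /y mulrC.
Qed.

Let dphi x : is_derive x 1 (fun x => phi (y x)) (l * (y x * phi (y x))).
Proof.
have H := @is_derive1_comp _ phi y x _ _ (is_derive_std_normal_pdf _) (dy x).
by apply: (is_derive_eq H); ring.
Qed.

Lemma heat_dxx x : is_derive x 1 (fun x => - l * phi (l * (t - x)))
  (- l ^+ 2 * (l * (t - x) * phi (l * (t - x)))).
Proof.
have H := is_deriveM (is_derive_cst (- l) x 1) (dphi x).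
by apply: (is_derive_eq H); rewrite /GRing.scale/= /y; ring.
Qed.

Lemma heat_dxxx x : is_derive x 1 (fun x => - l ^+ 2 * (l * (t - x) * phi (l * (t - x))))
  (l ^+ 3 * (phi (l * (t - x)) - (l * (t - x)) ^+ 2 * phi (l * (t - x)))).
Proof.
have H := is_deriveM (is_derive_cst (- l ^+ 2) x 1) (is_deriveM (dy x) (dphi x)).
by apply: (is_derive_eq H); rewrite /GRing.scale/= /y; ring.
Qed.

Lemma heat_dxx_le x : `|- l ^+ 2 * (l * (t - x) * phi (l * (t - x)))| <= 17 * l ^+ 2.
Proof.
rewrite normrM normrN (ger0_norm (sqr_ge0 _)) mulrC ler_wpM2r ?sqr_ge0//.
by have := @nb 1 (l * (t - x)) isT; rewrite expr1.
Qed.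

Lemma heat_dxxx_le x :
  `|l ^+ 3 * (phi (l * (t - x)) - (l * (t - x)) ^+ 2 * phi (l * (t - x)))| <= 34 * l ^+ 3.
Proof.
rewrite normrM (ger0_norm (exprn_ge0 _ (ltW l0))) mulrC ler_wpM2r ?(exprn_ge0 _ (ltW l0))//.
rewrite (le_trans (ler_normB _ _))// (_ : 34 = 17 + 17); last by ring.
rewrite lerD//; last exact: nb.
by have := @nb 0 (l * (t - x)) isT; rewrite expr0 mul1r.
Qed.

End space.

Section time.
Variable (x : R).
Let lam (s : R) := (Num.sqrt s)^-1.

Let dlam s : 0 < s -> is_derive s 1 lam (- (2^-1 * lam s ^+ 3)).
Proof.
move=> s0; have r0 : Num.sqrt s != 0 by rewrite gt_eqF// sqrtr_gt0.
have H := is_deriveV r0 (is_derive1_sqrt s0).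
by apply: (is_derive_eq H); rewrite /GRing.scale/= /lam; field.
Qed.

Let dlx s : 0 < s -> is_derive s 1 (fun s => lam s * x) (- (2^-1 * lam s ^+ 2) * (lam s * x)).
Proof.
move=> s0; have H := is_deriveM (dlam s0) (is_derive_cst x s 1).
by apply: (is_derive_eq H); rewrite /GRing.scale/=; ring.
Qed.

(** With [x] in the place of t - x, the right side is half the value in [heat_dxx]: this is the heat
    equation. *)
Lemma heat_dt s : 0 < s -> is_derive s 1 (fun s => Phi ((Num.sqrt s)^-1 * x))
  (- 2^-1 * ((Num.sqrt s)^-1 ^+ 2 * ((Num.sqrt s)^-1 * x * phi ((Num.sqrt s)^-1 * x)))).
Proof.
move=> s0; have H := @is_derive1_comp _ (@Phi R) (fun s => lam s * x) s _ _ (is_derive_Phi _) (dlx s0).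
by apply: (is_derive_eq H); rewrite /lam; ring.
Qed.

(** The function differentiated is -F_xx. Its variation in time is the error made by freezing F_xx
    during one step. *)
Lemma heat_dtxx s : 0 < s ->
  is_derive s 1 (fun s => (Num.sqrt s)^-1 ^+ 2 * ((Num.sqrt s)^-1 * x * phi ((Num.sqrt s)^-1 * x)))
  ((Num.sqrt s)^-1 ^+ 4 * (2^-1 * (((Num.sqrt s)^-1 * x) ^+ 3 * phi ((Num.sqrt s)^-1 * x))
       - 3 / 2 * ((Num.sqrt s)^-1 * x * phi ((Num.sqrt s)^-1 * x)))).
Proof.
move=> s0.
have H1 := @is_derive1_comp _ phi (fun s => lam s * x) s _ _ (is_derive_std_normal_pdf _) (dlx s0).
have H := is_deriveM (is_deriveX 2 (dlam s0)) (is_deriveM (dlx s0) H1).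
apply: (is_derive_eq H); rewrite /GRing.scale/= !fctE/= /lam; set l := (Num.sqrt s)^-1. by field.
Qed.

(** The constant is 17 (1/2 + 3/2) = 34. *)
Lemma heat_dtxx_le s s0 : 0 < s0 -> s0 <= s ->
  `|(Num.sqrt s)^-1 ^+ 4 * (2^-1 * (((Num.sqrt s)^-1 * x) ^+ 3 * phi ((Num.sqrt s)^-1 * x))
       - 3 / 2 * ((Num.sqrt s)^-1 * x * phi ((Num.sqrt s)^-1 * x)))| <= 34 * s0 ^- 2.
Proof.
move=> s00 s0s; have sp := lt_le_trans s00 s0s.
rewrite normrM mulrC ler_pM//.
  rewrite (le_trans (ler_normB _ _))// !normrM !(ger0_norm (_ : 0 <= 2^-1)) ?invr_ge0// (ger0_norm (_ : 0 <= 3))//.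
  have := @nb 3 ((Num.sqrt s)^-1 * x) isT.
  have := @nb 1 ((Num.sqrt s)^-1 * x) isT.
  rewrite expr1 !normrM; lra.
rewrite ger0_norm ?exprn_ge0 ?invr_ge0 ?sqrtr_ge0// exprVn (exprM _ 2 2) sqr_sqrtr ?(ltW sp)//.
by rewrite lef_pV2 ?posrE ?exprn_gt0// lerXn2r// nnegrE ltW.
Qed.

End time.

Lemma mean_value_gt0 (f df : R -> R) a b : 0 < a -> a <= b ->
  (forall z : R, 0 < z -> is_derive z 1 f (df z)) ->
  exists2 c, a <= c <= b & f b - f a = df c * (b - a).
Proof.
move=> a0 ab fdf.
have [||c] := @MVT_segment R f df a b ab.
- by move=> z /[!in_itv]/= /andP[az _]; apply: fdf; exact: lt_trans az.
- apply: continuous_in_subspaceT => z /[!inE]/= /[!in_itv]/= /andP[az _].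
  apply/differentiable_continuous/derivable1_diffP.
  by have [] := fdf z (lt_le_trans a0 az).
- by rewrite in_itv/=; exists c.
Qed.

(* The time increment [- h] cancels against [E z^2 = h] because
   [Phi ((t - x) / sqrt s)] solves [F_s = F_xx / 2]. *)
Lemma heat_step s0 : 0 < s0 -> exists A B : R, [/\ 0 <= A, 0 <= B &
  forall s h t x, 0 <= h -> s0 <= s - h -> exists D1 D2 : R, forall z,
   `|Phi ((Num.sqrt (s - h))^-1 * (t - (x + z))) - Phi ((Num.sqrt s)^-1 * (t - x))
     - z * D1 - 2^-1 * (z ^+ 2 - h) * D2| <=
   A * Num.min (z ^+ 2) (`|z| ^+ 3) + B * h ^+ 2].
Proof.
move=> s00; pose l0 := (Num.sqrt s0)^-1.
have l00 : 0 < l0 by rewrite invr_gt0 sqrtr_gt0.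
(* [34 * l0 ^+ 2] is the quadratic Taylor constant 2 * 17, [34 * l0 ^+ 3] the cubic one.
   [17 * s0 ^- 2] is half the bound of [heat_dtxx_le], as F_s is half of F_xx. *)
exists (34 * l0 ^+ 2 + 34 * l0 ^+ 3), (17 * s0 ^- 2).
have A2 : 0 <= 34 * l0 ^+ 2 by rewrite mulr_ge0// exprn_ge0// ltW.
have A3 : 0 <= 34 * l0 ^+ 3 by rewrite mulr_ge0// exprn_ge0// ltW.
split; first by rewrite addr_ge0.
  by rewrite mulr_ge0// invr_ge0 exprn_ge0// ltW.
move=> s h t x h0 s0s; have sh0 := lt_le_trans s00 s0s.
pose l := (Num.sqrt (s - h))^-1.
have l0' : 0 < l by rewrite invr_gt0 sqrtr_gt0.
have ll0 : l <= l0 by rewrite lef_pV2 ?posrE ?sqrtr_gt0// ler_sqrt// ltW.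
have ll0n n : l ^+ n <= l0 ^+ n by rewrite lerXn2r// nnegrE ltW.
(* [D1] and [D2] are F_x and F_xx at time s - h. The space expansion is made at that time; the mean
   value theorem in time, used twice, carries F(s, x) to it with an error of order h^2. *)
exists (- l * normal_pdf 0 1 (l * (t - x))),
  (- l ^+ 2 * (l * (t - x) * normal_pdf 0 1 (l * (t - x)))) => z.
have T3 := taylor2_cubic x z (heat_dx l t) (heat_dxx l t) (heat_dxxx l t) (heat_dxxx_le t l0').
have T2 := taylor2_quadratic x z (heat_dx l t) (heat_dxx l t) (heat_dxx_le l t).
pose K s := (Num.sqrt s)^-1 ^+ 2 * ((Num.sqrt s)^-1 * (t - x) * phi ((Num.sqrt s)^-1 * (t - x))).
have hs : s - h <= s by rewrite lerBlDr lerDl.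
have [c /andP[cl cr] cE] := mean_value_gt0 sh0 hs (heat_dt (t - x)).
have [c' /andP[cl' cr'] c'E] := mean_value_gt0 sh0 cl (heat_dtxx (t - x)).
have K'le := heat_dtxx_le (t - x) s00 (le_trans s0s cl').
have KB : `|2^-1 * h * (K c - K (s - h))| <= 17 * s0 ^- 2 * h ^+ 2.
  rewrite /K c'E normrM [X in _ * X]normrM (ger0_norm (_ : 0 <= 2^-1 * h)) ?mulr_ge0 ?invr_ge0//.
  rewrite (ger0_norm (_ : 0 <= c - (s - h))) ?subr_ge0//.
  rewrite (_ : 17 * _ * _ = 2^-1 * h * ((34 * s0 ^- 2) * h)); last by field; rewrite gt_eqF.
  rewrite ler_wpM2l ?mulr_ge0 ?invr_ge0// ler_pM// ?subr_ge0//.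
  by rewrite lerBlDr addrC subrK.
pose Tay := Phi (l * (t - (x + z))) - Phi (l * (t - x)) - z * (- l * phi (l * (t - x)))
   - 2^-1 * z ^+ 2 * (- l ^+ 2 * (l * (t - x) * phi (l * (t - x)))).
have -> : Phi (l * (t - (x + z))) - Phi ((Num.sqrt s)^-1 * (t - x))
   - z * (- l * phi (l * (t - x)))
   - 2^-1 * (z ^+ 2 - h) * (- l ^+ 2 * (l * (t - x) * phi (l * (t - x)))) =
   Tay + 2^-1 * h * (K c - K (s - h)).
  have -> : Phi ((Num.sqrt s)^-1 * (t - x)) = Phi (l * (t - x)) - 2^-1 * K c * h.
    have -> : - (2^-1 * K c * h) = - 2^-1 * K c * (s - (s - h)) by ring.
    by rewrite -cE -/l; ring.
  by rewrite /Tay /K -/l; ring.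
rewrite (le_trans (ler_normD _ _))// lerD//.
rewrite /Num.min; case: ifP => _.
  rewrite (le_trans T2)// real_normK ?num_real// ler_wpM2r ?sqr_ge0//.
  rewrite (le_trans (_ : _ <= 34 * l0 ^+ 2)) ?lerDl//.
  by rewrite mulrA -natrM ler_wpM2l.
rewrite (le_trans T3)// ler_wpM2r ?exprn_ge0//.
rewrite (le_trans (_ : _ <= 34 * l0 ^+ 3)) ?lerDr//.
by rewrite ler_wpM2l.
Qed.

Lemma Phi_ge0 t : 0 <= Phi t. Proof. by rewrite fine_ge0. Qed.

Lemma Phi_le1 t : Phi t <= 1.
Proof.
by rewrite -lee_fin fineK ?fin_num_measure// probability_le1.
Qed.

Lemma le_Phi x y : x <= y -> Phi x <= Phi y.
Proof.
move=> xy; rewrite fine_le ?fin_num_measure// le_measure ?inE//.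
by apply: subset_itvl; rewrite bnd_simp.
Qed.

Lemma measurable_Phi : measurable_fun setT (@Phi R).
Proof. by apply: nondecreasing_measurable => // x y; exact: le_Phi. Qed.

Lemma Phi_lipschitz x y : `|Phi y - Phi x| <= 17 * `|y - x|.
Proof.
have [c _ ->] := mean_value x y is_derive_Phi.
rewrite normrM ler_wpM2r// ger0_norm ?std_normal_pdf_ge0//.
by have := @normr_exp_std_normal_pdf 0 c isT; rewrite expr0 mul1r.
Qed.

(** Since [dl] is at most 1/2, the intermediate point satisfies |x| <= 2 |c|, so the growth of |x|
    is absorbed by |c| phi(c) <= 17. *)
Lemma Phi_scale_lipschitz dl x y : 0 <= dl <= 2^-1 -> `|y - x| <= dl * `|x| ->
  `|Phi y - Phi x| <= 34 * dl.
Proof.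
move=> /andP[dl0 dl1] yx.
have [c cx ->] := mean_value x y is_derive_Phi.
have xc : `|x| <= 2 * `|c|.
  have : `|x| <= `|c| + `|c - x|.
    by have := ler_normB c (c - x); rewrite subKr.
  have := normr_ge0 x; nra.
have := @normr_exp_std_normal_pdf 1 c isT; rewrite expr1 => pc.
rewrite normrM (ger0_norm (std_normal_pdf_ge0 _)).
have := std_normal_pdf_ge0 c; set p := phi c in pc * => p0.
rewrite (@le_trans _ _ (p * (dl * (2 * `|c|))))//; last nra.
by rewrite ler_wpM2l// (le_trans yx)// ler_wpM2l.
Qed.

(** [Phi] is the distribution function of the identity under the normal law, so its limits at both
    infinities are those of a distribution function. *)
Lemma Phi_tails (e : R) : 0 < e -> exists2 M : R, 0 <= M & Phi (- M) <= e /\ 1 - Phi M <= e.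
Proof.
move=> e0.
pose idR : measurableTypeR R -> R := idfun.
have mid : measurable_fun setT idR by exact: measurable_id.
pose X : {RV (normal_prob (0:R) 1) >-> R} :=
  HB.pack idR (isMeasurableFun.Build _ _ _ _ idR mid).
have cp : Phi x @[x --> +oo] --> (1 : R) by have /fine_cvgP[_] := cvg_cdfy1 X.
have cn : Phi x @[x --> -oo] --> (0 : R) by have /fine_cvgP[_] := cvg_cdfNy0 X.
have cn' : Phi (- x) @[x --> +oo] --> (0 : R) by move/cvgNy_compNP : cn.
move/cvgrPdist_le : cp => /(_ e e0) cp; move/cvgrPdist_le : cn' => /(_ e e0) cn'.
near (pinfty_nbhs R) => M.
exists M; first by near: M; exact: nbhs_pinfty_ge.
split.
  have : `|0 - Phi (- M)| <= e by near: M.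
  by rewrite sub0r normrN ger0_norm ?Phi_ge0.
have : `|1 - Phi M| <= e by near: M.
by rewrite ger0_norm ?subr_ge0 ?Phi_le1.
Unshelve. all: by end_near. Qed.

End gauss.

(** * Lindeberg steps and the central limit theorem *)

Section prob_facts.
Context {R : realType} {d : measure_display} {T : measurableType d}.
Variable P : probability T R.
Implicit Types f g : T -> R.

Lemma integrable_cst_probability (c : R) : P.-integrable setT (EFin \o (fun=> c)).
Proof. exact: (finite_measure_integrable_cst P c measurableT). Qed.

Lemma integrable_addr f g : P.-integrable setT (EFin \o f) ->
  P.-integrable setT (EFin \o g) -> P.-integrable setT (EFin \o (fun x => f x + g x)).
Proof. exact: integrableD. Qed.

Lemma integrable_subr f g : P.-integrable setT (EFin \o f) ->
  P.-integrable setT (EFin \o g) -> P.-integrable setT (EFin \o (fun x => f x - g x)).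
Proof. exact: integrableB. Qed.

Lemma integrable_mulr (c : R) f : P.-integrable setT (EFin \o f) ->
  P.-integrable setT (EFin \o (fun x => c * f x)).
Proof. exact: integrableZl. Qed.

Lemma dominated_integrable f g : measurable_fun setT f ->
  (forall x, `|f x| <= g x) -> P.-integrable setT (EFin \o g) ->
  P.-integrable setT (EFin \o f).
Proof.
move=> mf fg; apply: le_integrable => //; first exact/measurable_EFinP.
by move=> x _ /=; rewrite lee_fin (le_trans (fg x))// ler_norm.
Qed.

Lemma bounded_integrable f (M : R) : measurable_fun setT f ->
  (forall x, `|f x| <= M) -> P.-integrable setT (EFin \o f).
Proof.
move=> mf fM; apply: (dominated_integrable mf fM).
exact: integrable_cst_probability.
Qed.

Lemma Rintegral_cst_probability (c : R) : \int[P]_x c = c.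
Proof. by rewrite Rintegral_cst//= probability_setT mulr1. Qed.

Lemma Rintegral_fineK f : P.-integrable setT (EFin \o f) ->
  (\int[P]_x (f x)%:E = (\int[P]_x f x)%R%:E)%E.
Proof. by move=> fi; rewrite fineK//; exact: integrable_fin_num. Qed.

Lemma le_Rintegral_cst f (c : R) : P.-integrable setT (EFin \o f) ->
  (forall x, f x <= c) -> \int[P]_x f x <= c.
Proof.
move=> fi fc; rewrite -[leRHS]Rintegral_cst_probability le_Rintegral//.
exact: integrable_cst_probability.
Qed.

Lemma normr_Rintegral_le f (c : R) : P.-integrable setT (EFin \o f) ->
  (forall x, `|f x| <= c) -> `|\int[P]_x f x| <= c.
Proof.
move=> fi fc; rewrite (le_trans (le_normr_Rintegral measurableT fi))//.
by apply: le_Rintegral_cst => //; exact: integrable_norm.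
Qed.

End prob_facts.

Section lindeberg_step.
Context {R : realType} {dO dS : measure_display} {Om : measurableType dO}
  {S : measurableType dS}.
Variables (Q : probability Om R) (P : probability S R).

(** With [W] frozen by independence, [D1] and [D2] are constants, and the terms z D1 and (z^2 - h)
    D2 integrate to zero because [Z] has mean 0 and second moment [h]. Only the remainder
    survives. *)
Lemma lindeberg_step (A B s h t : R) (X : Om -> S) (W : Om -> R) (Z : S -> R) :
  (forall x, exists D1 D2 : R, forall z,
     `|Phi ((Num.sqrt (s - h))^-1 * (t - (x + z))) - Phi ((Num.sqrt s)^-1 * (t - x))
       - z * D1 - 2^-1 * (z ^+ 2 - h) * D2| <=
     A * Num.min (z ^+ 2) (`|z| ^+ 3) + B) -> 
  0 <= A ->
  measurable_fun setT X -> measurable_fun setT W -> measurable_fun setT Z ->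
  prodlaw Q P X W ->
  P.-integrable setT (fun o => (Z o ^+ 2)%:E) ->
  \int[P]_o Z o = 0 -> \int[P]_o (Z o ^+ 2) = h ->
  `|\int[Q]_om Phi ((Num.sqrt (s - h))^-1 * (t - (W om + Z (X om))))
    - \int[Q]_om Phi ((Num.sqrt s)^-1 * (t - W om))| <=
  A * (\int[P]_o Num.min (Z o ^+ 2) (`|Z o| ^+ 3)) + B.
Proof.
move=> taylor A0 mX mW mZ QP iZ2 Z0 Z2.
set c := leRHS.
have mlin (d' : measure_display) (T : measurableType d') (f : T -> R) (l : R) :
    measurable_fun setT f -> measurable_fun setT (fun x => Phi (l * (t - f x))).
  move=> mf; apply: (measurableT_comp measurable_Phi).
  by apply: measurable_funM => //; apply: measurable_funB.
have Phi1 x : `|Phi x| <= 1 :> R by rewrite ger0_norm ?Phi_ge0 ?Phi_le1.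
have iPhi (d' : measure_display) (T : measurableType d') (Pb : probability T R) (f : T -> R) (l : R) :
    measurable_fun setT f -> Pb.-integrable setT (EFin \o (fun x => Phi (l * (t - f x)))).
  by move=> mf; apply: (@bounded_integrable _ _ _ _ _ 1) => //; exact: mlin.
pose G (p : S * R) := Phi ((Num.sqrt (s - h))^-1 * (t - (p.2 + Z p.1))).
have mG : measurable_fun [set: S * R] G.
  by apply: mlin; apply: measurable_funD => //; exact: measurableT_comp.
(* The conditional expectation of the new smoothed value given W = v. *)
pose j (v : R) := \int[P]_o G (o, v).
have jE v : (\int[P]_o (G (o, v))%:E = (j v)%:E)%E.
  rewrite Rintegral_fineK//; apply: iPhi; exact: measurable_funD.
have mj : measurable_fun setT j.
  have mG' : measurable_fun [set: S * R] (EFin \o G) by exact/measurable_EFinP.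
  have G0 p : (0 <= (EFin \o G) p)%E by rewrite lee_fin Phi_ge0.
  apply/measurable_EFinP.
  rewrite (_ : EFin \o j = fun v => (\int[P]_o (EFin \o G) (o, v))%E).
    exact: (measurable_fun_fubini_tonelli_G (m1 := P) (EFin \o G) mG' G0).
  by apply/funext => v; rewrite /= -jE.
have iZ : P.-integrable setT (EFin \o Z).
  apply: (@dominated_integrable _ _ _ _ _ (fun o => 1 + Z o ^+ 2)) => //.
    move=> o; have := sqr_ge0 (`|Z o| - 1); rewrite sqrrB real_normK ?num_real//.
    have := normr_ge0 (Z o); have := sqr_ge0 (Z o); lra.
  by apply: integrable_addr => //; exact: integrable_cst_probability.
have imin : P.-integrable setT (EFin \o (fun o => Num.min (Z o ^+ 2) (`|Z o| ^+ 3))).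
  apply: (@dominated_integrable _ _ _ _ _ (fun o => Z o ^+ 2)) => //.
    apply/measurable_minr; first exact: measurable_funX.
    by apply: measurable_funX; apply: measurableT_comp.
  move=> o; rewrite ger0_norm ?ge_min ?lexx//.
  by rewrite le_min sqr_ge0 exprn_ge0.
have jv v : `|j v - Phi ((Num.sqrt s)^-1 * (t - v))| <= c.
  have [D1 [D2 tay]] := taylor v.
  set p := Phi _ in tay *.
  have iG : P.-integrable setT (EFin \o (fun o => G (o, v))).
    by apply: iPhi; exact: measurable_funD.
  have iZD : P.-integrable setT (EFin \o (fun o => Z o * D1)).
    by under eq_fun do rewrite mulrC; exact: integrable_mulr.
  have iZ2h : P.-integrable setT (EFin \o (fun o => Z o ^+ 2 - h)).
    by apply: integrable_subr => //; exact: integrable_cst_probability.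
  have iZ2h' : P.-integrable setT (EFin \o (fun o => 2^-1 * (Z o ^+ 2 - h))).
    exact: integrable_mulr.
  have iq : P.-integrable setT (EFin \o (fun o => 2^-1 * (Z o ^+ 2 - h) * D2)).
    by under eq_fun do rewrite mulrC; exact: integrable_mulr.
  have ip : P.-integrable setT (EFin \o (fun=> p)) by exact: integrable_cst_probability.
  have iGp : P.-integrable setT (EFin \o (fun o => G (o, v) - p)).
    exact: integrable_subr.
  have iGpZ : P.-integrable setT (EFin \o (fun o => G (o, v) - p - Z o * D1)).
    exact: integrable_subr.
  have ir : P.-integrable setT (EFin \o (fun o => G (o, v) - p - Z o * D1 - 2^-1 * (Z o ^+ 2 - h) * D2)).
    exact: integrable_subr.
  have -> : j v - p = \int[P]_o (G (o, v) - p - Z o * D1 - 2^-1 * (Z o ^+ 2 - h) * D2).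
    rewrite RintegralB// RintegralB// RintegralB// Rintegral_cst_probability.
    rewrite RintegralZr// Z0 mul0r subr0.
    rewrite [X in _ = _ - X](_ : _ = 0) ?subr0//.
    rewrite RintegralZr// RintegralZl// RintegralB//; last first.
      exact: integrable_cst_probability.
    by rewrite Z2 Rintegral_cst_probability subrr mulr0 mul0r.
  rewrite (le_trans (le_normr_Rintegral measurableT ir))//.
  have iAm : P.-integrable setT (EFin \o (fun o => A * Num.min (Z o ^+ 2) (`|Z o| ^+ 3))).
    exact: integrable_mulr.
  rewrite /c -RintegralZl// -[X in _ + X](Rintegral_cst_probability P) -RintegralD//; last first.
    exact: integrable_cst_probability.
  rewrite le_Rintegral//.
  - exact: integrable_norm.
  - by apply: integrable_addr => //; exact: integrable_cst_probability.
  - by move=> o _; exact: tay.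
have -> : \int[Q]_om Phi ((Num.sqrt (s - h))^-1 * (t - (W om + Z (X om)))) =
    \int[Q]_om j (W om).
  have mPsi : measurable_fun [set: S * R] (EFin \o G) by exact/measurable_EFinP.
  have := prodlaw_integral mX mW QP mPsi (fun p => _ : 0 <= _)%E.
  rewrite /= /Rintegral => ->; last by move=> p; rewrite lee_fin Phi_ge0.
  by congr fine; apply: eq_integral => om _; rewrite jE.
have c0 : 0 <= c by exact: le_trans (normr_ge0 _) (jv 0).
have mjW : measurable_fun setT (fun om => j (W om)) by exact: measurableT_comp.
have ijW : Q.-integrable setT (EFin \o (fun om => j (W om))).
  apply: (@bounded_integrable _ _ _ _ _ (c + 1)) => // om.
  rewrite -[X in `|X|](subrK (Phi ((Num.sqrt s)^-1 * (t - W om)))).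
  by rewrite (le_trans (ler_normD _ _))// lerD.
have iPW : Q.-integrable setT (EFin \o (fun om => Phi ((Num.sqrt s)^-1 * (t - W om)))).
  exact: iPhi.
rewrite -RintegralB//; apply: normr_Rintegral_le => //.
exact: integrable_subr.
Qed.

End lindeberg_step.

Section clt.
Context {R : realType} {dO dS : measure_display} {Om : measurableType dO}
  {S : measurableType dS}.

(** This is n times the mean of min(z^2, |z|^3) at z = Y / sqrt n, that is, the remainder
    accumulated over the [n] steps. *)
Definition lindeberg_moment (P : probability S R) (Y : S -> R) (n : nat) : R :=
  \int[P]_o Num.min (Y o ^+ 2) (`|Y o| ^+ 3 / Num.sqrt n%:R).

Definition nsum (X : nat -> Om -> S) (Y : S -> R) (n k : nat) (om : Om) : R :=
  \sum_(i < k) Y (X i om) / Num.sqrt n%:R.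

(** The independence clause is what one Lindeberg step consumes: the k-th variable against the sum
    of its predecessors. *)
Definition clt_data (Q : probability Om R) (P : probability S R) (n : nat)
    (X : nat -> Om -> S) (Y : S -> R) :=
  [/\ forall i, measurable_fun setT (X i), measurable_fun setT Y,
     forall k, (k < n)%N -> prodlaw Q P (X k) (nsum X Y n k),
     P.-integrable setT (fun o => (Y o ^+ 2)%:E) &
     \int[P]_o Y o = 0 /\ \int[P]_o (Y o ^+ 2) = 1].

Lemma measurable_nsum X Y n k : (forall i, measurable_fun setT (X i)) ->
  measurable_fun setT Y -> measurable_fun setT (nsum X Y n k).
Proof.
move=> mX mY; apply: measurable_sum => i.
by apply: measurable_funM => //; exact: measurableT_comp.
Qed.

(** Each of the [n] steps of length 1 / n costs A m / n + B / n^2, with m the Lindeberg moment. [A]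
    and [B] are chosen before the law, the sample size and [t], which gives the uniformity. *)
Lemma lindeberg_telescope (s0 : R) : 0 < s0 -> exists A B : R, [/\ 0 <= A, 0 <= B &
  forall Q P n X Y t, (0 < n)%N -> clt_data Q P n X Y ->
  `|\int[Q]_om Phi ((Num.sqrt s0)^-1 * (t - nsum X Y n n om))
    - Phi ((Num.sqrt (s0 + 1))^-1 * t)| <= A * lindeberg_moment P Y n + B / n%:R].
Proof.
move=> s00; have [A [B [A0 B0 step]]] := heat_step s00.
exists A, B; split=> // Q P n X Y t n0 [mX mY ind iY2 [EY EY2]].
have n0R : 0 < n%:R :> R by rewrite ltr0n.
have r0 : 0 < Num.sqrt n%:R :> R by rewrite sqrtr_gt0.
have r2 : Num.sqrt n%:R ^+ 2 = n%:R :> R by rewrite sqr_sqrtr// ltW.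
set m := lindeberg_moment P Y n.
pose h : R := n%:R^-1.
have h0 : 0 <= h by rewrite invr_ge0 ltW.
pose sk k : R := s0 + 1 - k%:R * h.
pose Z o := Y o / Num.sqrt n%:R.
have mZ : measurable_fun setT Z by exact: measurable_funM.
have Z2E o : Z o ^+ 2 = h * Y o ^+ 2 by rewrite expr_div_n r2 mulrC.
have iZ2 : P.-integrable setT (EFin \o (fun o => Z o ^+ 2)).
  under eq_fun do rewrite Z2E; exact: integrable_mulr.
have iY : P.-integrable setT (EFin \o Y).
  apply: (@dominated_integrable _ _ _ _ _ (fun o => 1 + Y o ^+ 2)) => //.
    move=> o; have := sqr_ge0 (`|Y o| - 1); rewrite sqrrB real_normK ?num_real//.
    have := normr_ge0 (Y o); have := sqr_ge0 (Y o); lra.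
  by apply: integrable_addr => //; exact: integrable_cst_probability.
have EZ : \int[P]_o Z o = 0 by rewrite RintegralZr// EY mul0r.
have EZ2 : \int[P]_o (Z o ^+ 2) = h.
  by under eq_Rintegral do rewrite Z2E; rewrite RintegralZl// EY2 mulr1.
have imin : P.-integrable setT (EFin \o (fun o => Num.min (Y o ^+ 2) (`|Y o| ^+ 3 / Num.sqrt n%:R))).
  apply: (@dominated_integrable _ _ _ _ _ (fun o => Y o ^+ 2)) => //.
    apply/measurable_minr; first exact: measurable_funX.
    by apply: measurable_funM => //; apply: measurable_funX; apply: measurableT_comp.
  move=> o; rewrite ger0_norm ?ge_min ?lexx//.
  by rewrite le_min sqr_ge0/= divr_ge0 ?sqrtr_ge0// exprn_ge0.
have mZE : \int[P]_o Num.min (Z o ^+ 2) (`|Z o| ^+ 3) = h * m.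
  rewrite /m /lindeberg_moment -RintegralZl//; apply: eq_Rintegral => o _.
  rewrite minr_pMr// -Z2E; congr Num.min.
  rewrite normrM normfV (ger0_norm (ltW r0)) expr_div_n [Num.sqrt n%:R ^+ 3]exprS r2 /h.
  by field; rewrite !gt_eqF.
suff H k : (k <= n)%N ->
    `|\int[Q]_om Phi ((Num.sqrt (sk k))^-1 * (t - nsum X Y n k om))
      - Phi ((Num.sqrt (s0 + 1))^-1 * t)| <= k%:R * (A * (h * m) + B * h ^+ 2).
  have := H n (leqnn _); rewrite /sk /h mulfV ?gt_eqF// addrK => /le_trans; apply.
  by rewrite le_eqVlt; apply/orP; left; apply/eqP; field; rewrite gt_eqF.
elim: k => [_|k IH kn].
  rewrite /sk mul0r subr0 mul0r.
  under eq_Rintegral do rewrite /nsum big_ord0 subr0.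
  by rewrite Rintegral_cst_probability subrr normr0.
have skS : sk k.+1 = sk k - h by rewrite /sk -natr1; ring.
(* As k + 1 <= n, the remaining time never drops below [s0], where the bounds of [heat_step]
   hold. *)
have s0k : s0 <= sk k - h.
  rewrite -skS /sk -addrA lerDl subr_ge0 /h ler_pdivrMr// mul1r ler_nat//.
rewrite -natr1 mulrDl mul1r.
rewrite -(subrK (\int[Q]_om Phi ((Num.sqrt (sk k))^-1 * (t - nsum X Y n k om))) (\int[Q]_om Phi ((Num.sqrt (sk k.+1))^-1 * (t - nsum X Y n k.+1 om)))).
rewrite -addrA addrC (le_trans (ler_normD _ _))// lerD ?IH ?(ltnW kn)//.
have -> : \int[Q]_om Phi ((Num.sqrt (sk k.+1))^-1 * (t - nsum X Y n k.+1 om)) =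
  \int[Q]_om Phi ((Num.sqrt (sk k - h))^-1 * (t - (nsum X Y n k om + Z (X k om)))).
  by apply: eq_Rintegral => om _; rewrite skS /nsum big_ord_recr.
rewrite -mZE; apply: lindeberg_step => //.
- by move=> x; apply: step.
- exact: measurable_nsum.
- exact: ind.
Qed.

(** Unsmoothing: with s_0 = dl^2 the indicator of S <= t lies, up to e / 2, between the smoothed
    indicators centred at t - dl M and t + dl M. *)
Lemma clt_bound (e : R) : 0 < e -> exists A B : R, [/\ 0 <= A, 0 <= B &
  forall Q P n X Y t, (0 < n)%N -> clt_data Q P n X Y ->
  `|fine (Q [set om | nsum X Y n n om <= t]) - Phi t| <=
    e + A * lindeberg_moment P Y n + B / n%:R].
Proof.
move=> e0.
have [M M0 [MN MP]] := @Phi_tails R (e / 2) (divr_gt0 e0 (ltr0n _ 2)).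
(* Replacing the final scale sqrt(dl^2 + 1) by 1 costs 34 dl, and shifting [t] by dl M costs 17 dl
   M. The second entry of the minimum makes the sum at most e / 2; the first allows
   [Phi_scale_lipschitz]. *)
pose dl : R := Num.min (2^-1) (e / (2 * (34 + 17 * M))).
have c0 : 0 < 34 + 17 * M by rewrite ltr_wpDr ?mulr_ge0.
have dl0 : 0 < dl by rewrite lt_min invr_gt0 ltr0n/= divr_gt0// mulr_gt0.
have dl1 : dl <= 2^-1 by rewrite ge_min lexx.
have dle : dl * (34 + 17 * M) <= e / 2.
  have : dl <= e / (2 * (34 + 17 * M)) by rewrite ge_min lexx orbT.
  rewrite -(ler_pM2r c0) => /le_trans; apply.
  by rewrite le_eqVlt; apply/orP; left; apply/eqP; field; rewrite gt_eqF.
have [A [B [A0 B0 tele]]] := lindeberg_telescope (exprn_gt0 2 dl0).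
exists A, B; split => // Q P n X Y t n0 data.
have [mX mY _ _ _] := data.
have mW := measurable_nsum n n mX mY.
have rdl : Num.sqrt (dl ^+ 2) = dl by rewrite sqrtr_sqr gtr0_norm.
pose err := A * lindeberg_moment P Y n + B / n%:R; rewrite -addrA -/err.
pose l := (Num.sqrt (dl ^+ 2 + 1))^-1.
have l1 : 1 - dl ^+ 2 <= l <= 1.
  have s1 : 1 <= Num.sqrt (dl ^+ 2 + 1).
    by rewrite -[leLHS]sqrtr1 ler_sqrt ?lerDr ?sqr_ge0// addr_ge0 ?sqr_ge0.
  have s2 : Num.sqrt (dl ^+ 2 + 1) <= dl ^+ 2 + 1.
    rewrite -[leRHS]ger0_norm ?addr_ge0 ?sqr_ge0// -sqrtr_sqr ler_sqrt ?sqr_ge0//.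
    have := sqr_ge0 dl; set q := dl ^+ 2; nra.
  apply/andP; split; last by rewrite invf_le1// (lt_le_trans _ s1).
  rewrite /l -[X in _ <= X]mul1r ler_pdivlMr ?(lt_le_trans _ s1)//.
  have := sqr_ge0 dl; set q := dl ^+ 2 in s2 *; nra.
have near_t (u : R) : `|u| <= dl * M -> `|Phi (l * (t + u)) - Phi t| <= e / 2.
  move=> uM; apply: le_trans dle.
  have P1 : `|Phi (l * t) - Phi t| <= 34 * dl.
    apply: Phi_scale_lipschitz; first by rewrite ltW.
    rewrite -[X in _ - X]mul1r -mulrBl normrM ler_wpM2r// ler0_norm ?subr_le0; last by case/andP: l1.
    have : dl ^+ 2 <= dl by rewrite expr2 ler_piMl ?(ltW dl0)//; move: dl1; lra.
    by case/andP: l1; lra.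
  have P2 : `|Phi (l * (t + u)) - Phi (l * t)| <= 17 * (dl * M).
    rewrite (le_trans (Phi_lipschitz _ _))// ler_wpM2l// -mulrBr addrAC subrr add0r.
    rewrite normrM (le_trans _ uM)// ler_piMl// ger0_norm ?invr_ge0 ?sqrtr_ge0//.
    by case/andP: l1.
  rewrite -(subrK (Phi (l * t)) (Phi (l * (t + u)))) -addrA (le_trans (ler_normD _ _))//.
  lra.
have mlin (c : R) : measurable_fun setT (fun om => Phi (dl^-1 * (c - nsum X Y n n om))).
  apply: (measurableT_comp measurable_Phi).
  by apply: measurable_funM => //; apply: measurable_funB.
have iPhi (c : R) : Q.-integrable setT (EFin \o (fun om => Phi (dl^-1 * (c - nsum X Y n n om)))).
  apply: (@bounded_integrable _ _ _ _ _ 1) => // om.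
  by rewrite ger0_norm ?Phi_ge0 ?Phi_le1.
have mset : measurable [set om | nsum X Y n n om <= t].
  have := mW measurableT `]-oo, t]%classic (measurable_itv _).
  by rewrite setTI; congr measurable; apply/seteqP; split => om /=; rewrite in_itv.
have iind : Q.-integrable setT (EFin \o (\1_[set om | nsum X Y n n om <= t] : Om -> R)).
  apply: (@bounded_integrable _ _ _ _ _ 1) => //.
  by move=> om; rewrite indicE; case: (_ \in _); rewrite ?normr1 ?normr0.
have QE : fine (Q [set om | nsum X Y n n om <= t]) =
    \int[Q]_om \1_[set om | nsum X Y n n om <= t] om.
  by rewrite /Rintegral integral_indic// setIT.
have teleM (c : R) := tele Q P n X Y c n0 data.
rewrite rdl in teleM.
have Mdl : `|dl * M| <= dl * M by rewrite ger0_norm// mulr_ge0 ?(ltW dl0).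
rewrite ler_norml; apply/andP; split.
  (* When the sum exceeds [t], the argument of [Phi] is below -M and the tail bound applies;
     otherwise Phi <= 1 is compared with the indicator. *)
  have Q1 : \int[Q]_om Phi (dl^-1 * (t - dl * M - nsum X Y n n om)) - e / 2 <=
      fine (Q [set om | nsum X Y n n om <= t]).
    rewrite QE -[X in _ - X](Rintegral_cst_probability Q) -RintegralB//; last exact: integrable_cst_probability.
    rewrite le_Rintegral//; first by apply: integrable_subr => //; exact: integrable_cst_probability.
    move=> om _; rewrite indicE; case: (boolP (om \in _)) => /= [_|].
      by rewrite lerBlDr (le_trans (Phi_le1 _))// lerDl divr_ge0// ltW.
    rewrite notin_setE => /negP; rewrite -ltNge => tW.
    rewrite subr_le0 (le_trans _ MN)// le_Phi// ler_pdivrMl//.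
    rewrite mulrN; move: tW; lra.
  have := teleM (t - dl * M); have := near_t (- (dl * M)).
  rewrite normrN => /(_ Mdl); rewrite -/l -/err !ler_norml => /andP[+ _] /andP[+ _].
  lra.
have Q1 : fine (Q [set om | nsum X Y n n om <= t]) <=
    \int[Q]_om Phi (dl^-1 * (t + dl * M - nsum X Y n n om)) + e / 2.
  rewrite QE -[X in _ + X](Rintegral_cst_probability Q) -RintegralD//; last exact: integrable_cst_probability.
  rewrite le_Rintegral//; first by apply: integrable_addr => //; exact: integrable_cst_probability.
  move=> om _; rewrite indicE; case: (boolP (om \in _)) => /= [|_]; last first.
    by rewrite addr_ge0 ?Phi_ge0// divr_ge0// ltW.
  rewrite inE => /= tW.
  have : Phi M <= Phi (dl^-1 * (t + dl * M - nsum X Y n n om)).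
    by rewrite le_Phi// ler_pdivlMl//; move: tW; lra.
  by move: MP; lra.
have := teleM (t + dl * M); have := near_t (dl * M) Mdl.
rewrite -/l -/err !ler_norml => /andP[_ +] /andP[_ +].
lra.
Qed.
End clt.

(** * Weak laws of large numbers *)

Section second_moments.
Context {R : realType} {d : measure_display} {Om : measurableType d}.
Variable Q : probability Om R.
Implicit Types (f : Om -> R) (g : nat -> Om -> R).

Lemma eq_integrable_fun f1 f2 : f1 =1 f2 ->
  Q.-integrable setT (EFin \o f1) -> Q.-integrable setT (EFin \o f2).
Proof. by move=> /funext ->. Qed.

Lemma integrable_sqr_mul f1 f2 : measurable_fun setT f1 -> measurable_fun setT f2 ->
  Q.-integrable setT (EFin \o (fun om => f1 om ^+ 2)) ->
  Q.-integrable setT (EFin \o (fun om => f2 om ^+ 2)) ->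
  Q.-integrable setT (EFin \o (fun om => f1 om * f2 om)).
Proof.
move=> m1 m2 i1 i2.
apply: (@dominated_integrable _ _ _ _ _ (fun om => f1 om ^+ 2 + f2 om ^+ 2)).
- exact: measurable_funM.
- move=> om; rewrite normrM -(real_normK (num_real (f1 om))) -(real_normK (num_real (f2 om))).
  have := normr_ge0 (f1 om); have := normr_ge0 (f2 om); nra.
- exact: integrable_addr.
Qed.

(** Orthogonality replaces independence here because the truncated cross terms share a random
    factor. *)
Lemma orthogonal_sum_sqr g n : (forall i, measurable_fun setT (g i)) ->
  (forall i, (i < n)%N -> Q.-integrable setT (EFin \o (fun om => g i om ^+ 2))) ->
  (forall i j, (i < n)%N -> (j < n)%N -> i != j -> \int[Q]_om (g i om * g j om) = 0) ->
  Q.-integrable setT (EFin \o (fun om => (\sum_(i < n) g i om) ^+ 2)) /\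
  \int[Q]_om ((\sum_(i < n) g i om) ^+ 2) = \sum_(i < n) \int[Q]_om (g i om ^+ 2).
Proof.
move=> mg ig og.
have H k : (k <= n)%N ->
    Q.-integrable setT (EFin \o (fun om => (\sum_(i < k) g i om) ^+ 2)) /\
    \int[Q]_om ((\sum_(i < k) g i om) ^+ 2) = \sum_(i < k) \int[Q]_om (g i om ^+ 2).
  elim: k => [_|k IH kn].
    split.
      apply: (eq_integrable_fun (f1 := fun=> 0)); last exact: integrable_cst_probability.
      by move=> om; rewrite big_ord0 expr0n.
    under eq_Rintegral do rewrite big_ord0 expr0n/=.
    by rewrite Rintegral_cst_probability big_ord0.
  have [iS ES] := IH (ltnW kn).
  have X l : (l <= k)%N ->
      Q.-integrable setT (EFin \o (fun om => (\sum_(i < l) g i om) * g k om)) /\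
      \int[Q]_om ((\sum_(i < l) g i om) * g k om) = 0.
    elim: l => [_|l IHl lk].
      split.
        apply: (eq_integrable_fun (f1 := fun=> 0)); last exact: integrable_cst_probability.
        by move=> om; rewrite big_ord0 mul0r.
      under eq_Rintegral do rewrite big_ord0 mul0r.
      by rewrite Rintegral_cst_probability.
    have [il El] := IHl (ltnW lk).
    have ilk : Q.-integrable setT (EFin \o (fun om => g l om * g k om)).
      by apply: integrable_sqr_mul => //; apply: ig => //; exact: leq_trans lk (ltnW kn).
    split.
      apply: (eq_integrable_fun _ (integrable_addr il ilk)).
      by move=> om; rewrite big_ord_recr/= mulrDl.
    under eq_Rintegral do rewrite big_ord_recr/= mulrDl.
    rewrite RintegralD// El add0r og//; first exact: leq_trans lk (ltnW kn).
    by rewrite ltn_eqF.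
  have [iX EX] := X k (leqnn _).
  have E om : (\sum_(i < k.+1) g i om) ^+ 2 =
      (\sum_(i < k) g i om) ^+ 2 + 2 * ((\sum_(i < k) g i om) * g k om) + g k om ^+ 2.
    by rewrite big_ord_recr/=; ring.
  have i2 := integrable_mulr 2 iX.
  have i3 := integrable_addr iS i2.
  split.
    by apply: (eq_integrable_fun _ (integrable_addr i3 (ig k kn))) => om; rewrite E.
  under eq_Rintegral do rewrite E.
  rewrite RintegralD//; last exact: ig.
  by rewrite RintegralD// RintegralZl// EX mulr0 addr0 ES big_ord_recr.
exact: H.
Qed.

Lemma measurable_set_gt f (a : R) : measurable_fun setT f -> measurable [set om | a < f om].
Proof.
move=> mf; have := mf measurableT `]a, +oo[%classic (measurable_itv _).
by rewrite setTI; congr measurable; apply/seteqP; split => om /=; rewrite in_itv/= andbT.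
Qed.

Lemma measurable_set_le f (a : R) : measurable_fun setT f -> measurable [set om | f om <= a].
Proof.
move=> mf; have := mf measurableT `]-oo, a]%classic (measurable_itv _).
by rewrite setTI; congr measurable; apply/seteqP; split => om /=; rewrite in_itv.
Qed.

Lemma markov_Rintegral f (a c : R) : 0 < a -> (forall om, 0 <= f om) ->
  Q.-integrable setT (EFin \o f) -> \int[Q]_om f om <= c ->
  (Q [set om | (a < f om)%R] <= (c / a)%:E)%E.
Proof.
move=> a0 f0 fi fc.
have mf : measurable_fun setT f by apply/measurable_EFinP; exact: measurable_int fi.
have mA := measurable_set_gt a mf.
rewrite -[leLHS]fineK ?fin_num_measure// lee_fin ler_pdivlMr// mulrC.
apply: le_trans fc.
have -> : fine (Q [set om | a < f om]) = \int[Q]_om \1_[set om | a < f om] om.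
  by rewrite /Rintegral integral_indic// setIT.
have iind : Q.-integrable setT (EFin \o (\1_[set om | a < f om] : Om -> R)).
  apply: (@bounded_integrable _ _ _ _ _ 1) => //.
  by move=> om; rewrite indicE; case: (_ \in _); rewrite ?normr1 ?normr0.
rewrite -RintegralZl// le_Rintegral//; first exact: integrable_mulr.
move=> om _; rewrite indicE; case: (boolP (om \in _)) => [|_]; last by rewrite mulr0.
by rewrite inE mulr1 => /ltW.
Qed.

Lemma markov_sqr f (a c : R) : 0 < a ->
  Q.-integrable setT (EFin \o (fun om => f om ^+ 2)) -> \int[Q]_om (f om ^+ 2) <= c ->
  (Q [set om | (a < `|f om|)%R] <= (c / a ^+ 2)%:E)%E.
Proof.
move=> a0 fi fc.
have E om : (a < `|f om|) = (a ^+ 2 < f om ^+ 2).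
  by rewrite -[in RHS](real_normK (num_real (f om))) ltr_pXn2r ?nnegrE ?(ltW a0).
have -> : [set om | a < `|f om|] = [set om | a ^+ 2 < f om ^+ 2].
  by apply/seteqP; split => om /=; rewrite E.
exact: (markov_Rintegral (exprn_gt0 2 a0) (fun om => sqr_ge0 (f om)) fi fc).
Qed.

End second_moments.

(** * Means of pairwise independent, identically distributed observations *)

Section iid_sums.
Context {R : realType} {dO dS : measure_display} {Om : measurableType dO}
  {S : measurableType dS}.
Variables (Q : probability Om R) (P : probability S R) (n : nat) (X : nat -> Om -> S).
Hypothesis mX : forall i, measurable_fun setT (X i).
Hypothesis lawX : forall i, (i < n)%N -> forall B, measurable B -> Q (X i @^-1` B) = P B.
Hypothesis indX : forall i j, (i < n)%N -> (j < n)%N -> i != j ->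
  prodlaw Q P (X i) (X j).

Let law_integral i (f : S -> \bar R) : (i < n)%N -> measurable_fun setT f ->
  (forall o, 0 <= f o)%E -> (\int[Q]_om f (X i om) = \int[P]_o f o)%E.
Proof.
move=> ni mf f0.
pose fX : {mfun Om >-> S} := HB.pack (X i) (isMeasurableFun.Build _ _ _ _ _ (mX i)).
transitivity (\int[distribution Q fX]_z f z)%E.
  by rewrite ge0_integral_pushforward.
by apply: eq_measure_integral => A mA _; exact: lawX.
Qed.

Lemma law_integrable i (f : S -> R) : (i < n)%N ->
  P.-integrable setT (EFin \o f) -> Q.-integrable setT (EFin \o (fun om => f (X i om))).
Proof.
move=> ni /integrableP[mf foo]; apply/integrableP; split.
  exact: (measurableT_comp mf (mX i)).
rewrite (law_integral (f := fun o => `|(EFin \o f) o|%E))//.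
exact: measurableT_comp.
Qed.

Lemma law_Rintegral i (f : S -> R) : (i < n)%N -> P.-integrable setT (EFin \o f) ->
  \int[Q]_om f (X i om) = \int[P]_o f o.
Proof.
move=> ni fi; have mf : measurable_fun setT (EFin \o f) := measurable_int _ fi.
pose fX : {mfun Om >-> S} := HB.pack (X i) (isMeasurableFun.Build _ _ _ _ _ (mX i)).
rewrite /Rintegral; congr fine.
transitivity (\int[distribution Q fX]_z (EFin \o f) z)%E; last first.
  by apply: eq_measure_integral => A mA _; exact: lawX.
by rewrite integral_distribution//; exact: law_integrable.
Qed.

Lemma iid_centered_sum (phi : S -> R) : measurable_fun setT phi ->
  P.-integrable setT (EFin \o (fun o => phi o ^+ 2)) ->
  P.-integrable setT (EFin \o phi) ->
  \int[P]_o phi o = 0 ->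
  Q.-integrable setT (EFin \o (fun om => (\sum_(i < n) phi (X i om)) ^+ 2)) /\
  \int[Q]_om ((\sum_(i < n) phi (X i om)) ^+ 2) = n%:R * \int[P]_o (phi o ^+ 2).
Proof.
move=> mphi iphi2 iphi E0.
have mphiX i : measurable_fun setT (fun om => phi (X i om)) by exact: measurableT_comp.
have i2 i : (i < n)%N -> Q.-integrable setT (EFin \o (fun om => phi (X i om) ^+ 2)).
  by move=> ni; exact: (law_integrable ni iphi2).
have pn : (\int[P]_o (phi^\+%R o)%:E = \int[P]_o (phi^\-%R o)%:E)%E.
  have := E0; rewrite /Rintegral integralE.
  have ip := integrable_pos_fin_num measurableT iphi.
  have ineg := integrable_neg_fin_num measurableT iphi.
  rewrite fineB// => /eqP; rewrite subr_eq0 => /eqP pn.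
  have -> : (\int[P]_o (phi^\+%R o)%:E = \int[P]_o (EFin \o phi)^\+ o)%E.
    by apply: eq_integral => o _; rewrite funeposE /= -EFin_max.
  have -> : (\int[P]_o (phi^\-%R o)%:E = \int[P]_o (EFin \o phi)^\- o)%E.
    by apply: eq_integral => o _; rewrite funenegE /= -EFin_max.
  by rewrite -(fineK ip) pn fineK.
have og i j : (i < n)%N -> (j < n)%N -> i != j ->
    \int[Q]_om (phi (X i om) * phi (X j om)) = 0.
  move=> ni nj ij.
  have iij : Q.-integrable setT (EFin \o (fun om => phi (X i om) * phi (X j om))).
    by apply: integrable_sqr_mul => //; exact: i2.
  (* With a constant [pi] into [unit], conditional centring is plain centring of [phi]; the other
     factor, phi(X j), is the weight [H]. *)
  have := @prodlaw_cond_integral0 R dO dS dS default_measure_display Om S S unit Q P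
     (X i) (X j) (fun=> tt) (mX i) (mX j) (measurable_cst _) (indX ni nj ij)
     phi (fun p => phi p.2) mphi.
  rewrite /Rintegral => H; under eq_integral do rewrite mulrC.
  rewrite H//.
  - move=> B mB; have [Btt|Btt] := pselect (B tt).
      by rewrite (_ : _ @^-1` B = setT)//; apply/seteqP; split.
    by rewrite (_ : _ @^-1` B = set0) ?integral_set0//; apply/seteqP; split.
  - exact: measurableT_comp.
  - by under eq_fun do rewrite mulrC; exact: iij.
have [iS ->] := orthogonal_sum_sqr mphiX i2 og.
split=> //; rewrite (eq_bigr (fun=> \int[P]_o (phi o ^+ 2))).
  by rewrite sumr_const card_ord mulr_natl.
by move=> i _; rewrite (law_Rintegral (ltn_ord i) iphi2).
Qed.

Lemma iid_mean_deviation (phi : S -> R) (c dl : R) : (0 < n)%N -> 0 < dl ->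
  measurable_fun setT phi ->
  P.-integrable setT (EFin \o (fun o => phi o ^+ 2)) ->
  P.-integrable setT (EFin \o phi) ->
  \int[P]_o phi o = 0 -> \int[P]_o (phi o ^+ 2) <= c ->
  (Q [set om | (dl < `|n%:R^-1 * \sum_(i < n) phi (X i om)|)%R] <=
    (c / dl ^+ 2 / n%:R)%:E)%E.
Proof.
move=> n0 dl0 mphi i2 i1 E0 Ec.
have n0R : 0 < n%:R :> R by rewrite ltr0n.
have [iS ES] := iid_centered_sum mphi i2 i1 E0.
rewrite mulrAC; apply: markov_sqr => //.
  apply: (eq_integrable_fun _ (integrable_mulr (n%:R ^- 2) iS)) => om.
  by rewrite exprMn exprVn.
under eq_Rintegral do rewrite exprMn exprVn.
rewrite RintegralZl// ES (_ : _ ^- 2 * _ = (\int[P]_o (phi o ^+ 2)) / n%:R).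
  by rewrite ler_wpM2r// invr_ge0 ltW.
by field; rewrite gt_eqF.
Qed.

(** Y^2 need not have a variance, so it is split at |Y| = K. The bounded part [T] has variance at
    most K^2 E Y^2 = K^2 and obeys Chebyshev at level dl / 3; the tail [U] has mean at most [k] and
    obeys Markov at the same level. The centre 1 is E T + E U, and E U is at most k <= dl / 3. *)
Lemma iid_mean_sqr_deviation (Y : S -> R) (K k dl : R) : (0 < n)%N -> 0 < dl ->
  measurable_fun setT Y -> P.-integrable setT (EFin \o (fun o => Y o ^+ 2)) ->
  \int[P]_o (Y o ^+ 2) = 1 ->
  \int[P]_o (if `|Y o| <= K then 0 else Y o ^+ 2) <= k -> k <= dl / 3 ->
  (Q [set om | (dl < `|n%:R^-1 * (\sum_(i < n) Y (X i om) ^+ 2) - 1|)%R] <=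
    (9 * K ^+ 2 / dl ^+ 2 / n%:R + 3 * k / dl)%:E)%E.
Proof.
move=> n0 dl0 mY i2 E2 Uk kdl.
have n0R : 0 < n%:R :> R by rewrite ltr0n.
have dl30 : 0 < dl / 3 by rewrite divr_gt0.
pose U o := if `|Y o| <= K then 0 else Y o ^+ 2.
pose T o := if `|Y o| <= K then Y o ^+ 2 else 0.
have YTU o : Y o ^+ 2 = T o + U o by rewrite /T /U; case: ifP; rewrite ?addr0 ?add0r.
have mc : measurable_fun setT (fun o => `|Y o| <= K).
  by apply: measurable_fun_ler => //; exact: measurableT_comp.
have mU : measurable_fun setT U.
  by apply: measurable_fun_ifT => //; exact: measurable_funX.
have mT : measurable_fun setT T.
  by apply: measurable_fun_ifT => //; exact: measurable_funX.
have U0 o : 0 <= U o by rewrite /U; case: ifP => // _; exact: sqr_ge0.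
have T0 o : 0 <= T o by rewrite /T; case: ifP => // _; exact: sqr_ge0.
have iU : P.-integrable setT (EFin \o U).
  by apply: (dominated_integrable mU _ i2) => o; rewrite ger0_norm// YTU lerDr.
have iT : P.-integrable setT (EFin \o T).
  by apply: (dominated_integrable mT _ i2) => o; rewrite ger0_norm// YTU lerDl.
have T2 o : T o ^+ 2 <= K ^+ 2 * Y o ^+ 2.
  rewrite /T; case: ifP => [YK|_]; last by rewrite expr0n mulr_ge0 ?sqr_ge0.
  rewrite expr2 ler_wpM2r ?sqr_ge0// -(real_normK (num_real (Y o))).
  by rewrite lerXn2r// nnegrE (le_trans _ YK).
have iKY : P.-integrable setT (EFin \o (fun o => K ^+ 2 * Y o ^+ 2)) by exact: integrable_mulr.
have iT2 : P.-integrable setT (EFin \o (fun o => T o ^+ 2)).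
  by apply: (dominated_integrable _ _ iKY) => [|o]; [exact: measurable_funX|rewrite ger0_norm ?sqr_ge0].
pose mu := \int[P]_o T o.
have muU : mu = 1 - \int[P]_o U o.
  by rewrite -E2; under eq_Rintegral do rewrite YTU; rewrite RintegralD// addrK.
pose phi o := T o - mu.
have phi2 o : phi o ^+ 2 = T o ^+ 2 - (2 * mu) * T o + mu ^+ 2 by rewrite /phi; ring.
have iphi2 : P.-integrable setT (EFin \o (fun o => phi o ^+ 2)).
  have iT2T := integrable_subr iT2 (integrable_mulr (2 * mu) iT).
  apply: (eq_integrable_fun _ (integrable_addr iT2T (integrable_cst_probability P (mu ^+ 2)))) => o.
  by rewrite phi2.
have iphi : P.-integrable setT (EFin \o phi).
  by apply: integrable_subr => //; exact: integrable_cst_probability.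
have Ephi : \int[P]_o phi o = 0.
  by rewrite RintegralB// ?Rintegral_cst_probability ?subrr//; exact: integrable_cst_probability.
have Ephi2 : \int[P]_o (phi o ^+ 2) <= K ^+ 2.
  under eq_Rintegral do rewrite phi2.
  rewrite RintegralD//; [|exact: integrable_subr iT2 (integrable_mulr _ iT)|exact: integrable_cst_probability].
  rewrite RintegralB//; last exact: integrable_mulr.
  rewrite RintegralZl// Rintegral_cst_probability -/mu.
  have : \int[P]_o (T o ^+ 2) <= K ^+ 2.
    rewrite -[leRHS]mulr1 -E2 -RintegralZl// le_Rintegral//.
  by have := sqr_ge0 mu; lra.
have mphiX : measurable_fun setT (fun om => n%:R^-1 * \sum_(i < n) phi (X i om)).
  apply: measurable_funM => //; apply: measurable_sum => i.
  by apply: measurableT_comp => //; exact: measurable_funB.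
have mUX : measurable_fun setT (fun om => n%:R^-1 * \sum_(i < n) U (X i om)).
  by apply: measurable_funM => //; apply: measurable_sum => i; exact: measurableT_comp.
have iUX : Q.-integrable setT (EFin \o (fun om => n%:R^-1 * \sum_(i < n) U (X i om))) /\
    \int[Q]_om (n%:R^-1 * \sum_(i < n) U (X i om)) = \int[P]_o U o.
  have H m : (m <= n)%N -> Q.-integrable setT (EFin \o (fun om => \sum_(i < m) U (X i om))) /\
      \int[Q]_om (\sum_(i < m) U (X i om)) = m%:R * \int[P]_o U o.
    elim: m => [_|m IH mn].
      split.
        apply: (eq_integrable_fun (f1 := fun=> 0)); last exact: integrable_cst_probability.
        by move=> om; rewrite big_ord0.
      by under eq_Rintegral do rewrite big_ord0; rewrite Rintegral_cst_probability mul0r.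
    have [im Em] := IH (ltnW mn); have iUm := law_integrable mn iU.
    split.
      by apply: (eq_integrable_fun _ (integrable_addr im iUm)) => om; rewrite big_ord_recr.
    under eq_Rintegral do rewrite big_ord_recr/=.
    by rewrite RintegralD// Em (law_Rintegral mn iU) -natr1 mulrDl mul1r.
  have [iS ES] := H n (leqnn _).
  by split; [exact: integrable_mulr|rewrite RintegralZl// ES mulKf// gt_eqF].
have P1 := iid_mean_deviation n0 dl30 (measurable_funB mT (measurable_cst _)) iphi2 iphi Ephi Ephi2.
have P2 : (Q [set om | (dl / 3 < n%:R^-1 * \sum_(i < n) U (X i om))%R] <= (k / (dl / 3))%:E)%E.
  apply: markov_Rintegral => //; first by move=> om; rewrite mulr_ge0 ?invr_ge0 ?(ltW n0R)// sumr_ge0.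
    by have [] := iUX.
  by have [_ ->] := iUX.
set A := (X in Q X) in P1; set B := (X in Q X) in P2.
have mA : measurable A.
  by apply: measurable_set_gt; exact: measurableT_comp mphiX.
have mB : measurable B by exact: measurable_set_gt.
apply: (@le_trans _ _ (Q (A `|` B))).
  apply: le_measure; rewrite ?inE; last 2 first.
  - exact: measurableU.
  - move=> om /= dev; rewrite /A /B /=.
    have [|Ale] := ltP (dl / 3) `|n%:R^-1 * \sum_(i < n) phi (X i om)|; first by left.
    have [|Ble] := ltP (dl / 3) (n%:R^-1 * \sum_(i < n) U (X i om)); first by right.
    exfalso; move: dev; apply/negP; rewrite -leNgt.
    have -> : n%:R^-1 * (\sum_(i < n) Y (X i om) ^+ 2) - 1 =
        n%:R^-1 * (\sum_(i < n) phi (X i om)) + (n%:R^-1 * (\sum_(i < n) U (X i om)) - \int[P]_o U o).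
      under eq_bigr do rewrite YTU.
      rewrite /phi big_split/= sumrB sumr_const card_ord -[mu *+ n]mulr_natl muU.
      by field; rewrite gt_eqF.
    have EU0 : 0 <= \int[P]_o U o by apply: Rintegral_ge0.
    have Uavg0 : 0 <= n%:R^-1 * (\sum_(i < n) U (X i om)).
      by rewrite mulr_ge0 ?invr_ge0 ?(ltW n0R)// sumr_ge0.
    move: Ale; rewrite !ler_norml => /andP[A1 A2].
    have Uk' : \int[P]_o U o <= k by [].
    by apply/andP; split; lra.
  apply: measurable_set_gt; apply: measurableT_comp => //; apply: measurable_funB => //.
  apply: measurable_funM => //; apply: measurable_sum => i; apply: measurable_funX.
  exact: measurableT_comp.
apply: (le_trans (measureU2 _ mA mB)).
rewrite (_ : _%:E = (K ^+ 2 / (dl / 3) ^+ 2 / n%:R)%:E + (k / (dl / 3))%:E)%E ?leeD//.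
by rewrite -EFinD; congr EFin; field; rewrite !gt_eqF.
Qed.

End iid_sums.

(** * Cross terms truncated on a small weighted regression error *)

Section trunc.
Context {R : realType}.

Definition trunc (eta x : R) : R := if x <= eta then 1 else 0.

Lemma trunc_ge0 eta x : 0 <= trunc eta x.
Proof. by rewrite /trunc; case: ifP. Qed.

Lemma trunc_sqr eta x : trunc eta x ^+ 2 = trunc eta x.
Proof. by rewrite /trunc; case: ifP; rewrite ?expr1n ?expr0n. Qed.

Lemma trunc_mul_le eta x : 0 <= eta -> trunc eta x * x <= eta.
Proof. by rewrite /trunc; case: ifP; rewrite ?mul1r ?mul0r. Qed.

Lemma measurable_trunc d (T : measurableType d) (eta : R) (f : T -> R) :
  measurable_fun setT f -> measurable_fun setT (fun x => trunc eta (f x)).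
Proof.
by move=> mf; apply: measurable_fun_ifT => //; exact: measurable_fun_ler.
Qed.

Lemma measurable_Zc d : measurable_fun setT (@Zc R d).
Proof.
apply/measurable_fun_tnthP => i.
rewrite (_ : _ \o _ = fun o => tnth o (rshift 2 i)); last first.
  by apply/funext => o /=; rewrite tnth_mktuple.
exact: measurable_tnth.
Qed.

End trunc.

Section truncated_moments.
Context {R : realType} {dO dA : measure_display} {Om : measurableType dO}
  {Aux : measurableType dA} {d : nat}.
Variables (P : probability (@Obs R d) R) (Q : probability Om R) (n : nat)
  (obs : nat -> Om -> @Obs R d) (aux : Om -> Aux).
Hypothesis mobs : forall i, measurable_fun setT (obs i).
Hypothesis maux : measurable_fun setT aux.
Hypothesis iid : iid_indep_aux P Q n obs aux.
Hypothesis n0 : (0 < n)%N.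
Variables (A b : Aux * @Zsp R d -> R) (h : @Obs R d -> R) (V : @Zsp R d -> R) (C eta : R).
Hypotheses (mA : measurable_fun setT A) (mb : measurable_fun setT b)
  (mh : measurable_fun setT h) (mV : measurable_fun setT V).
Hypotheses (V0 : forall z, 0 <= V z) (b0 : forall p, 0 <= b p) (eta0 : 0 <= eta).
Hypothesis AVb : forall p, A p ^+ 2 * V p.2 <= C ^+ 2 * b p.
Hypothesis hV : forall B, measurable B ->
  (\int[P]_(o in Zc @^-1` B) (h o ^+ 2)%:E = \int[P]_(o in Zc @^-1` B) (V (Zc o))%:E)%E.
Hypothesis hpn : forall B, measurable B ->
  (\int[P]_(o in Zc @^-1` B) (h^\+ o)%:E = \int[P]_(o in Zc @^-1` B) (h^\- o)%:E)%E.

Let n0R : 0 < n%:R :> R. Proof. by rewrite ltr0n. Qed.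

(** In the application [A] is a regression error times [w], [b] its square times the conditional
    variance [V] of the other noise [h]; this average is then B_f or B_g. *)
Definition aux_avg (om : Om) : R :=
  n%:R^-1 * \sum_(i < n) b (aux om, Zc (obs i om)).

(** The factor [trunc] makes the terms dependent, but it involves no noise: given the auxiliary data
    and all the Z_j, each [h (obs i om)] is still centred. *)
Definition trunc_term (i : nat) (om : Om) : R :=
  trunc eta (aux_avg om) * (A (aux om, Zc (obs i om)) * h (obs i om)).

Let maz (f : Aux * @Zsp R d -> R) i : measurable_fun setT f ->
  measurable_fun setT (fun om => f (aux om, Zc (obs i om))).
Proof.
move=> mf; apply: (measurableT_comp mf); apply: measurable_fun_pair => //.
exact: measurableT_comp (@measurable_Zc R d) (mobs i).
Qed.

Lemma measurable_aux_avg : measurable_fun setT aux_avg.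
Proof.
by apply: measurable_funM => //; apply: measurable_sum => i; exact: maz.
Qed.

Lemma measurable_trunc_term i : measurable_fun setT (trunc_term i).
Proof.
apply: measurable_funM; first exact: measurable_trunc measurable_aux_avg.
by apply: measurable_funM; [exact: maz|exact: measurableT_comp].
Qed.

Let T := (Aux * n.-tuple (@Obs R d))%type.
(** [aux_avg] as a function of Z_i and [rest]: the i-th summand is taken from the first component,
    since [rest] no longer holds it. *)
Let avg' (i : nat) (p : @Zsp R d * T) : R :=
  n%:R^-1 * (b (p.2.1, p.1) +
    \sum_(j < n) if (j : nat) == i then 0 else b (p.2.1, Zc (tnth p.2.2 j))).

Let avg'E i om : (i < n)%N -> avg' i (Zc (obs i om), rest n obs aux i om) = aux_avg om.
Proof.
move=> ni; rewrite /avg' /aux_avg; congr (_ * _).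
rewrite [in RHS](bigD1 (Ordinal ni))//=; congr (_ + _).
rewrite [RHS]big_mkcond/=; apply: eq_bigr => j _; rewrite tnth_mktuple.
rewrite -val_eqE/=; by case: eqP.
Qed.

Let mtn j : measurable_fun [set: @Zsp R d * T] (fun p => tnth p.2.2 j).
Proof.
apply: (measurableT_comp (measurable_tnth j)).
exact: measurableT_comp measurable_snd measurable_snd.
Qed.

Let maz' (f : Aux * @Zsp R d -> R) j : measurable_fun setT f ->
  measurable_fun [set: @Zsp R d * T] (fun p => f (p.2.1, Zc (tnth p.2.2 j))).
Proof.
move=> mf; apply: (measurableT_comp mf); apply: measurable_fun_pair.
  exact: measurableT_comp measurable_fst measurable_snd.
exact: measurableT_comp (@measurable_Zc R d) (mtn j).
Qed.

Let maz'' (f : Aux * @Zsp R d -> R) : measurable_fun setT f ->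
  measurable_fun [set: @Zsp R d * T] (fun p => f (p.2.1, p.1)).
Proof.
move=> mf; apply: (measurableT_comp mf); apply: measurable_fun_pair => //.
exact: measurableT_comp measurable_fst measurable_snd.
Qed.

Let mavg' i : measurable_fun [set: @Zsp R d * T] (avg' i).
Proof.
apply: measurable_funM => //; apply: measurable_funD; first exact: maz''.
by apply: measurable_sum => j; case: eqP => // _; exact: maz'.
Qed.

Let mrest i : measurable_fun setT (rest n obs aux i).
Proof. exact: measurable_rest. Qed.

(** One nonnegative summand is at most the whole sum, which truncation caps at n eta. This crude
    bound provides integrability. *)
Let trunc_b_le i om : (i < n)%N ->
  trunc eta (aux_avg om) * b (aux om, Zc (obs i om)) <= n%:R * eta.
Proof.
move=> ni; apply: (@le_trans _ _ (n%:R * (trunc eta (aux_avg om) * aux_avg om))); last first.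
  by rewrite ler_wpM2l ?trunc_mul_le// ltW.
rewrite mulrCA ler_wpM2l ?trunc_ge0// /aux_avg mulVKf ?gt_eqF//.
by rewrite (bigD1 (Ordinal ni))//= lerDl sumr_ge0.
Qed.

Let itb i : (i < n)%N -> Q.-integrable setT
  (EFin \o (fun om => C ^+ 2 * (trunc eta (aux_avg om) * b (aux om, Zc (obs i om))))).
Proof.
move=> ni; apply: integrable_mulr; apply: (@bounded_integrable _ _ _ _ _ (n%:R * eta)).
  by apply: measurable_funM; [exact: measurable_trunc measurable_aux_avg|exact: maz].
by move=> om; rewrite ger0_norm ?mulr_ge0 ?trunc_ge0// trunc_b_le.
Qed.

Let trunc_term_sqr i om : trunc_term i om ^+ 2 =
  trunc eta (aux_avg om) * A (aux om, Zc (obs i om)) ^+ 2 * h (obs i om) ^+ 2.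
Proof. by rewrite /trunc_term !exprMn trunc_sqr mulrA. Qed.

(** The truncation and [A] depend on observation [i] through Z_i only, so h^2 may be replaced by
    V(Z_i) under the integral; [AVb] then applies pointwise. *)
Let diag i : (i < n)%N ->
  (\int[Q]_om (trunc_term i om ^+ 2)%:E <=
   \int[Q]_om (C ^+ 2 * (trunc eta (aux_avg om) * b (aux om, Zc (obs i om))))%:E)%E.
Proof.
move=> ni.
have := @prodlaw_cond_integral R dO _ _ _ Om (@Obs R d) T (@Zsp R d) Q P (obs i) (rest n obs aux i)
  Zc (mobs i) (mrest i) (@measurable_Zc R d) (rest_prodlaw mobs maux iid ni)
  (fun o => h o ^+ 2) (V \o Zc)
  (fun p => trunc eta (avg' i p) * A (p.2.1, p.1) ^+ 2).
move=> /(_ (measurable_funX _ mh) (measurableT_comp mV (@measurable_Zc R d))).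
move=> /(_ (fun o => sqr_ge0 _) (fun o => V0 _) hV).
have -> : (\int[Q]_om (trunc_term i om ^+ 2)%:E = \int[Q]_om
   (trunc eta (avg' i (Zc (obs i om), rest n obs aux i om)) *
     A ((rest n obs aux i om).1, Zc (obs i om)) ^+ 2 * h (obs i om) ^+ 2)%:E)%E.
  by apply: eq_integral => om _; rewrite avg'E// trunc_term_sqr.
move=> ->; last 2 first.
- apply: measurable_funM; first exact: measurable_trunc.
  by apply: measurable_funX; exact: maz''.
- by move=> z; rewrite mulr_ge0 ?trunc_ge0 ?sqr_ge0.
apply: ge0_le_integral => //.
- move=> om _; rewrite lee_fin; apply: mulr_ge0; last exact: V0.
  by rewrite mulr_ge0 ?trunc_ge0 ?sqr_ge0.
- apply/measurable_EFinP/measurable_funM; last first.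
    exact: measurableT_comp (measurableT_comp mV (@measurable_Zc R d)) (mobs i).
  apply: measurable_funM; last by apply: measurable_funX; exact: maz.
  apply: measurable_trunc; rewrite (_ : (fun x => _) = aux_avg); first exact: measurable_aux_avg.
  by apply/funext => om; rewrite avg'E.
- exact: measurable_int (itb ni).
- move=> om _; rewrite lee_fin avg'E// -mulrA [leRHS]mulrCA.
  by rewrite ler_wpM2l ?trunc_ge0// (AVb (aux om, Zc (obs i om))).
Qed.

Lemma integrable_trunc_term i : (i < n)%N ->
  Q.-integrable setT (EFin \o (fun om => trunc_term i om ^+ 2)).
Proof.
move=> ni; apply/integrableP; split.
  by apply/measurable_EFinP/measurable_funX; exact: measurable_trunc_term.
rewrite (eq_integral (fun om => (trunc_term i om ^+ 2)%:E)); last first.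
  by move=> om _; rewrite /= ger0_norm ?sqr_ge0.
apply: (le_lt_trans (diag ni)).
by rewrite (Rintegral_fineK (itb ni)) ltry.
Qed.

(** Adding the bounds from [trunc_b_le] would give order n^2. Summing under the integral first
    yields n times the truncated average, capped once by [eta]. *)
Lemma sum_trunc_term_sqr :
  \sum_(i < n) \int[Q]_om (trunc_term i om ^+ 2) <= n%:R * (C ^+ 2 * eta).
Proof.
have H m : (m <= n)%N ->
    Q.-integrable setT (EFin \o (fun om => \sum_(i < m) (C ^+ 2 * (trunc eta (aux_avg om) * b (aux om, Zc (obs i om)))))) /\
    \sum_(i < m) \int[Q]_om (trunc_term i om ^+ 2) <=
    \int[Q]_om (\sum_(i < m) (C ^+ 2 * (trunc eta (aux_avg om) * b (aux om, Zc (obs i om))))).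
  elim: m => [_|m IH mn].
    split.
      apply: (eq_integrable_fun (f1 := fun=> 0)); last exact: integrable_cst_probability.
      by move=> om; rewrite big_ord0.
    under eq_Rintegral do rewrite big_ord0.
    by rewrite Rintegral_cst_probability big_ord0.
  have [im lem] := IH (ltnW mn).
  split.
    by apply: (eq_integrable_fun _ (integrable_addr im (itb mn))) => om; rewrite big_ord_recr.
  rewrite big_ord_recr/=; under [leRHS]eq_Rintegral do rewrite big_ord_recr/=.
  rewrite RintegralD//; last exact: itb.
  rewrite lerD// -lee_fin -Rintegral_fineK; last exact: integrable_trunc_term.
  by rewrite -Rintegral_fineK; [exact: diag|exact: itb].
have [iS /le_trans] := H n (leqnn _); apply.
apply: le_Rintegral_cst => // om; rewrite -mulr_sumr -mulr_sumr [leRHS]mulrCA ler_wpM2l ?sqr_ge0//.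
have -> : \sum_(i < n) b (aux om, Zc (obs i om)) = n%:R * aux_avg om.
  by rewrite /aux_avg mulVKf// gt_eqF.
rewrite mulrCA ler_wpM2l ?(ltW n0R)//.
exact: trunc_mul_le.
Qed.

(** Apart from the last factor h(X_i), the product is a function of Z_i and [rest]; the two equal
    truncation factors merge by idempotence. Conditional centring of the i-th noise finishes. *)
Lemma trunc_term_orthogonal i j : (i < n)%N -> (j < n)%N -> i != j ->
  \int[Q]_om (trunc_term i om * trunc_term j om) = 0.
Proof.
move=> ni nj ij.
have := @prodlaw_cond_integral0 R dO _ _ _ Om (@Obs R d) T (@Zsp R d) Q P (obs i) (rest n obs aux i)
  Zc (mobs i) (mrest i) (@measurable_Zc R d) (rest_prodlaw mobs maux iid ni) h
  (fun p => trunc eta (avg' i p) * A (p.2.1, p.1) *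
     (A (p.2.1, Zc (tnth p.2.2 (Ordinal nj))) * h (tnth p.2.2 (Ordinal nj)))) mh hpn.
have E om : trunc_term i om * trunc_term j om =
   trunc eta (avg' i (Zc (obs i om), rest n obs aux i om)) *
   A ((rest n obs aux i om).1, Zc (obs i om)) *
     (A ((rest n obs aux i om).1, Zc (tnth (rest n obs aux i om).2 (Ordinal nj))) *
      h (tnth (rest n obs aux i om).2 (Ordinal nj))) * h (obs i om).
  rewrite avg'E// tnth_mktuple/= eq_sym (negbTE ij) /trunc_term.
  by rewrite -[in RHS]trunc_sqr; ring.
move=> H; rewrite /Rintegral; under eq_integral do rewrite E.
rewrite H//.
  apply: measurable_funM.
    by apply: measurable_funM; [exact: measurable_trunc|exact: maz''].
  by apply: measurable_funM; [exact: maz'|exact: measurableT_comp mh (mtn _)].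
apply: (eq_integrable_fun (f1 := fun om => trunc_term i om * trunc_term j om)) => [om|].
  by rewrite E.
by apply: integrable_sqr_mul; try exact: measurable_trunc_term; exact: integrable_trunc_term.
Qed.

Let on_trunc (E F : set Om) : measurable E -> measurable F ->
  (forall om, aux_avg om <= eta -> E om -> F om) ->
  (Q E <= Q [set om | (eta < aux_avg om)%R] + Q F)%E.
Proof.
move=> mE mF EF.
have mB : measurable [set om | eta < aux_avg om] by exact: measurable_set_gt measurable_aux_avg.
apply: le_trans (measureU2 _ mB mF).
apply: le_measure; rewrite ?inE//; first exact: measurableU.
move=> om Eom; have [avgle|avggt] := leP (aux_avg om) eta; last by left.
by right; exact: EF.
Qed.

(** Outside the event eta < [aux_avg] the truncation is inactive; on the truncated sum orthogonality
    gives Chebyshev, and 1 / n cancels the [n] of [sum_trunc_term_sqr]. *)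
Lemma truncated_sum_deviation (dl : R) : 0 < dl ->
  (Q [set om | (dl < `|(Num.sqrt n%:R)^-1 *
        \sum_(i < n) A (aux om, Zc (obs i om)) * h (obs i om)|)%R] <=
   Q [set om | (eta < aux_avg om)%R] + (C ^+ 2 * eta / dl ^+ 2)%:E)%E.
Proof.
move=> dl0.
have mi i : measurable_fun setT (fun om => A (aux om, Zc (obs i om)) * h (obs i om)).
  by apply: measurable_funM; [exact: maz|exact: measurableT_comp].
have [iS ES] := orthogonal_sum_sqr measurable_trunc_term integrable_trunc_term trunc_term_orthogonal.
have r2 : (Num.sqrt n%:R)^-1 ^+ 2 = n%:R^-1 :> R by rewrite exprVn sqr_sqrtr// ltW.
pose F := [set om | dl < `|(Num.sqrt n%:R)^-1 * \sum_(i < n) trunc_term i om|].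
apply: (le_trans (@on_trunc _ F _ _ _)).
- apply: measurable_set_gt; apply: measurableT_comp => //.
  by apply: measurable_funM => //; exact: measurable_sum.
- apply: measurable_set_gt; apply: measurableT_comp => //.
  by apply: measurable_funM => //; apply: measurable_sum => i; exact: measurable_trunc_term.
- move=> om le_eta; rewrite /F /=; congr (is_true (_ < normr (_ * _))).
  by apply: eq_bigr => i _; rewrite /trunc_term /trunc le_eta mul1r.
rewrite leeD2l//; apply: markov_sqr => //.
  by apply: (eq_integrable_fun _ (integrable_mulr (n%:R^-1) iS)) => om; rewrite exprMn r2.
under eq_Rintegral do rewrite exprMn r2.
by rewrite RintegralZl// ES ler_pdivrMl// sum_trunc_term_sqr.
Qed.

(** The analogue for the mean square, which perturbs the denominator: Markov's inequality on the sum
    of second moments. *)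
Lemma truncated_sqr_deviation (dl : R) : 0 < dl ->
  (Q [set om | (dl < n%:R^-1 *
        \sum_(i < n) (A (aux om, Zc (obs i om)) * h (obs i om)) ^+ 2)%R] <=
   Q [set om | (eta < aux_avg om)%R] + (C ^+ 2 * eta / dl)%:E)%E.
Proof.
move=> dl0.
have mi i : measurable_fun setT (fun om => A (aux om, Zc (obs i om)) * h (obs i om)).
  by apply: measurable_funM; [exact: maz|exact: measurableT_comp].
pose F := [set om | dl < n%:R^-1 * \sum_(i < n) trunc_term i om ^+ 2].
apply: (le_trans (@on_trunc _ F _ _ _)).
- apply: measurable_set_gt; apply: measurable_funM => //; apply: measurable_sum => i.
  exact: measurable_funX.
- apply: measurable_set_gt; apply: measurable_funM => //; apply: measurable_sum => i.
  by apply: measurable_funX; exact: measurable_trunc_term.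
- move=> om le_eta; rewrite /F /=; congr (is_true (_ < _ * _)).
  by apply: eq_bigr => i _; rewrite /trunc_term /trunc le_eta mul1r.
have H m : (m <= n)%N ->
    Q.-integrable setT (EFin \o (fun om => \sum_(i < m) trunc_term i om ^+ 2)) /\
    \int[Q]_om (\sum_(i < m) trunc_term i om ^+ 2) = \sum_(i < m) \int[Q]_om (trunc_term i om ^+ 2).
  elim: m => [_|m IH mn].
    split.
      apply: (eq_integrable_fun (f1 := fun=> 0)); last exact: integrable_cst_probability.
      by move=> om; rewrite big_ord0.
    under eq_Rintegral do rewrite big_ord0.
    by rewrite Rintegral_cst_probability big_ord0.
  have [im lem] := IH (ltnW mn); have it := integrable_trunc_term mn.
  split.
    by apply: (eq_integrable_fun _ (integrable_addr im it)) => om; rewrite big_ord_recr.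
  rewrite big_ord_recr/=; under eq_Rintegral do rewrite big_ord_recr/=.
  by rewrite RintegralD// lem.
have [iS ES] := H n (leqnn _).
rewrite leeD2l//; apply: markov_Rintegral => //.
- by move=> om; rewrite mulr_ge0 ?invr_ge0 ?(ltW n0R)// sumr_ge0// => i _; exact: sqr_ge0.
- exact: integrable_mulr.
- by rewrite RintegralZl// ES ler_pdivrMl// sum_trunc_term_sqr.
Qed.

End truncated_moments.

(** * Finite-sample inequalities *)

Section finite_sums.
Context {R : realType}.
Implicit Types (a b r s : nat -> R) (n : nat).

Lemma cauchy_schwarz_sum n a b :
  (\sum_(i < n) a i * b i) ^+ 2 <= (\sum_(i < n) a i ^+ 2) * (\sum_(i < n) b i ^+ 2).
Proof.
set Sab := \sum_(i < n) a i * b i; set Sa := \sum_(i < n) a i ^+ 2.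
set Sb := \sum_(i < n) b i ^+ 2.
have Sa0 : 0 <= Sa by apply: sumr_ge0 => i _; exact: sqr_ge0.
(* The residual of the projection of b on a, with denominators cleared. Dividing by [Sa] needs Sa >
   0; if Sa = 0, every a_i vanishes. *)
have E : Sa * (Sa * Sb - Sab ^+ 2) = \sum_(i < n) (Sa * b i - Sab * a i) ^+ 2.
  rewrite (eq_bigr (fun i : 'I_n => Sa ^+ 2 * b i ^+ 2 + Sab ^+ 2 * a i ^+ 2
     + (- 2 * Sa * Sab) * (a i * b i))); last by move=> i _; ring.
  by rewrite !big_split/= -!mulr_sumr -/Sab -/Sa -/Sb; ring.
have [Sa_gt|] := ltP 0 Sa.
  rewrite -subr_ge0 -(pmulr_rge0 _ Sa_gt) E.
  by apply: sumr_ge0 => i _; exact: sqr_ge0.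
move=> Sa_le; have Sa_eq : Sa = 0 by apply/eqP; rewrite eq_le Sa_le.
have az (i : 'I_n) : a i = 0.
  move/eqP: Sa_eq; rewrite psumr_eq0; last by move=> j _; exact: sqr_ge0.
  by move=> /allP/(_ i (mem_index_enum _)); rewrite sqrf_eq0 => /eqP.
rewrite Sa_eq mul0r /Sab big1 ?expr0n// => i _.
by rewrite az mul0r.
Qed.

Definition smean n r : R := n%:R^-1 * \sum_(i < n) r i.

(** Written exactly as the radicand of [tauD], so that [tauD] converts to its square root. *)
Definition svar n r : R := n%:R^-1 * (\sum_(i < n) r i ^+ 2) - smean n r ^+ 2.

Lemma svarE n r : (0 < n)%N ->
  svar n r = n%:R^-1 * \sum_(i < n) (r i - smean n r) ^+ 2.
Proof.
move=> n0; have n0R : n%:R != 0 :> R by rewrite pnatr_eq0 -lt0n.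
rewrite (eq_bigr (fun i : 'I_n => r i ^+ 2 + (- 2 * smean n r) * r i + smean n r ^+ 2)); last first.
  by move=> i _; ring.
rewrite !big_split/= -mulr_sumr sumr_const card_ord -[_ *+ n]mulr_natl.
have -> : \sum_(i < n) r i = n%:R * smean n r by rewrite /smean mulVKf.
by rewrite /svar; field.
Qed.

Lemma svar_ge0 n r : (0 < n)%N -> 0 <= svar n r.
Proof.
move=> n0; rewrite svarE// mulr_ge0 ?invr_ge0//.
by apply: sumr_ge0 => i _; exact: sqr_ge0.
Qed.

Lemma svar_affine n r c m : (0 < n)%N ->
  svar n (fun i => c * r i + m) = c ^+ 2 * svar n r.
Proof.
move=> n0; have n0R : n%:R != 0 :> R by rewrite pnatr_eq0 -lt0n.
have mE : smean n (fun i => c * r i + m) = c * smean n r + m.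
  rewrite /smean big_split/= -mulr_sumr sumr_const card_ord -[_ *+ n]mulr_natl.
  by field.
rewrite !svarE// mE.
rewrite (eq_bigr (fun i : 'I_n => c ^+ 2 * (r i - smean n r) ^+ 2)); last by move=> i _; ring.
by rewrite -mulr_sumr; ring.
Qed.

(** The root of [svar] is a Euclidean seminorm of the centred vector. This is its reverse triangle
    inequality, followed by dropping the squared mean of r - s. *)
Lemma sqr_sqrt_svar_sub n r s : (0 < n)%N ->
  (Num.sqrt (svar n r) - Num.sqrt (svar n s)) ^+ 2 <=
  n%:R^-1 * \sum_(i < n) (r i - s i) ^+ 2.
Proof.
move=> n0; have n0R : 0 < n%:R :> R by rewrite ltr0n.
apply: (@le_trans _ _ (svar n (fun i => r i - s i))); last first.
  by rewrite /svar lerBlDr lerDl sqr_ge0.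
have mE : smean n (fun i => r i - s i) = smean n r - smean n s.
  by rewrite /smean sumrB; ring.
pose cv := n%:R^-1 * \sum_(i < n) (r i - smean n r) * (s i - smean n s).
have -> : svar n (fun i => r i - s i) = svar n r + svar n s - 2 * cv.
  rewrite !svarE// mE /cv.
  rewrite (eq_bigr (fun i : 'I_n => (r i - smean n r) ^+ 2 + (s i - smean n s) ^+ 2
    + (- 2) * ((r i - smean n r) * (s i - smean n s)))); last by move=> i _; ring.
  by rewrite !big_split/= -mulr_sumr; ring.
have cv_le : cv <= Num.sqrt (svar n r) * Num.sqrt (svar n s).
  rewrite -sqrtrM ?svar_ge0//; apply: (le_trans (ler_norm _)).
  rewrite -sqrtr_sqr ler_sqrt ?mulr_ge0 ?svar_ge0// !svarE//.
  rewrite /cv exprMn [leRHS]mulrACA -[n%:R^-1 * n%:R^-1]expr2 ler_wpM2l ?sqr_ge0//.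
  exact: (cauchy_schwarz_sum n (fun i => r i - smean n r) (fun i => s i - smean n s)).
rewrite sqrrB !sqr_sqrtr ?svar_ge0//; move: cv_le; rewrite -mulr_natl; lra.
Qed.

Lemma normr_sqrt_sub1 (x : R) : 0 <= x -> `|Num.sqrt x - 1| <= `|x - 1|.
Proof.
move=> x0; have s0 := sqrtr_ge0 x.
have -> : x - 1 = (Num.sqrt x - 1) * (Num.sqrt x + 1).
  by rewrite -[in LHS](sqr_sqrtr x0); ring.
by rewrite normrM ler_peMr// ger0_norm ?addr_ge0// lerDr.
Qed.

(* [e i = (a i + x i) * (b i + y i) * w i - x i * y i * w i]: [a], [b] are the
   regression errors and [x], [y] the noises. *)
Lemma residual_expansion_bounds n (a b x y w : nat -> R) (C th : R) :
  (0 < n)%N -> 0 <= C -> 0 <= th -> (forall i, `|w i| <= C) ->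
  let e i := a i * b i * w i + a i * w i * y i + b i * w i * x i in
  (n%:R^-1 * \sum_(i < n) a i ^+ 2) * (n%:R^-1 * \sum_(i < n) b i ^+ 2) * n%:R <= th ^+ 2 ->
  `|(Num.sqrt n%:R)^-1 * \sum_(i < n) a i * w i * y i| <= th ->
  `|(Num.sqrt n%:R)^-1 * \sum_(i < n) b i * w i * x i| <= th ->
  n%:R^-1 * \sum_(i < n) (a i * w i * y i) ^+ 2 <= th ^+ 2 ->
  n%:R^-1 * \sum_(i < n) (b i * w i * x i) ^+ 2 <= th ^+ 2 ->
  `|(Num.sqrt n%:R)^-1 * \sum_(i < n) e i| <= 2 * (C + 2) * th /\
  n%:R^-1 * \sum_(i < n) e i ^+ 2 <= (2 * (C + 2) * th) ^+ 2.
Proof.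
move=> n0 C0 th0 wC e AB1 S1 S2 Q1 Q2.
have n0R : 0 < n%:R :> R by rewrite ltr0n.
have r0 : 0 < Num.sqrt n%:R :> R by rewrite sqrtr_gt0.
have r2 : Num.sqrt n%:R ^+ 2 = n%:R :> R by rewrite sqr_sqrtr// ltW.
set Sa := \sum_(i < n) a i ^+ 2 in AB1; set Sb := \sum_(i < n) b i ^+ 2 in AB1.
have Sa0 : 0 <= Sa by apply: sumr_ge0 => i _; exact: sqr_ge0.
have Sb0 : 0 <= Sb by apply: sumr_ge0 => i _; exact: sqr_ge0.
have AB : n%:R^-1 * (Sa * Sb) <= th ^+ 2.
  by apply: le_trans AB1; rewrite le_eqVlt; apply/orP; left; apply/eqP; field; rewrite gt_eqF.
(* Each a_i^2 is at most the sum [Sa], so the sum of a_i^2 b_i^2 is at most Sa Sb. *)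
have abw2 : \sum_(i < n) (a i * b i * w i) ^+ 2 <= C ^+ 2 * (Sa * Sb).
  rewrite mulrA mulr_sumr; apply: ler_sum => i _.
  have -> : (a i * b i * w i) ^+ 2 = w i ^+ 2 * a i ^+ 2 * b i ^+ 2 by ring.
  rewrite ler_wpM2r ?sqr_ge0// ler_pM ?sqr_ge0//.
    by rewrite -(real_normK (num_real (w i))) lerXn2r// nnegrE.
  by rewrite /Sa (bigD1 i)//= lerDl sumr_ge0// => j _; exact: sqr_ge0.
have abw1 : `|(Num.sqrt n%:R)^-1 * \sum_(i < n) a i * b i * w i| <= C * th.
  rewrite -ler_sqr ?nnegrE ?mulr_ge0// real_normK ?num_real// exprMn exprVn r2.
  have CS := cauchy_schwarz_sum n (fun i => a i * w i) b.
  have awS : \sum_(i < n) (a i * w i) ^+ 2 <= C ^+ 2 * Sa.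
    rewrite mulr_sumr; apply: ler_sum => i _; rewrite exprMn mulrC ler_wpM2r ?sqr_ge0//.
    by rewrite -(real_normK (num_real (w i))) lerXn2r// nnegrE.
  rewrite (eq_bigr (fun i : 'I_n => a i * w i * b i)); last by move=> i _; ring.
  apply: (@le_trans _ _ (n%:R^-1 * (C ^+ 2 * Sa * Sb))).
    rewrite ler_wpM2l ?invr_ge0 ?(ltW n0R)// (le_trans CS)// ler_wpM2r//.
  by rewrite -mulrA mulrCA exprMn ler_wpM2l ?sqr_ge0.
split.
  rewrite /e !big_split/= !mulrDr.
  rewrite (le_trans (ler_normD _ _))// (le_trans (lerD (ler_normD _ _) (lexx _)))//.
  by move: abw1 S1 S2; have := mulr_ge0 C0 th0; lra.
(* From (p + q + s)^2 <= 3 (p^2 + q^2 + s^2) the total is at most 3 (C^2 + 2) th^2, which 4 (C +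
   2)^2 th^2 covers; the linear bound (C + 2) th has the same room. *)
apply: (@le_trans _ _ (3 * (n%:R^-1 * \sum_(i < n) (a i * b i * w i) ^+ 2
   + n%:R^-1 * \sum_(i < n) (a i * w i * y i) ^+ 2
   + n%:R^-1 * \sum_(i < n) (b i * w i * x i) ^+ 2))).
  rewrite -!mulrDr mulrCA ler_wpM2l ?invr_ge0 ?(ltW n0R)// -!big_split/= mulr_sumr.
  apply: ler_sum => i _; rewrite /e.
  set p := a i * b i * w i; set q := a i * w i * y i; set s := b i * w i * x i.
  have := sqr_ge0 (p - q); have := sqr_ge0 (p - s); have := sqr_ge0 (q - s); nra.
have P1 : n%:R^-1 * \sum_(i < n) (a i * b i * w i) ^+ 2 <= C ^+ 2 * th ^+ 2.
  apply: (@le_trans _ _ (n%:R^-1 * (C ^+ 2 * (Sa * Sb)))).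
    by rewrite ler_wpM2l ?invr_ge0 ?(ltW n0R).
  by rewrite mulrCA ler_wpM2l ?sqr_ge0.
have := mulr_ge0 C0 (sqr_ge0 th); have := mulr_ge0 (sqr_ge0 C) (sqr_ge0 th).
have := sqr_ge0 th.
have -> : (2 * (C + 2) * th) ^+ 2 = 4 * (C ^+ 2 * th ^+ 2) + 16 * (C * th ^+ 2) + 16 * th ^+ 2 by ring.
by lra.
Qed.

(** One kp sg is the distance from [rr] to the affine image of [z]; the other two bound |svar z - 1|
    by kp + kp^2, with kp <= 1. *)
Lemma studentized_sub n (rr z : nat -> R) (sg rh kp : R) : (0 < n)%N ->
  0 < sg -> 0 <= kp <= 1 ->
  `|n%:R^-1 * (\sum_(i < n) z i ^+ 2) - 1| <= kp -> `|n%:R^-1 * \sum_(i < n) z i| <= kp ->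
  n%:R^-1 * \sum_(i < n) (rr i - (sg * z i + rh)) ^+ 2 <= (kp * sg) ^+ 2 ->
  `|Num.sqrt (svar n rr) - sg| <= 3 * kp * sg.
Proof.
move=> n0 sg0 /andP[kp0 kp1] z2 z1 e2.
have vz := svar_ge0 z n0.
have E1 : Num.sqrt (svar n (fun i => sg * z i + rh)) = sg * Num.sqrt (svar n z).
  by rewrite svar_affine// sqrtrM ?sqr_ge0// sqrtr_sqr gtr0_norm.
have D1 : `|Num.sqrt (svar n rr) - sg * Num.sqrt (svar n z)| <= kp * sg.
  rewrite -ler_sqr ?nnegrE ?mulr_ge0 ?(ltW sg0)// real_normK ?num_real// -E1.
  exact: le_trans (sqr_sqrt_svar_sub _ _ n0) e2.
have D2 : `|svar n z - 1| <= 2 * kp.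
  rewrite /svar /smean addrAC (le_trans (ler_normB _ _))//.
  have -> : 2 * kp = kp + kp by ring.
  rewrite lerD// normrX; apply: le_trans (_ : kp ^+ 2 <= _).
    by rewrite lerXn2r ?nnegrE.
  by rewrite expr2 ler_piMl.
have D3 := le_trans (normr_sqrt_sub1 vz) D2.
have -> : Num.sqrt (svar n rr) - sg =
   (Num.sqrt (svar n rr) - sg * Num.sqrt (svar n z)) + sg * (Num.sqrt (svar n z) - 1) by ring.
rewrite (le_trans (ler_normD _ _))// normrM (gtr0_norm sg0).
have : sg * `|Num.sqrt (svar n z) - 1| <= sg * (2 * kp) by rewrite ler_wpM2l// ltW.
by move: D1; lra.
Qed.

(** Slutsky's lemma for a single outcome. [dl < 1] makes [D] positive; clearing it changes [t] by
    |t| dl from [D] and by dl from [r], so the threshold moves in proportion to |t| + 1. *)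
Lemma slutsky_le (S r sg D dl t : R) : 0 < sg -> 0 <= dl -> dl < 1 ->
  `|r| <= dl * sg -> `|D - sg| <= dl * sg ->
  ((sg * S + r) / D <= t -> S <= t + dl * (`|t| + 1)) /\
  (S <= t - dl * (`|t| + 1) -> (sg * S + r) / D <= t).
Proof.
move=> sg0 dl0 dl1 rle Dle.
have D0 : 0 < D.
  by move: Dle; rewrite ler_norml => /andP[+ _]; nra.
have tD : `|t * D - t * sg| <= `|t| * (dl * sg) by rewrite -mulrBr normrM ler_wpM2l.
move: rle tD; rewrite !ler_norml => /andP[r1 r2] /andP[tD1 tD2].
have E : dl * (`|t| + 1) * sg = `|t| * (dl * sg) + dl * sg by ring.
split.
  rewrite ler_pdivrMr// => H; rewrite -(ler_pM2r sg0) mulrDl E [S * sg]mulrC; lra.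
move=> H; rewrite ler_pdivrMr//.
have : sg * S <= t * sg - dl * (`|t| + 1) * sg.
  by rewrite -mulrBl mulrC ler_wpM2r// ltW.
rewrite E; lra.
Qed.

End finite_sums.

(** * Residuals and standardization *)

Section regression.
Context {R : realType} {d : nat}.
Variable P : probability (@Obs R d) R.

Lemma measurable_preimage_Zc (B : set (@Zsp R d)) : measurable B ->
  measurable (@Zc R d @^-1` B).
Proof. by move=> mB; rewrite -[X in measurable X]setTI; exact: measurable_Zc. Qed.

Lemma integral_restrict_support (D : set (@Obs R d)) (k : @Obs R d -> \bar R) :
  (forall o, ~ D o -> k o = 0)%E -> (\int[P]_o k o = \int[P]_(o in D) k o)%E.
Proof.
move=> k0; rewrite [RHS]integral_mkcond; apply: eq_integral => o _.
rewrite patchE; case: ifPn => // /negP oD; rewrite k0// => Do; apply: oD.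
by rewrite inE.
Qed.

(** Testing the defining identity on c >= 0 and on c < 0 shows that both parts of [c (Zc o)] have a
    finite integral. *)
Lemma cond_exp_integrable h (c : @Zsp R d -> R) : cond_exp P h c ->
  P.-integrable setT (EFin \o (fun o => c (Zc o))).
Proof.
move=> [mc [ih hc]].
have mcZ : measurable_fun setT (fun o : @Obs R d => c (Zc o)).
  exact: measurableT_comp mc (@measurable_Zc R d).
pose F := EFin \o (fun o : @Obs R d => c (Zc o)).
have mF : measurable_fun setT F by exact/measurable_EFinP.
have fin B : measurable B -> (\int[P]_(o in Zc @^-1` B) F o)%E \is a fin_num.
  move=> mB; rewrite -hc//; apply: integrable_fin_num.
    exact: measurable_preimage_Zc.
  by apply: (integrableS measurableT _ _ ih) => //; exact: measurable_preimage_Zc.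
pose Bp := [set z | 0 <= c z]; pose Bn := [set z | c z < 0].
have mBp : measurable Bp.
  have := mc measurableT `[0, +oo[%classic (measurable_itv _).
  by rewrite setTI; congr measurable; apply/seteqP; split => z /=; rewrite in_itv/= andbT.
have mBn : measurable Bn.
  have := mc measurableT `]-oo, 0[%classic (measurable_itv _).
  by rewrite setTI; congr measurable; apply/seteqP; split => z /=; rewrite in_itv.
have Fp : (\int[P]_o F^\+ o < +oo)%E.
  rewrite (@integral_restrict_support (Zc @^-1` Bp)); last first.
    move=> o /negP; rewrite /Bp /= -ltNge => co.
    by rewrite funeposE; apply/max_idPr; rewrite lee_fin ltW.
  have := fin _ mBp; rewrite ge0_fin_numE; last first.
    by apply: integral_ge0 => o /=; rewrite lee_fin.
  by congr (_ < _)%E; apply: eq_integral => o; rewrite inE /= => co;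
    rewrite funeposE; apply/esym/max_idPl; rewrite lee_fin.
have Fn : (\int[P]_o F^\- o < +oo)%E.
  rewrite (@integral_restrict_support (Zc @^-1` Bn)); last first.
    move=> o /negP; rewrite /Bn /= -leNgt => co.
    by rewrite funenegE; apply/max_idPr; rewrite /F/= lee_fin oppr_le0.
  have := fin _ mBn; rewrite integralE.
  rewrite (_ : \int[P]_(o in Zc @^-1` Bn) F^\+ o = 0)%E; last first.
    apply: integral0_eq => o /= co; rewrite funeposE; apply/max_idPr.
    by rewrite lee_fin ltW.
  rewrite sub0e fin_numN ge0_fin_numE//.
  by apply: integral_ge0.
apply/integrableP; split => //.
rewrite (eq_integral (fun o => F^\+ o + F^\- o)%E); last first.
  by move=> o _; rewrite -[LHS]/((abse \o F) o) fune_abse.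
rewrite ge0_integralD//; first exact: lte_add_pinfty.
- exact: measurable_funepos.
- exact: measurable_funeneg.
Qed.

(** E[k | Z] = 0 in the form that [prodlaw_cond_integral0] consumes. *)
Lemma cond_exp_residual h (c : @Zsp R d -> R) : cond_exp P h c ->
  let k o := h o - c (Zc o) in
  P.-integrable setT (EFin \o k) /\ forall B, measurable B ->
  (\int[P]_(o in Zc @^-1` B) (k^\+ o)%:E = \int[P]_(o in Zc @^-1` B) (k^\- o)%:E)%E.
Proof.
move=> hc k; have ic := cond_exp_integrable hc.
have [mc [ih E]] := hc.
have ik : P.-integrable setT (EFin \o k) by exact: integrable_subr.
split=> // B mB; have mB' := measurable_preimage_Zc mB.
have ikB := integrableS measurableT mB' (@subsetT _ _) ik.
have ihB := integrableS measurableT mB' (@subsetT _ _) ih.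
have icB := integrableS measurableT mB' (@subsetT _ _) ic.
have : (\int[P]_(o in Zc @^-1` B) (k o)%:E = 0)%E.
  under eq_integral do rewrite EFinB.
  rewrite integralB// E// subee//.
  exact: (integrable_fin_num mB' icB).
have ip := integrable_pos_fin_num mB' ikB; have ineg := integrable_neg_fin_num mB' ikB.
rewrite integralE -(fineK ip) -(fineK ineg) -EFinB => -[/eqP]; rewrite subr_eq0 => /eqP pn.
have -> : (\int[P]_(o in Zc @^-1` B) (k^\+ o)%:E = \int[P]_(o in Zc @^-1` B) (EFin \o k)^\+ o)%E.
  by apply: eq_integral => o _; rewrite funeposE /= -EFin_max.
have -> : (\int[P]_(o in Zc @^-1` B) (k^\- o)%:E = \int[P]_(o in Zc @^-1` B) (EFin \o k)^\- o)%E.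
  by apply: eq_integral => o _; rewrite funenegE /= -EFin_max.
by rewrite -(fineK ip) pn fineK.
Qed.

End regression.

(** * Standardization and the Lindeberg moment *)

Section standardized.
Context {R : realType} {d : nat}.
Variables (P : probability (@Obs R d) R) (zeta : @Obs R d -> R).
Hypothesis mzeta : measurable_fun setT zeta.
Hypothesis izeta2 : P.-integrable setT (EFin \o (fun o => zeta o ^+ 2)).

Definition standardize (o : @Obs R d) : R :=
  (zeta o - fine (expectation P zeta)) / Num.sqrt (fine (variance P zeta)).

Hypothesis var0 : 0 < fine (variance P zeta).

Lemma integrable_of_sqr : P.-integrable setT (EFin \o zeta).
Proof.
apply: (@dominated_integrable _ _ _ _ _ (fun o => 1 + zeta o ^+ 2)) => //.
  move=> o; have := sqr_ge0 (`|zeta o| - 1); rewrite sqrrB real_normK ?num_real//.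
  have := normr_ge0 (zeta o); have := sqr_ge0 (zeta o); lra.
by apply: integrable_addr => //; exact: integrable_cst_probability.
Qed.

Lemma standardize_moments : [/\ measurable_fun setT standardize,
  P.-integrable setT (EFin \o standardize),
  P.-integrable setT (EFin \o (fun o => standardize o ^+ 2)),
  \int[P]_o standardize o = 0 & \int[P]_o (standardize o ^+ 2) = 1].
Proof.
have iz := integrable_of_sqr.
set m := fine (expectation P zeta); set s2 := fine (variance P zeta).
have mE : m = \int[P]_o zeta o by rewrite /m unlock.
have s2E : s2 = \int[P]_o ((zeta o - m) ^+ 2).
  by rewrite /s2 /variance covariance.unlock [in LHS]expectation.unlock mE.
have r2 : Num.sqrt s2 ^+ 2 = s2 by rewrite sqr_sqrtr// ltW.
have ic : P.-integrable setT (EFin \o (fun o => zeta o - m)).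
  by apply: integrable_subr => //; exact: integrable_cst_probability.
have ic2 : P.-integrable setT (EFin \o (fun o => (zeta o - m) ^+ 2)).
  have i1 := integrable_subr izeta2 (integrable_mulr (2 * m) iz).
  apply: (eq_integrable_fun _ (integrable_addr i1 (integrable_cst_probability P (m ^+ 2)))) => o.
  by ring.
have E o : standardize o = (Num.sqrt s2)^-1 * (zeta o - m) by rewrite /standardize mulrC.
have E2 o : standardize o ^+ 2 = s2^-1 * (zeta o - m) ^+ 2 by rewrite E exprMn exprVn r2.
split.
- by apply: measurable_funM => //; exact: measurable_funB.
- by apply: (eq_integrable_fun _ (integrable_mulr (Num.sqrt s2)^-1 ic)) => o; rewrite E.
- by apply: (eq_integrable_fun _ (integrable_mulr (s2^-1) ic2)) => o; rewrite E2.
- under eq_Rintegral do rewrite E.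
  rewrite RintegralZl// RintegralB//; last exact: integrable_cst_probability.
  by rewrite Rintegral_cst_probability -mE subrr mulr0.
- under eq_Rintegral do rewrite E2.
  by rewrite RintegralZl// -s2E mulVf// gt_eqF.
Qed.

(** Where |Y| > K the minimum is at most Y^2, elsewhere at most K Y^2 / sqrt n; the second part
    integrates to K / sqrt n because E Y^2 = 1. *)
Lemma lindeberg_moment_le n K k : (0 < n)%N -> 0 <= K ->
  \int[P]_o (if `|standardize o| <= K then 0 else standardize o ^+ 2) <= k ->
  lindeberg_moment P standardize n <= k + K / Num.sqrt n%:R.
Proof.
move=> n0 K0 kU; have [mY iY iY2 _ E2] := standardize_moments.
set Y := standardize in kU mY iY iY2 E2 *.
have r0 : 0 < Num.sqrt n%:R :> R by rewrite sqrtr_gt0 ltr0n.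
have mU : measurable_fun setT (fun o => if `|Y o| <= K then 0 else Y o ^+ 2).
  have mc : measurable_fun setT (fun o => `|Y o| <= K).
    by apply: measurable_fun_ler => //; exact: (measurableT_comp (@normr_measurable R setT) mY).
  by apply: measurable_fun_ifT => //; exact: measurable_funX.
have iU : P.-integrable setT (EFin \o (fun o => if `|Y o| <= K then 0 else Y o ^+ 2)).
  apply: (dominated_integrable mU _ iY2) => o.
  case: (`|Y o| <= K); first by rewrite normr0 sqr_ge0.
  by rewrite ger0_norm ?sqr_ge0.
have iKY := integrable_mulr (K / Num.sqrt n%:R) iY2.
apply: (@le_trans _ _ (\int[P]_o ((if `|Y o| <= K then 0 else Y o ^+ 2) + K / Num.sqrt n%:R * Y o ^+ 2))).
  apply: le_Rintegral => //.
  - apply: (dominated_integrable _ _ iY2).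
      apply/measurable_minr; first exact: measurable_funX.
      by apply: measurable_funM => //; apply: measurable_funX; apply: measurableT_comp.
    move=> o; rewrite ger0_norm ?ge_min ?lexx//.
    by rewrite le_min sqr_ge0/= divr_ge0 ?sqrtr_ge0// exprn_ge0.
  - exact: integrable_addr.
  - move=> o _; case: ifPn => YK.
      rewrite add0r ge_min; apply/orP; right.
      rewrite exprS real_normK ?num_real// mulrAC ler_wpM2r ?sqr_ge0//.
      by rewrite ler_wpM2r// invr_ge0 sqrtr_ge0.
    rewrite ge_min; apply/orP; left.
    by rewrite lerDl mulr_ge0 ?sqr_ge0// divr_ge0 ?sqrtr_ge0.
by rewrite RintegralD// RintegralZl// E2 mulr1 lerD2r.
Qed.

End standardized.

Section iid_clt_data.
Context {R : realType} {dO dA : measure_display} {Om : measurableType dO}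
  {Aux : measurableType dA} {d : nat}.
Variables (P : probability (@Obs R d) R) (Q : probability Om R) (n : nat)
  (obs : nat -> Om -> @Obs R d) (aux : Om -> Aux).
Hypothesis mobs : forall i, measurable_fun setT (obs i).
Hypothesis maux : measurable_fun setT aux.
Hypothesis iid : iid_indep_aux P Q n obs aux.

Let mtn j : measurable_fun [set: Aux * n.-tuple (@Obs R d)] (fun p => tnth p.2 j).
Proof. by apply: (measurableT_comp (measurable_tnth j)). Qed.

Lemma pairwise_prodlaw i j : (i < n)%N -> (j < n)%N -> i != j ->
  prodlaw Q P (obs i) (obs j).
Proof.
move=> ni nj ij B D mB mD.
have := prodlaw_comp (mtn (Ordinal nj)) (rest_prodlaw mobs maux iid ni) mB mD.
have -> : (fun p : Aux * n.-tuple (@Obs R d) => tnth p.2 (Ordinal nj)) \o rest n obs aux i = obs j.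
  by apply/funext => om /=; rewrite tnth_mktuple/= eq_sym (negbTE ij).
by [].
Qed.

(** The partial sum reads only indices below [k], so it is a function of [rest] that never looks at
    the overwritten coordinate. *)
Lemma nsum_prodlaw (Y : @Obs R d -> R) k : measurable_fun setT Y -> (k < n)%N ->
  prodlaw Q P (obs k) (nsum obs Y n k).
Proof.
move=> mY kn B D mB mD.
pose phi (p : Aux * n.-tuple (@Obs R d)) : R :=
  \sum_(j < n) if (j < k)%N then Y (tnth p.2 j) / Num.sqrt n%:R else 0.
have mphi : measurable_fun setT phi.
  apply: measurable_sum => j; case: (j < k)%N => //.
  by apply: measurable_funM => //; exact: measurableT_comp mY (mtn j).
have := prodlaw_comp mphi (rest_prodlaw mobs maux iid kn) mB mD.
have -> : phi \o rest n obs aux k = nsum obs Y n k.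
  apply/funext => om /=; rewrite /phi /nsum -(big_mkcond (fun j : 'I_n => (j < k)%N))/=.
  rewrite (big_ord_widen n (fun i => Y (obs i om) / Num.sqrt n%:R) (ltnW kn)).
  by apply: eq_bigr => j jk; rewrite tnth_mktuple/= ltn_eqF.
by [].
Qed.

End iid_clt_data.

(** * The studentized statistic *)

Section near_facts.
Context {R : realType}.

Lemma near_div_le (c e : R) : 0 < e -> \forall n \near \oo, c / n%:R <= e.
Proof.
move=> e0; near=> n.
have n0 : 0 < n%:R :> R by rewrite ltr0n; near: n; exists 1%N.
rewrite ler_pdivrMr// mulrC -ler_pdivrMr//.
by near: n; exact: nbhs_infty_ger.
Unshelve. all: by end_near. Qed.

Lemma near_div_sqrt_le (c e : R) : 0 < e -> \forall n \near \oo, c / Num.sqrt n%:R <= e.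
Proof.
move=> e0; near=> n.
have n0 : 0 < n%:R :> R by rewrite ltr0n; near: n; exists 1%N.
rewrite ler_pdivrMr ?sqrtr_gt0// mulrC -ler_pdivrMr// (le_trans (ler_norm _))//.
rewrite -sqrtr_sqr ler_sqrt ?ler0n//.
by near: n; exact: nbhs_infty_ger.
Unshelve. all: by end_near. Qed.

End near_facts.

Section union_bound.
Context {R : realType} {d : measure_display} {T : measurableType d}.

(** Measurability travels with the bound, so that applications nest. *)
Lemma union_bound (Q : probability T R) (A B : set T) (a b : R) :
  measurable A /\ (Q A <= a%:E)%E -> measurable B /\ (Q B <= b%:E)%E ->
  measurable (A `|` B) /\ (Q (A `|` B) <= (a + b)%:E)%E.
Proof.
move=> [mA Aa] [mB Bb]; split; first exact: measurableU.
by rewrite EFinD (le_trans (measureU2 _ mA mB))// leeD.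
Qed.

Lemma fine_probability_le (Q : probability T R) (A B C : set T) (p : R) :
  measurable A -> measurable B -> measurable C -> (Q C <= p%:E)%E ->
  (forall x, A x -> ~ C x -> B x) -> fine (Q A) <= fine (Q B) + p.
Proof.
move=> mA mB mC Cp ABC.
rewrite -lee_fin EFinD !fineK ?fin_num_measure//.
apply: (@le_trans _ _ (Q (B `|` C))).
  apply: le_measure; rewrite ?inE//; first exact: measurableU.
  by move=> x Ax; have [Cx|nCx] := pselect (C x); [right|left; exact: ABC].
by rewrite (le_trans (measureU2 _ mB mC))// leeD2l.
Qed.

End union_bound.

Section core.
Context {R : realType} {d : nat} {dO dA : measure_display}
  {Om : measurableType dO} {Aux : measurableType dA}.
Variables (Pr : probability (@Obs R d) R -> nat -> probability Om R)
  (obs : nat -> nat -> Om -> @Obs R d) (aux : nat -> Om -> Aux)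
  (Fh Gh : nat -> Aux -> @Zsp R d -> R) (w : @Zsp R d -> R) (C : R)
  (f g u v : probability (@Obs R d) R -> @Zsp R d -> R).
Hypotheses (mobs : forall n i, measurable_fun setT (obs n i))
  (maux : forall n, measurable_fun setT (aux n))
  (mFh : forall n, measurable_fun setT (fun p : Aux * @Zsp R d => Fh n p.1 p.2))
  (mGh : forall n, measurable_fun setT (fun p : Aux * @Zsp R d => Gh n p.1 p.2))
  (mw : measurable_fun setT w) (C0 : 0 < C) (wC : forall z, `|w z| <= C).

Let smp n om := fun i => obs n i om.
Let fh n om := Fh n (aux n om).
Let gh n om := Gh n (aux n om).
Let TN n om := tauN n (smp n om) (fh n om) (gh n om) w.
Let TD n om := tauD n (smp n om) (fh n om) (gh n om) w.
Let TT n om := Tstat n (smp n om) (fh n om) (gh n om) w.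
Let AfAg P n om := Af n (smp n om) (fh n om) (f P) * Ag n (smp n om) (gh n om) (g P).
Let BF P n om := Bf n (smp n om) (fh n om) (f P) (v P).
Let BG P n om := Bg n (smp n om) (gh n om) (g P) (u P).
Let centered P n om := TT n om - Num.sqrt n%:R * rho P (f P) (g P) w / TD n om.

Definition score (P : probability (@Obs R d) R) (o : @Obs R d) : R :=
  eps (f P) o * xi (g P) o * w (Zc o).

Local Notation Y P := (standardize P (score P)).
Local Notation sg P := (Num.sqrt (sigma2 P (f P) (g P) w)).

Variable fam : set (probability (@Obs R d) R).
Hypothesis model : forall P, fam P ->
  (forall n, iid_indep_aux P (Pr P n) n (obs n) (aux n)) /\
  regr_functions P (f P) (g P) (u P) (v P).
Hypothesis oAB : little_o_fam fam Pr AfAg (fun _ n _ => n%:R^-1).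
Hypothesis oBF : little_o_fam fam Pr BF (fun _ _ _ => 1).
Hypothesis oBG : little_o_fam fam Pr BG (fun _ _ _ => 1).
Variable s0 : R.
Hypotheses (s00 : 0 < s0) (s0sg : forall P, fam P -> s0 <= sg P).
Hypothesis iz2 : forall P, fam P -> P.-integrable setT (EFin \o (fun o => score P o ^+ 2)).
Hypothesis UI : forall k : R, 0 < k -> exists2 K : R, 0 <= K & forall P, fam P ->
  \int[P]_o (if `|Y P o| <= K then 0 else Y P o ^+ 2) <= k.

Let maz n i (F : Aux * @Zsp R d -> R) : measurable_fun setT F ->
  measurable_fun setT (fun om => F (aux n om, Zc (obs n i om))).
Proof.
move=> mF; apply: (measurableT_comp mF); apply: measurable_fun_pair => //.
exact: measurableT_comp (@measurable_Zc R d) (mobs n i).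
Qed.

Let mz n i (F : @Zsp R d -> R) : measurable_fun setT F ->
  measurable_fun setT (fun om => F (Zc (obs n i om))).
Proof.
move=> mF; apply: (measurableT_comp mF).
exact: measurableT_comp (@measurable_Zc R d) (mobs n i).
Qed.

Lemma measurable_Xc : measurable_fun setT (@Xc R d).
Proof. exact: measurable_tnth. Qed.

Lemma measurable_Yc : measurable_fun setT (@Yc R d).
Proof. exact: measurable_tnth. Qed.

Let mRi n i : measurable_fun setT (fun om => Ri (smp n om) (fh n om) (gh n om) w i).
Proof.
have mX := measurableT_comp measurable_Xc (mobs n i).
have mY := measurableT_comp measurable_Yc (mobs n i).
apply: measurable_funM; last exact: mz.
apply: measurable_funM; apply: measurable_funB => //; first exact: maz (mFh n).
exact: maz (mGh n).
Qed.

Let mTN n : measurable_fun setT (TN n).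
Proof. by apply: measurable_funM => //; apply: measurable_sum => i; exact: mRi. Qed.

Let mTD n : measurable_fun setT (TD n).
Proof.
apply: (measurableT_comp (continuous_measurable_fun (@sqrt_continuous R))).
apply: measurable_funB.
  apply: measurable_funM => //; apply: measurable_sum => i.
  by apply: measurable_funX; exact: mRi.
apply: measurable_funX; apply: measurable_funM => //.
by apply: measurable_sum => i; exact: mRi.
Qed.

Let mcentered P n : measurable_fun setT (centered P n).
Proof.
have mV : measurable_fun setT (fun om => (TD n om)^-1).
  (* Since [TD] is nonnegative its inverse is the real power -1, a measurable function, including at
     the default value 0 of the inverse at 0. *)
  rewrite (_ : (fun om => _) = (fun om => TD n om `^ (-1))).
    exact: (measurableT_comp (measurable_powR (-1)) (mTD n)).
  by apply/funext => om; rewrite powR_inv1// sqrtr_ge0.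
apply: measurable_funB; first exact: (measurable_funM (mTN n) mV).
exact: (measurable_funM (measurable_cst _) mV).
Qed.

Let mscore P : fam P -> measurable_fun setT (score P).
Proof.
move=> /model[_ [[mf _] [[mg _] _]]].
have mZ (F : @Zsp R d -> R) : measurable_fun setT F ->
    measurable_fun setT (fun o : @Obs R d => F (Zc o)).
  by move=> mF; exact: measurableT_comp mF (@measurable_Zc R d).
apply: measurable_funM; last exact: mZ.
apply: measurable_funM; apply: measurable_funB; by [exact: measurable_Xc|exact: measurable_Yc|exact: mZ].
Qed.

Let sg0 P : fam P -> 0 < sg P. Proof. by move=> /s0sg; exact: lt_le_trans. Qed.

Let var0 P : fam P -> 0 < fine (variance P (score P)).
Proof. by move=> /sg0; rewrite sqrtr_gt0. Qed.

Let moments P (FP : fam P) := standardize_moments (mscore FP) (iz2 FP) (var0 FP).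

Let scoreE P o : fam P -> score P o = sg P * Y P o + rho P (f P) (g P) w.
Proof.
move=> FP; rewrite /standardize mulrC divfK ?subrK//.
by rewrite gt_eqF// sg0.
Qed.

(** What [slutsky_le] needs at one outcome. Both tolerances are relative to sigma, so no upper bound
    on sigma is involved. *)
Definition good_event kp P n om := exists2 r : R, `|r| <= kp * sg P &
  TN n om = sg P * nsum (obs n) (Y P) n n om + Num.sqrt n%:R * rho P (f P) (g P) w + r /\
  `|TD n om - sg P| <= 3 * kp * sg P.

(** The deterministic half: seven sample inequalities imply the good event. [th] is chosen so that
    the factor 2 (C + 2) of [residual_expansion_bounds] gives kp s0, which is at most kp sigma for
    every member of the family. *)
Lemma good_event_of_bounds kp P n om (th := kp * s0 / (2 * (C + 2))) :
  (0 < n)%N -> fam P -> 0 < kp <= 1 ->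
  `|AfAg P n om / n%:R^-1| <= th ^+ 2 ->
  `|(Num.sqrt n%:R)^-1 * \sum_(i < n) (f P (Zc (obs n i om)) - Fh n (aux n om) (Zc (obs n i om))) * w (Zc (obs n i om)) * xi (g P) (obs n i om)| <= th ->
  `|(Num.sqrt n%:R)^-1 * \sum_(i < n) (g P (Zc (obs n i om)) - Gh n (aux n om) (Zc (obs n i om))) * w (Zc (obs n i om)) * eps (f P) (obs n i om)| <= th ->
  n%:R^-1 * \sum_(i < n) ((f P (Zc (obs n i om)) - Fh n (aux n om) (Zc (obs n i om))) * w (Zc (obs n i om)) * xi (g P) (obs n i om)) ^+ 2 <= th ^+ 2 ->
  n%:R^-1 * \sum_(i < n) ((g P (Zc (obs n i om)) - Gh n (aux n om) (Zc (obs n i om))) * w (Zc (obs n i om)) * eps (f P) (obs n i om)) ^+ 2 <= th ^+ 2 ->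
  `|n%:R^-1 * (\sum_(i < n) Y P (obs n i om) ^+ 2) - 1| <= kp ->
  `|n%:R^-1 * \sum_(i < n) Y P (obs n i om)| <= kp ->
  good_event kp P n om.
Proof.
move=> n0 FP /andP[kp0 kp1] E1 E2 E2' E3 E3' E4 E5.
have n0R : 0 < n%:R :> R by rewrite ltr0n.
have r0 : 0 < Num.sqrt n%:R :> R by rewrite sqrtr_gt0.
have r2 : Num.sqrt n%:R ^+ 2 = n%:R :> R by rewrite sqr_sqrtr// ltW.
have C2 : 0 < C + 2 by rewrite addr_gt0.
have th0 : 0 <= th by rewrite divr_ge0 ?mulr_ge0 ?(ltW kp0) ?(ltW s00) ?(ltW C2).
pose a i := f P (Zc (obs n i om)) - Fh n (aux n om) (Zc (obs n i om)).
pose b i := g P (Zc (obs n i om)) - Gh n (aux n om) (Zc (obs n i om)).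
pose x i := eps (f P) (obs n i om).
pose y i := xi (g P) (obs n i om).
pose wi i := w (Zc (obs n i om)).
have E1' : (n%:R^-1 * \sum_(i < n) a i ^+ 2) * (n%:R^-1 * \sum_(i < n) b i ^+ 2) * n%:R <= th ^+ 2.
  by move: E1; rewrite invrK; apply: le_trans; exact: ler_norm.
pose e i := a i * b i * wi i + a i * wi i * y i + b i * wi i * x i.
have thE : 2 * (C + 2) * th = kp * s0 by rewrite /th; field; rewrite gt_eqF.
have [B1 B2] : `|(Num.sqrt n%:R)^-1 * \sum_(i < n) e i| <= kp * s0 /\
    n%:R^-1 * \sum_(i < n) e i ^+ 2 <= (kp * s0) ^+ 2.
  rewrite -thE.
  exact: (@residual_expansion_bounds R n a b x y wi C th n0 (ltW C0) th0 (fun i => wC _) E1' E2 E2' E3 E3').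
pose Rr i := Ri (smp n om) (fh n om) (gh n om) w i.
pose ze i := sg P * Y P (obs n i om) + rho P (f P) (g P) w.
have RE i : Rr i = ze i + e i.
  rewrite /ze -scoreE// /Rr /Ri /score /e /a /b /x /y /wi /eps /xi /smp /fh /gh; ring.
have kps : kp * s0 <= kp * sg P by rewrite ler_wpM2l ?(ltW kp0)// s0sg.
exists ((Num.sqrt n%:R)^-1 * \sum_(i < n) e i); first exact: le_trans kps.
split.
  rewrite /TN /tauN (eq_bigr (fun i : 'I_n => ze i + e i)); last by move=> i _; exact: RE.
  rewrite big_split/= mulrDr; congr (_ + _).
  set SY := \sum_(i < n) Y P (obs n i om).
  have -> : \sum_(i < n) ze i = sg P * SY + n%:R * rho P (f P) (g P) w.
    by rewrite /ze big_split/= sumr_const card_ord -[_ *+ n]mulr_natl /SY mulr_sumr.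
  have -> : nsum (obs n) (Y P) n n om = (Num.sqrt n%:R)^-1 * SY.
    by rewrite /nsum /SY mulr_sumr; apply: eq_bigr => i _; exact: mulrC.
  rewrite -[in n%:R * rho _ _ _ _]r2; field.
  by rewrite gt_eqF.
have -> : TD n om = Num.sqrt (svar n Rr) by [].
apply: (@studentized_sub R n Rr (fun i => Y P (obs n i om)) (sg P) (rho P (f P) (g P) w) kp n0 (sg0 FP)) => //.
  by rewrite (ltW kp0).
rewrite (eq_bigr (fun i : 'I_n => e i ^+ 2)); last first.
  by move=> i _; rewrite RE /ze addrAC subrr add0r.
by apply: (le_trans B2); rewrite lerXn2r// nnegrE mulr_ge0 ?(ltW kp0) ?(ltW s00)// (ltW (sg0 FP)).
Qed.


Let mdev n (F : Aux * @Zsp R d -> R) (h : @Obs R d -> R) i :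
  measurable_fun setT F -> measurable_fun setT h ->
  measurable_fun setT (fun om => F (aux n om, Zc (obs n i om)) * h (obs n i om)).
Proof.
move=> mF mh; apply: measurable_funM; first exact: maz.
exact: measurableT_comp.
Qed.

(* [c - Ch] is the regression error of one variable, [h] the noise of the
   other, and [V] the conditional second moment of [h]. *)
Let cross_term_events P n (c : @Zsp R d -> R) (Ch : nat -> Aux -> @Zsp R d -> R)
    (h : @Obs R d -> R) (V : @Zsp R d -> R) (eta q th : R) :
  (0 < n)%N -> fam P -> 0 <= eta -> 0 < th -> C ^+ 2 * eta / th ^+ 2 <= q ->
  measurable_fun setT c ->
  measurable_fun setT (fun p : Aux * @Zsp R d => Ch n p.1 p.2) ->
  measurable_fun setT h -> measurable_fun setT V -> (forall z, 0 <= V z) ->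
  (forall B, measurable B ->
    (\int[P]_(o in Zc @^-1` B) (h o ^+ 2)%:E = \int[P]_(o in Zc @^-1` B) (V (Zc o))%:E)%E) ->
  (forall B, measurable B ->
    (\int[P]_(o in Zc @^-1` B) (h^\+ o)%:E = \int[P]_(o in Zc @^-1` B) (h^\- o)%:E)%E) ->
  (Pr P n [set om | (eta < `|(n%:R^-1 * \sum_(i < n) (c (Zc (obs n i om)) - Ch n (aux n om) (Zc (obs n i om))) ^+ 2 * V (Zc (obs n i om))) / 1|)%R] <= q%:E)%E ->
  let s om := fun i : nat => (c (Zc (obs n i om)) - Ch n (aux n om) (Zc (obs n i om))) * w (Zc (obs n i om)) * h (obs n i om) in
  (measurable [set om | th < `|(Num.sqrt n%:R)^-1 * \sum_(i < n) s om i|] /\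
   (Pr P n [set om | (th < `|(Num.sqrt n%:R)^-1 * \sum_(i < n) s om i|)%R] <= (2 * q)%:E)%E) /\
  (measurable [set om | th ^+ 2 < n%:R^-1 * \sum_(i < n) s om i ^+ 2] /\
   (Pr P n [set om | (th ^+ 2 < n%:R^-1 * \sum_(i < n) s om i ^+ 2)%R] <= (2 * q)%:E)%E).
Proof.
move=> n0 FP eta0 th0 etaq mc mCh mh mV V0 hV hpn hB s.
pose A (p : Aux * @Zsp R d) := (c p.2 - Ch n p.1 p.2) * w p.2.
pose b (p : Aux * @Zsp R d) := (c p.2 - Ch n p.1 p.2) ^+ 2 * V p.2.
have mdif : measurable_fun setT (fun p : Aux * @Zsp R d => c p.2 - Ch n p.1 p.2).
  by apply: measurable_funB => //; exact: measurableT_comp mc measurable_snd.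
have mA : measurable_fun setT A.
  by apply: measurable_funM => //; exact: measurableT_comp mw measurable_snd.
have mb : measurable_fun setT b.
  apply: measurable_funM; first exact: measurable_funX.
  exact: measurableT_comp mV measurable_snd.
have b0 p : 0 <= b p by rewrite mulr_ge0 ?sqr_ge0.
have AVb p : A p ^+ 2 * V p.2 <= C ^+ 2 * b p.
  rewrite /A /b exprMn mulrAC [leRHS]mulrC; apply: ler_wpM2l.
    by rewrite mulr_ge0 ?sqr_ge0.
  by rewrite -[leLHS](real_normK (num_real (w p.2))) lerXn2r ?nnegrE ?(ltW C0).
have iid := (model FP).1 n.
have avgE om : aux_avg n (obs n) (aux n) b om =
    n%:R^-1 * \sum_(i < n) (c (Zc (obs n i om)) - Ch n (aux n om) (Zc (obs n i om))) ^+ 2 * V (Zc (obs n i om)) by [].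
have hB' : (Pr P n [set om | (eta < aux_avg n (obs n) (aux n) b om)%R] <= q%:E)%E.
  move: hB; congr (Pr P n _ <= _)%E; apply/seteqP; split => om /=;
    rewrite divr1 -avgE ger0_norm// mulr_ge0 ?invr_ge0// sumr_ge0//.
split; split.
- apply: measurable_set_gt; apply: measurableT_comp => //; apply: measurable_funM => //.
  by apply: measurable_sum => i; exact: (mdev n i mA mh).
- apply: (le_trans (truncated_sum_deviation (mobs n) (maux n) iid n0 mA mb mh mV V0 b0 eta0 AVb hV hpn th0)).
  (* One [q] pays for the event where B_f or B_g exceeds [eta], the other for the moment bound. The
     level th^2 for the mean square makes that bound C^2 eta / th^2 in both cases. *)
  rewrite (_ : 2 * q = q + q); last by ring.
  by rewrite EFinD leeD// lee_fin.
- apply: measurable_set_gt; apply: measurable_funM => //.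
  by apply: measurable_sum => i; apply: measurable_funX; exact: (mdev n i mA mh).
- have D := truncated_sqr_deviation (mobs n) (maux n) iid n0 mA mb mh mV V0 b0 eta0 AVb hV (exprn_gt0 2 th0).
  apply: le_trans D _.
  rewrite (_ : 2 * q = q + q); last by ring.
  by rewrite EFinD leeD// lee_fin.
Qed.

Lemma good_event_near (kp e : R) : 0 < kp <= 1 -> 0 < e ->
  \forall n \near \oo, (0 < n)%N /\ forall P, fam P ->
    exists2 Bad : set Om, measurable Bad /\ (Pr P n Bad <= e%:E)%E &
      forall om, ~ Bad om -> good_event kp P n om.
Proof.
move=> /andP[kp0 kp1] e0.
pose th := kp * s0 / (2 * (C + 2)).
have th0 : 0 < th by rewrite divr_gt0 ?mulr_gt0 ?addr_gt0.
(* The product A_f A_g and the mean of the scores cost [q] each; the two sums and two mean squares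
   of cross terms and the mean of the squared scores cost 2 q each: 12 q in all. *)
pose q := e / 12.
have q0 : 0 < q by rewrite divr_gt0.
pose eta := q * th ^+ 2 / C ^+ 2.
have eta0 : 0 < eta by apply: divr_gt0; [apply: mulr_gt0 => //|]; exact: exprn_gt0.
have etaq : C ^+ 2 * eta / th ^+ 2 <= q.
  by rewrite le_eqVlt; apply/orP; left; apply/eqP; rewrite /eta; field; rewrite !gt_eqF.
(* The first entry makes the Markov term 3 k / kp at most [q]; the second is the hypothesis k <= dl
   / 3 of [iid_mean_sqr_deviation]. *)
pose k := Num.min (q * kp / 3) (kp / 3).
have k0 : 0 < k by rewrite lt_min; apply/andP; split; apply: divr_gt0 => //; exact: mulr_gt0.
have kkp : k <= kp / 3 by rewrite ge_min lexx orbT.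
have kq : 3 * k / kp <= q.
  rewrite ler_pdivrMr// -ler_pdivlMl// (le_trans (_ : _ <= q * kp / 3)) ?ge_min ?lexx//.
  by rewrite mulrC.
have [K K0 UK] := UI k0.
near=> n.
have n0 : (0 < n)%N by near: n; exists 1%N.
split=> // P FP.
have [iid [hf [hg [hu hv]]]] := model FP.
have [mf _] := hf; have [mg _] := hg; have [mu [u0 hu2]] := hu; have [mv [v0 hv2]] := hv.
have mZ (F : @Zsp R d -> R) : measurable_fun setT F ->
    measurable_fun setT (fun o : @Obs R d => F (Zc o)).
  by move=> mF; exact: measurableT_comp mF (@measurable_Zc R d).
have meps : measurable_fun setT (eps (f P)).
  by apply: measurable_funB; [exact: measurable_Xc|exact: mZ].
have mxi : measurable_fun setT (xi (g P)).
  by apply: measurable_funB; [exact: measurable_Yc|exact: mZ].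
have [_ epspn] := cond_exp_residual hf; have [_ xipn] := cond_exp_residual hg.
have hAB : (Pr P n [set om | (th ^+ 2 < `|AfAg P n om / n%:R^-1|)%R] <= q%:E)%E.
  (* [P] returns to the goal before [n] is discharged, so that the threshold on [n] is common to the
     whole family. *)
  move: P FP {iid hf hg hu hv mf mg mu u0 hu2 mv v0 hv2 meps mxi epspn xipn}; near: n.
  exact: (oAB (exprn_gt0 2 th0) q0).
have hBF : (Pr P n [set om | (eta < `|BF P n om / 1|)%R] <= q%:E)%E.
  move: P FP {iid hf hg hu hv mf mg mu u0 hu2 mv v0 hv2 meps mxi epspn xipn hAB}; near: n.
  exact: (oBF eta0 q0).
have hBG : (Pr P n [set om | (eta < `|BG P n om / 1|)%R] <= q%:E)%E.
  move: P FP {iid hf hg hu hv mf mg mu u0 hu2 mv v0 hv2 meps mxi epspn xipn hAB hBF}; near: n.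
  exact: (oBG eta0 q0).
have [E2 E3] := cross_term_events n0 FP (ltW eta0) th0 etaq mf (mFh n) mxi mv v0 hv2 xipn hBF.
have [E2' E3'] := cross_term_events n0 FP (ltW eta0) th0 etaq mg (mGh n) meps mu u0 hu2 epspn hBG.
have [mY iY iY2 EY EY2] := moments FP.
have law := (iid n).1.
have ind i j := @pairwise_prodlaw R dO dA Om Aux d P (Pr P n) n (obs n) (aux n) (mobs n) (maux n) (iid n) i j.
have P4 := iid_mean_sqr_deviation (mobs n) law ind n0 kp0 mY iY2 EY2 (UK P FP) kkp.
have P5 := iid_mean_deviation (mobs n) law ind n0 kp0 mY iY2 iY EY (_ : _ <= 1).
set S1 := [set om | _] in hAB.
set S4 := (X in (Pr P n X <= _)%E) in P4; set S5 := (X in (Pr P n X <= _)%E) in P5.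
have mYX i : measurable_fun setT (fun om => Y P (obs n i om)) by exact: measurableT_comp.
have M1 : measurable S1.
  apply: measurable_set_gt; apply: measurableT_comp => //; apply: measurable_funM => //.
  apply: measurable_funM; apply: measurable_funM => //; apply: measurable_sum => i;
    apply: measurable_funX; apply: measurable_funB; by [exact: mz|exact: maz (mFh n)|exact: maz (mGh n)].
have M4 : measurable S4 /\ (Pr P n S4 <= (2 * q)%:E)%E.
  split.
    apply: measurable_set_gt; apply: measurableT_comp => //; apply: measurable_funB => //.
    by apply: measurable_funM => //; apply: measurable_sum => i; exact: measurable_funX.
  apply: (le_trans P4); rewrite lee_fin (_ : 2 * q = q + q); last by ring.
  by rewrite lerD//; near: n; exact: near_div_le.
have M5 : measurable S5 /\ (Pr P n S5 <= q%:E)%E.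
  split.
    apply: measurable_set_gt; apply: measurableT_comp => //; apply: measurable_funM => //.
    exact: measurable_sum.
  apply: (le_trans (P5 _)); first by rewrite EY2.
  by rewrite lee_fin; near: n; exact: near_div_le.
have [mBad Bade] := union_bound (union_bound (union_bound (conj M1 hAB) E2) (union_bound E2' E3))
   (union_bound E3' (union_bound M4 M5)).
eexists; first (split; first exact: mBad).
  apply: (le_trans Bade); rewrite lee_fin le_eqVlt; apply/orP; left; apply/eqP.
  by rewrite /q; field.
move=> om /= nBad.
apply: good_event_of_bounds => //; rewrite ?kp0//; rewrite leNgt; apply/negP => H; apply: nBad.
- by do 3 left.
- by left; left; right.
- by left; right; left.
- by left; right; right.
- by right; left.
- by right; right; left.
- by right; right; right.
Unshelve. all: by end_near. Qed.


Let clt_data_standardize P n : fam P ->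
  clt_data (Pr P n) P n (obs n) (Y P).
Proof.
move=> FP; have [mY iY iY2 EY EY2] := moments FP.
split => // k kn; exact: (nsum_prodlaw (mobs n) (maux n) ((model FP).1 n) mY kn).
Qed.

(** The relative shift dl |t| costs 34 dl and the absolute shift dl costs 17 dl, together 51 dl. *)
Lemma Phi_shift_le (t dl : R) : 0 <= dl <= 2^-1 ->
  Phi (t + dl * (`|t| + 1)) <= Phi t + 51 * dl /\
  Phi t <= Phi (t - dl * (`|t| + 1)) + 51 * dl.
Proof.
move=> dlb; have [dl0 _] := andP dlb.
have H (sgn : R) : `|sgn| = 1 -> `|Phi (t + sgn * (dl * (`|t| + 1))) - Phi t| <= 51 * dl.
  move=> s1; set x := t + sgn * (dl * `|t|).
  have -> : t + sgn * (dl * (`|t| + 1)) = x + sgn * dl by rewrite /x; ring.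
  have P1 : `|Phi x - Phi t| <= 34 * dl.
    apply: Phi_scale_lipschitz => //.
    by rewrite /x addrAC subrr add0r normrM s1 mul1r normrM normr_id (ger0_norm dl0).
  have P2 : `|Phi (x + sgn * dl) - Phi x| <= 17 * dl.
    rewrite (le_trans (Phi_lipschitz _ _))// addrAC subrr add0r.
    by rewrite normrM s1 mul1r (ger0_norm dl0).
  rewrite -(subrK (Phi x) (Phi (x + _))) -addrA (le_trans (ler_normD _ _))//.
  by move: P1 P2; lra.
split.
  by have := H 1 (normr1 _); rewrite mul1r ler_norml => /andP[_]; lra.
by have := H (-1) (normrN1 _); rewrite mulN1r ler_norml => /andP[+ _]; lra.
Qed.

(** The error budget: e / 4 for the bad event, e / 2 for the central limit theorem, e / 4 for moving
    the threshold. *)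
Lemma dist_squeeze (q ql qu p pl pu c e : R) :
  q <= qu + e / 4 -> ql <= q + e / 4 ->
  `|ql - pl| <= e / 2 -> `|qu - pu| <= e / 2 ->
  pu <= p + c -> p <= pl + c -> c <= e / 4 -> `|q - p| <= e.
Proof.
move=> h1 h2; rewrite !ler_norml => /andP[h3 _] /andP[_ h4] h5 h6 h7.
by apply/andP; split; lra.
Qed.

Lemma studentized_clt : unif_cvg0 fam (fun P n => KSdist (Pr P n) (centered P n)).
Proof.
move=> e e0.
(* With dl = 3 kp, the first entry gives dl <= 1/2 and the second gives 51 dl <= e / 4. *)
pose kp : R := Num.min (6^-1) (e / 4 / 51 / 3).
have kp0 : 0 < kp by rewrite lt_min invr_gt0 ltr0n/= !divr_gt0.
have kp6 : kp <= 6^-1 by rewrite ge_min lexx.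
have kpe : kp <= e / 4 / 51 / 3 by rewrite ge_min lexx orbT.
have e8 : 0 < e / 8 by rewrite divr_gt0.
(* Four shares of e / 8 make up e / 2: the smoothing error, A k, A K / sqrt n and B / n. *)
have [A [B [A0 B0 clt]]] := @clt_bound R dO _ Om (@Obs R d) (e / 8) e8.
have A1 : 0 < 8 * (A + 1) by rewrite mulr_gt0// ltr_wpDl.
pose k := e / (8 * (A + 1)).
have k0 : 0 < k by rewrite divr_gt0.
have Ak : A * k <= e / 8.
  have -> : e / 8 = (A + 1) * k by rewrite /k; field; rewrite gt_eqF// ltr_wpDl.
  by rewrite ler_wpM2r ?(ltW k0)// lerDl.
have [K K0 UK] := UI k0.
have kp01 : 0 < kp <= 1 by rewrite kp0/=; move: kp6; lra.
have e4 : 0 < e / 4 by rewrite divr_gt0.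
near=> n => P FP.
have [n0 good] : (0 < n)%N /\ forall P, fam P ->
    exists2 Bad : set Om, measurable Bad /\ (Pr P n Bad <= (e / 4)%:E)%E &
      forall om, ~ Bad om -> good_event kp P n om.
  by near: n; exact: good_event_near.
have [Bad [mBad PBad] goodBad] := good P FP.
have [mY iY iY2 EY EY2] := moments FP.
have lm := lindeberg_moment_le (mscore FP) (iz2 FP) (var0 FP) n0 K0 (UK P FP).
have AK : A * K / Num.sqrt n%:R <= e / 8 by near: n; exact: near_div_sqrt_le.
have Bn : B / n%:R <= e / 8 by near: n; exact: near_div_le.
have cltS x : `|fine (Pr P n [set om | nsum (obs n) (Y P) n n om <= x]) - Phi x| <= e / 2.
  rewrite (le_trans (clt _ _ _ _ _ x n0 (clt_data_standardize n FP)))//.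
  have : A * lindeberg_moment P (Y P) n <= A * k + A * K / Num.sqrt n%:R.
    by rewrite -mulrA -mulrDr ler_wpM2l.
  by move: Bn AK Ak; lra.
have mW := measurable_nsum n n (mobs n) mY.
apply: ge_ereal_sup => _ [t _ <-]; rewrite lee_fin.
(* One tolerance for [slutsky_le]: it dominates kp for the numerator and equals 3 kp for the
   denominator. *)
pose dl := 3 * kp.
have dl0 : 0 <= dl by rewrite mulr_ge0// ltW.
have dl2 : dl <= 2^-1.
  rewrite /dl mulrC -ler_pdivlMr// (le_trans kp6)// le_eqVlt; apply/orP; left; apply/eqP.
  by field.
have slut om : ~ Bad om ->
    (centered P n om <= t -> nsum (obs n) (Y P) n n om <= t + dl * (`|t| + 1)) /\
    (nsum (obs n) (Y P) n n om <= t - dl * (`|t| + 1) -> centered P n om <= t).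
  move=> /goodBad[r rle [TNE TDle]].
  have -> : centered P n om = (sg P * nsum (obs n) (Y P) n n om + r) / TD n om.
    rewrite /centered /TT /Tstat -/(TN n om) -/(TD n om) TNE -mulrBl; congr (_ / _); ring.
  apply: slutsky_le => //; first exact: sg0.
    by rewrite (le_lt_trans dl2)// invf_lt1// ltr1n.
  apply: (le_trans rle); rewrite ler_wpM2r ?(ltW (sg0 FP))// /dl.
  by rewrite ler_peMl ?(ltW kp0)// ler1n.
have mT := measurable_set_le t (mcentered P n).
have up := fine_probability_le mT (measurable_set_le (t + dl * (`|t| + 1)) mW) mBad PBad
  (fun om T1 nB => (slut om nB).1 T1).
have lo := fine_probability_le (measurable_set_le (t - dl * (`|t| + 1)) mW) mT mBad PBad
  (fun om T1 nB => (slut om nB).2 T1).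
have dlb : 0 <= dl <= 2^-1 by rewrite dl0.
have [p1 p2] := Phi_shift_le t dlb.
have dle : 51 * dl <= e / 4.
  by rewrite /dl mulrC -ler_pdivlMr// mulrC -ler_pdivlMr.
exact: dist_squeeze up lo (cltS _) (cltS _) p1 p2 dle.
Unshelve. all: by end_near. Qed.


(** The good event controls [TD] relative to sigma; the upper bound [s1] turns this into an absolute
    error. *)
Lemma tauD_cvg (s1 : R) : (forall P, fam P -> sg P <= s1) ->
  little_o_fam fam Pr (fun P n om => TD n om - sg P) (fun _ _ _ => 1).
Proof.
move=> sgs1 dl dl0 e e0.
pose kp := Num.min 1 (dl / (3 * (`|s1| + 1))).
have s10 : 0 < 3 * (`|s1| + 1) by rewrite mulr_gt0// ltr_wpDl.
have kp0 : 0 < kp by rewrite lt_min ltr01 divr_gt0.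
have kp1 : 0 < kp <= 1 by rewrite kp0 ge_min lexx.
have kpdl : 3 * kp * (`|s1| + 1) <= dl.
  by rewrite mulrAC -ler_pdivlMl// mulrC ge_min lexx orbT.
near=> n => P FP.
have [n0 good] : (0 < n)%N /\ forall P, fam P ->
    exists2 Bad : set Om, measurable Bad /\ (Pr P n Bad <= e%:E)%E &
      forall om, ~ Bad om -> good_event kp P n om.
  by near: n; exact: good_event_near.
have [Bad [mBad PBad] goodBad] := good P FP.
apply: le_trans PBad; apply: le_measure; rewrite ?inE//.
  apply: measurable_set_gt; apply: measurableT_comp => //.
  by apply: measurable_funM => //; apply: measurable_funB.
move=> om /=; rewrite divr1 => H; apply: contrapT => /goodBad[r _ [_ D]].
move: H; apply/negP; rewrite -leNgt (le_trans D)// (le_trans _ kpdl)//.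
rewrite ler_wpM2l ?mulr_ge0 ?(ltW kp0)// (le_trans (sgs1 P FP))//.
by rewrite (le_trans (ler_norm _))// lerDl.
Unshelve. all: by end_near. Qed.

End core.

(** * Uniform integrability *)

Section uniform_integrability.
Context {R : realType} {d : measure_display} {T : measurableType d}.

Lemma sqr_le1_powR (x eta : R) : 0 <= x -> 0 < eta -> x ^+ 2 <= 1 + x `^ (2 + eta).
Proof.
move=> x0 eta0; have [x1|/ltW x1] := leP x 1.
  by rewrite (@le_trans _ _ 1)// ?exprn_ile1// lerDl powR_ge0.
rewrite (@le_trans _ _ (x `^ (2 + eta)))// ?lerDr//.
by rewrite -powR_mulrn// ler_powR// lerDl ltW.
Qed.

(** Dominated convergence along integer cutoffs: at each point the truncated tail is eventually 0,
    and Y^2 dominates. *)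
Lemma square_uniform_integrable1 (P : probability T R) (Y : T -> R) (k : R) :
  measurable_fun setT Y -> P.-integrable setT (EFin \o (fun o => Y o ^+ 2)) -> 0 < k ->
  exists2 K : R, 0 <= K & \int[P]_o (if `|Y o| <= K then 0 else Y o ^+ 2) <= k.
Proof.
move=> mY iY2 k0.
pose F (m : nat) (o : T) : R := if `|Y o| <= m%:R then 0 else Y o ^+ 2.
have mF m : measurable_fun setT (F m).
  have mc : measurable_fun setT (fun o => `|Y o| <= m%:R).
    by apply: measurable_fun_ler => //; exact: measurableT_comp.
  by apply: measurable_fun_ifT => //; exact: measurable_funX.
have FY m o : `|F m o| <= Y o ^+ 2.
  rewrite /F; case: (`|Y o| <= m%:R); first by rewrite normr0 sqr_ge0.
  by rewrite ger0_norm ?sqr_ge0.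
have F0 o : (F m o)%:E @[m --> \oo] --> 0%E.
  apply: cvg_near_cst; near=> m; rewrite /F ifT//.
  by near: m; exact: nbhs_infty_ger.
have [_ _] := @dominated_convergence d T R P setT measurableT
  (fun m o => (F m o)%:E) (cst 0%E) (fun o => (Y o ^+ 2)%:E)
  (fun m => (measurable_EFinP _ _).2 (mF m)) (measurable_cst _)
  (aeW _ (fun o _ => F0 o)) iY2 (aeW _ (fun o m _ => FY m o)).
rewrite integral0 => /fine_cvgP[_ /cvgrPdist_le/(_ _ k0)] H.
near \oo => m.
have : `|0 - \int[P]_o F m o| <= k by near: m; exact: H.
rewrite sub0r normrN => Fk.
by exists m%:R => //; exact: le_trans (ler_norm _) Fk.
Unshelve. all: by end_near. Qed.

End uniform_integrability.

(** * Uniform integrability from a bounded moment of order 2 + eta *)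

Section uniform_integrability_standardized.
Context {R : realType} {d : nat}.
Variables (fam : set (probability (@Obs R d) R)) (C M s0 eta : R)
  (X z : probability (@Obs R d) R -> @Obs R d -> R).
Hypotheses (C0 : 0 < C) (M0 : 0 <= M) (s00 : 0 < s0) (eta0 : 0 < eta)
  (mX : forall P, fam P -> measurable_fun setT (X P))
  (mz : forall P, fam P -> measurable_fun setT (z P))
  (zX : forall P o, fam P -> `|z P o| <= C * `|X P o|)
  (XM : forall P, fam P -> (\int[P]_o (`|X P o| `^ (2 + eta))%:E <= M%:E)%E).

Let iX P : fam P -> P.-integrable setT (EFin \o (fun o => `|X P o| `^ (2 + eta))).
Proof.
move=> FP; apply/integrableP; split.
  apply/measurable_EFinP; apply: (measurableT_comp (measurable_powR _)).
  exact: measurableT_comp (mX FP).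
rewrite (eq_integral (fun o => (`|X P o| `^ (2 + eta))%:E)); last first.
  by move=> o _; rewrite /= ger0_norm ?powR_ge0.
exact: le_lt_trans (XM FP) (ltry _).
Qed.

Let X2 P o : `|X P o| ^+ 2 <= 1 + `|X P o| `^ (2 + eta).
Proof. exact: sqr_le1_powR. Qed.

Let EX P : fam P -> \int[P]_o (`|X P o| `^ (2 + eta)) <= M.
Proof. by move=> FP; rewrite -lee_fin -Rintegral_fineK ?XM//; exact: iX. Qed.

Lemma moment_square_integrable P : fam P ->
  P.-integrable setT (EFin \o (fun o => z P o ^+ 2)).
Proof.
move=> FP.
have i1 := integrable_mulr (C ^+ 2) (integrable_addr (integrable_cst_probability P 1) (iX FP)).
apply: dominated_integrable i1; first by apply: measurable_funX; exact: mz.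
move=> o; rewrite normrX (@le_trans _ _ ((C * `|X P o|) ^+ 2))//.
  by rewrite lerXn2r ?nnegrE ?zX// mulr_ge0// ltW.
by rewrite exprMn ler_wpM2l ?sqr_ge0.
Qed.

Hypothesis sz : forall P, fam P -> s0 <= Num.sqrt (fine (variance P (z P))).

Let mean_le P : fam P -> `|fine (expectation P (z P))| <= C * (2 + M).
Proof.
move=> FP; have iz := integrable_of_sqr (mz FP) (moment_square_integrable FP).
have -> : fine (expectation P (z P)) = \int[P]_o z P o by rewrite unlock.
rewrite (le_trans (le_normr_Rintegral measurableT iz))//.
have i2 := integrable_addr (integrable_cst_probability P 2) (iX FP).
apply: (@le_trans _ _ (\int[P]_o (C * (2 + `|X P o| `^ (2 + eta))))).
  apply: le_Rintegral => //.
  - exact: integrable_norm.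
  - exact: integrable_mulr.
  - move=> o _; rewrite (le_trans (zX o FP))// ler_wpM2l ?(ltW C0)//.
    have := X2 P o; have := sqr_ge0 (`|X P o| - 1); have := normr_ge0 (X P o); nra.
rewrite RintegralZl// ler_wpM2l ?(ltW C0)// RintegralD//; last 2 first.
- exact: integrable_cst_probability.
- exact: iX.
by rewrite Rintegral_cst_probability lerD2l EX.
Qed.

(** The cutoff is transferred to [X]: if |Y| > K then |X| > L >= 1, hence Y^2 <= D X^2 <= D L^(-eta)
    |X|^(2 + eta), whose mean is at most D M / L^eta. *)
Lemma standardize_uniform_integrable (k : R) : 0 < k ->
  exists2 K : R, 0 <= K & forall P, fam P ->
  \int[P]_o (if `|standardize P (z P) o| <= K then 0 else standardize P (z P) o ^+ 2) <= k.
Proof.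
move=> k0; pose r0 := C * (2 + M).
have r00 : 0 <= r0 by rewrite mulr_ge0 ?(ltW C0)// addr_ge0.
pose D := ((C + r0) / s0) ^+ 2.
have D0 : 0 <= D by exact: sqr_ge0.
(* The power gives D M / L^eta <= k; the added 1 gives |X| >= 1, so that C |X| + r0 <= (C + r0)
   |X|. *)
pose L := 1 + (D * M / k) `^ eta^-1.
have L1 : 1 <= L by rewrite lerDl powR_ge0.
have L0 : 0 < L by exact: lt_le_trans L1.
have Leta : D * M / k <= L `^ eta.
  have DMk : 0 <= D * M / k by apply: divr_ge0; [exact: mulr_ge0|exact: ltW].
  rewrite -[leLHS]powRr1// -[X in _ `^ X](@mulVf _ eta) ?gt_eqF// powRrM.
  by apply: ge0_ler_powR; rewrite ?nnegrE ?powR_ge0 ?(ltW eta0) ?(ltW L0) ?lerDr.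
(* The bound (C x + r0) / s0 on |Y| at |X| = x, evaluated at x = L; exceeding it forces |X| > L. *)
exists ((C * L + r0) / s0).
  by apply: divr_ge0; [apply: addr_ge0 => //; apply: mulr_ge0|]; exact: ltW.
move=> P FP; set K := (C * L + r0) / s0.
have sg0 := lt_le_trans s00 (sz FP).
have var0 : 0 < fine (variance P (z P)) by rewrite -sqrtr_gt0.
have [mY iY iY2 _ _] := standardize_moments (mz FP) (moment_square_integrable FP) var0.
have iU : P.-integrable setT (EFin \o (fun o => if `|standardize P (z P) o| <= K then 0 else standardize P (z P) o ^+ 2)).
  apply: (dominated_integrable _ _ iY2).
    have mc : measurable_fun setT (fun o => `|standardize P (z P) o| <= K).
      by apply: measurable_fun_ler => //; exact: (measurableT_comp (@normr_measurable R setT) mY).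
    by apply: measurable_fun_ifT => //; exact: measurable_funX.
  move=> o; case: (`|standardize P (z P) o| <= K); first by rewrite normr0 sqr_ge0.
  by rewrite ger0_norm ?sqr_ge0.
apply: (@le_trans _ _ (\int[P]_o (D / L `^ eta * `|X P o| `^ (2 + eta)))).
  apply: le_Rintegral => //; first by apply: integrable_mulr; exact: iX.
  move=> o _; case: ifPn => [_|].
    by rewrite mulr_ge0 ?divr_ge0 ?powR_ge0.
  rewrite -ltNge => KY; set x := `|X P o|.
  have Yx : `|standardize P (z P) o| <= (C * x + r0) / s0.
    rewrite /standardize normrM normfV (ger0_norm (sqrtr_ge0 _)).
    apply: ler_pM => //.
      rewrite (le_trans (ler_normB _ _))// lerD ?zX//; exact: mean_le.
    by rewrite lef_pV2 ?posrE// sz.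
  have Lx : L < x.
    have := lt_le_trans KY Yx.
    by rewrite /K ltr_pM2r ?invr_gt0// ltrD2r ltr_pM2l.
  have x0 : 0 < x by exact: lt_trans Lx.
  have Y2 : standardize P (z P) o ^+ 2 <= D * x ^+ 2.
    rewrite -[leLHS](real_normK (num_real _)) /D -exprMn.
    have cx : 0 <= (C + r0) / s0 * x.
      apply: mulr_ge0; last exact: ltW.
      by apply: divr_ge0; [apply: addr_ge0 => //|]; exact: ltW.
    rewrite lerXn2r ?nnegrE// (le_trans Yx)// mulrAC ler_wpM2r ?invr_ge0 ?(ltW s00)//.
    rewrite mulrDl lerD2l ler_peMr//; exact: ltW (le_lt_trans L1 Lx).
  apply: (le_trans Y2); rewrite powRD; last by rewrite (gt_eqF x0) implybT.
  rewrite powR_mulrn ?(ltW x0)// -mulrA ler_wpM2l//.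
  rewrite mulrCA ler_peMr ?sqr_ge0// mulrC ler_pdivlMr ?powR_gt0// mul1r.
  by apply: ge0_ler_powR; rewrite ?nnegrE ?(ltW eta0) ?(ltW L0) ?(ltW x0) ?(ltW Lx).
rewrite RintegralZl//; last exact: iX.
apply: (@le_trans _ _ (D / L `^ eta * M)).
  by apply: ler_wpM2l; [rewrite divr_ge0 ?powR_ge0|exact: EX].
rewrite mulrAC ler_pdivrMr ?powR_gt0// -ler_pdivrMl// mulrC.
exact: Leta.
Qed.

End uniform_integrability_standardized.

Lemma KSdist_ge0 (R : realType) (dO : measure_display) (Om : measurableType dO)
  (Q : probability Om R) (S : Om -> R) : (0 <= KSdist Q S)%E.
Proof.
apply: (@le_trans _ _ (`|fine (Q [set om | S om <= 0]) - Phi 0|)%:E); first by rewrite lee_fin.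
by apply: ereal_sup_ubound; exists 0.
Qed.

Theorem theorem2 (R : realType) (d : nat) (dO dA : measure_display)
    (Om : measurableType dO) (Aux : measurableType dA)
    (Pr : probability (Obs d) R -> nat -> probability Om R)
    (obs : nat -> nat -> Om -> Obs d) (aux : nat -> Om -> Aux)
    (Fh Gh : nat -> Aux -> Zsp d -> R)
    (w : Zsp d -> R) (C : R)
    (f g u v : probability (Obs d) R -> Zsp d -> R) :
  (forall n i, measurable_fun setT (obs n i)) ->
  (forall n, measurable_fun setT (aux n)) ->
  (forall n, measurable_fun setT (fun p : Aux * Zsp d => Fh n p.1 p.2)) ->
  (forall n, measurable_fun setT (fun p : Aux * Zsp d => Gh n p.1 p.2)) ->
  measurable_fun setT w -> 0 < C -> (forall z, `|w z| <= C) ->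
  let smp n om := fun i => obs n i om in
  let fh n om := Fh n (aux n om) in
  let gh n om := Gh n (aux n om) in
  let TT n om := Tstat n (smp n om) (fh n om) (gh n om) w in
  let TD n om := tauD n (smp n om) (fh n om) (gh n om) w in
  let AfAg P n om := Af n (smp n om) (fh n om) (f P) * Ag n (smp n om) (gh n om) (g P) in
  let BF P n om := Bf n (smp n om) (fh n om) (f P) (v P) in
  let BG P n om := Bg n (smp n om) (gh n om) (g P) (u P) in
  let centered P n om := TT n om - Num.sqrt n%:R * rho P (f P) (g P) w / TD n om in
  let model P := (forall n, iid_indep_aux P (Pr P n) n (obs n) (aux n)) /\
                 regr_functions P (f P) (g P) (u P) (v P) in
  (* Part 1 *)
  (forall P : probability (Obs d) R,
     in_E0 P -> model P ->
     little_o_fam [set P] Pr AfAg (fun _ n _ => n%:R^-1) ->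
     little_o_fam [set P] Pr BF (fun _ _ _ => 1) ->
     little_o_fam [set P] Pr BG (fun _ _ _ => 1) ->
     0 < sigma2 P (f P) (g P) w ->
     (\int[P]_o ((eps (f P) o ^+ 2 * xi (g P) o ^+ 2)%:E) < +oo)%E ->
     (fun n => KSdist (Pr P n) (centered P n)) @ \oo --> 0%E /\
     little_o_fam [set P] Pr
       (fun P n om => TD n om - Num.sqrt (sigma2 P (f P) (g P) w))
       (fun _ _ _ => 1)) /\
  (* Part 2 *)
  (forall fam : set (probability (Obs d) R),
     fam `<=` in_E0 -> (forall P, fam P -> model P) ->
     little_o_fam fam Pr AfAg (fun _ n _ => n%:R^-1) ->
     little_o_fam fam Pr BF (fun _ _ _ => 1) ->
     little_o_fam fam Pr BG (fun _ _ _ => 1) ->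
     (0 < ereal_inf [set (sigma2 P (f P) (g P) w)%:E | P in fam])%E ->
     (exists eta : R, 0 < eta /\
        (ereal_sup [set \int[P]_o ((`|eps (f P) o * xi (g P) o| `^ (2 + eta))%:E)
                   | P in fam] < +oo)%E) ->
     unif_cvg0 fam (fun P n => KSdist (Pr P n) (centered P n))).
Proof.
move=> mobs maux mFh mGh mw C0 wC smp fh gh TT TD AfAg BF BG centered model.
have meps P : regr_functions P (f P) (g P) (u P) (v P) ->
    measurable_fun setT (eps (f P)) /\ measurable_fun setT (xi (g P)).
  move=> [[mf _] [[mg _] _]].
  split; apply: measurable_funB.
  - exact: measurable_Xc.
  - exact: measurableT_comp mf (@measurable_Zc R d).
  - exact: measurable_Yc.
  - exact: measurableT_comp mg (@measurable_Zc R d).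
have mscore P : regr_functions P (f P) (g P) (u P) (v P) ->
    measurable_fun setT (score w f g P).
  move=> /meps[me mx]; apply: measurable_funM; first exact: measurable_funM.
  exact: measurableT_comp mw (@measurable_Zc R d).
split.
  (* The family is {P}, with sigma itself as both lower and upper bound; square integrability of the
     score comes from |w| <= C. *)
  move=> P _ modelP oAB oBF oBG var0 fin.
  have mS := mscore P modelP.2; have [me mx] := meps P modelP.2.
  have modelF P' : [set P] P' -> model P' by move=> ->.
  have iex : P.-integrable setT (EFin \o (fun o => eps (f P) o ^+ 2 * xi (g P) o ^+ 2)).
    apply/integrableP; split.
      by apply/measurable_EFinP; apply: measurable_funM; apply: measurable_funX.
    rewrite (eq_integral (fun o => (eps (f P) o ^+ 2 * xi (g P) o ^+ 2)%:E))//.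
    by move=> o _; rewrite /= ger0_norm// mulr_ge0// sqr_ge0.
  have iz2 : P.-integrable setT (EFin \o (fun o => score w f g P o ^+ 2)).
    apply: dominated_integrable (integrable_mulr (C ^+ 2) iex); first exact: measurable_funX.
    move=> o; rewrite ger0_norm ?sqr_ge0// /score.
    have -> : (eps (f P) o * xi (g P) o * w (Zc o)) ^+ 2 =
        w (Zc o) ^+ 2 * (eps (f P) o ^+ 2 * xi (g P) o ^+ 2) by ring.
    apply: ler_wpM2r; first by apply: mulr_ge0; exact: sqr_ge0.
    by rewrite -(real_normK (num_real (w (Zc o)))) lerXn2r ?nnegrE ?(ltW C0).
  have iz2F P' : [set P] P' -> P'.-integrable setT (EFin \o (fun o => score w f g P' o ^+ 2)).
    by move=> ->.
  have [mY _ iY2 _ _] := standardize_moments mS iz2 var0.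
  have UI k : 0 < k -> exists2 K : R, 0 <= K & forall P', [set P] P' ->
      \int[P']_o (if `|standardize P' (score w f g P') o| <= K then 0 else standardize P' (score w f g P') o ^+ 2) <= k.
    move=> k0; have [K K0 UK] := square_uniform_integrable1 mY iY2 k0.
    by exists K => // P' ->.
  have sg0 : 0 < Num.sqrt (sigma2 P (f P) (g P) w) by rewrite sqrtr_gt0.
  have s0F P' : [set P] P' -> Num.sqrt (sigma2 P (f P) (g P) w) <= Num.sqrt (sigma2 P' (f P') (g P') w).
    by move=> ->.
  have s1F P' : [set P] P' -> Num.sqrt (sigma2 P' (f P') (g P') w) <= Num.sqrt (sigma2 P (f P) (g P) w).
    by move=> ->.
  split; last first.
    have H := tauD_cvg mobs maux mFh mGh mw C0 wC modelF oAB oBF oBG sg0 s0F iz2F UI s1F.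
    move=> dl dl0 e e0; have := H dl dl0 e e0; apply: filterS => n Hn P' PP'.
    by have := Hn P' PP'; rewrite PP'.
  have H := studentized_clt mobs maux mFh mGh mw C0 wC modelF oAB oBF oBG sg0 s0F iz2F UI.
  have KSe e : 0 < e -> \forall n \near \oo, (KSdist (Pr P n) (centered P n) <= e%:E)%E.
    by move=> e0; have := H e e0; apply: filterS => n /(_ P erefl).
  (* The distance is an extended real, so eventual finiteness is shown before convergence of its
     real part. *)
  apply/fine_cvgP; split.
    have := KSe 1 ltr01; apply: filterS => n Kn.
    by rewrite ge0_fin_numE ?KSdist_ge0// (le_lt_trans Kn)// ltry.
  apply/cvgrPdist_le => e e0; have := KSe e e0; apply: filterS => n Kn.
  rewrite sub0r normrN ger0_norm ?fine_ge0 ?KSdist_ge0//.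
  rewrite -lee_fin fineK// ge0_fin_numE ?KSdist_ge0//.
  by rewrite (le_lt_trans Kn)// ltry.
move=> fam _ modelF oAB oBF oBG inf0 [eta [eta0 supM]].
(* For the empty family the infimum is +oo, and the value 1 serves as lower bound. *)
have [s2 s20 s2le] : exists2 s2 : R, 0 < s2 & forall P, fam P -> s2 <= sigma2 P (f P) (g P) w.
  have infle P : fam P -> (ereal_inf [set (sigma2 P (f P) (g P) w)%:E | P in fam] <= (sigma2 P (f P) (g P) w)%:E)%E.
    by move=> FP; apply: ereal_inf_lbound; exists P.
  move: inf0 infle; case: ereal_inf => [r||] //=.
    by rewrite lte_fin => r0 rle; exists r => // P /rle; rewrite lee_fin.
  by move=> _ H; exists 1 => // P /H; rewrite leye_eq.
(* The maximum with 0 secures M >= 0; a supremum equal to -oo, as for the empty family, is bounded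
   by 0. *)
have [M M0 MX] : exists2 M : R, 0 <= M & forall P, fam P ->
    (\int[P]_o (`|eps (f P) o * xi (g P) o| `^ (2 + eta))%:E <= M%:E)%E.
  have suple P : fam P -> (\int[P]_o (`|eps (f P) o * xi (g P) o| `^ (2 + eta))%:E <=
     ereal_sup [set \int[P]_o ((`|eps (f P) o * xi (g P) o| `^ (2 + eta))%:E) | P in fam])%E.
    by move=> FP; apply: ereal_sup_ubound; exists P.
  move: supM suple; case: ereal_sup => [r||] //=.
    move=> _ H; exists (Num.max r 0); first by rewrite le_max lexx orbT.
    by move=> P /H /le_trans; apply; rewrite lee_fin le_max lexx.
  move=> _ H; exists 0 => // P /H /le_trans; apply.
  exact: leNye.
have sg0 : 0 < Num.sqrt s2 by rewrite sqrtr_gt0.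
have s0F P : fam P -> Num.sqrt s2 <= Num.sqrt (sigma2 P (f P) (g P) w).
  by move=> FP; rewrite ler_sqrt ?s2le// (le_trans (ltW s20))// s2le.
have mX P : fam P -> measurable_fun setT (fun o => eps (f P) o * xi (g P) o).
  by move=> /modelF[_ /meps[me mx]]; exact: measurable_funM.
have mz P : fam P -> measurable_fun setT (score w f g P).
  by move=> /modelF[_ /mscore].
have zX P o : fam P -> `|score w f g P o| <= C * `|eps (f P) o * xi (g P) o|.
  by move=> _; rewrite /score normrM mulrC ler_wpM2r.
have iz2 P (FP : fam P) := moment_square_integrable C0 eta0 mX mz zX MX FP.
have UI := standardize_uniform_integrable C0 M0 sg0 eta0 mX mz zX MX s0F.
exact: (studentized_clt mobs maux mFh mGh mw C0 wC modelF oAB oBF oBG sg0 s0F iz2 UI).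
Qed.
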